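(* Let $G$ be a connected planar graph with $n$ vertices and $m$ edges. Then $mc(G)\leq m-n+4$ and the following hold. (1) If $G$ is not $2$-connected, then $mc(G)=m-n+2$. (2) If $G$ is $2$-connected but not $3$-connected, then $m-n+2\leq mc(G)\leq m-n+3$, and $mc(G)=m-n+3$ if and only if $G\in\mathcal{P}_1$. (3) If $G$ is $3$-connected but not $4$-connected, then $m-n+2\leq mc(G)\leq m-n+4$. Moreover, $mc(G)=m-n+4$ if and only if $G=K_2\vee P_{n-2}$, and $mc(G)=m-n+3$ if and only if either $G\in\mathcal{P}_2$ or $G=2K_1\vee P_{n-2}$. (4) If $G$ is $4$-connected but not $5$-connected, then $m-n+2\leq mc(G)\leq m-n+3$, and $mc(G)=m-n+3$ if and only if $G=2K_1\vee C_{n-2}$. (5) If $G$ is $5$-connected, then $mc(G)=m-n+2$.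
   Context: All graphs are simple, finite and undirected; equalities of graphs are up to isomorphism. A complete graph $K_{p}$ is regarded as $(p-1)$-connected but not $p$-connected. An edge-coloring of a connected graph $G$ (an arbitrary assignment of colors to edges) is a monochromatic connection coloring (MC-coloring) if any two vertices of $G$ are connected by a path all of whose edges have the same color. The monochromatic connection number $mc(G)$ is the maximum number of colors used in an MC-coloring of $G$. $G\vee H$ denotes the join of vertex-disjoint graphs $G$ and $H$ (add all edges between $V(G)$ and $V(H)$); for a single vertex $v$, $v\vee H$ is the join of the one-vertex graph on $v$ with $H$. $P_p$ is the path with $p$ vertices, $C_p$ is the cycle with $p$ edges, and $2K_1$ is the graph with two vertices and no edges. A planar graph is outerplanar if it has a planar embedding with every vertex on the boundary of the unbounded face. $\mathcal{P}_1$ is the set of graphs $v\vee H$, where $H$ is a connected outerplanar graph with a cut-vertex. $\mathcal{P}_2$ is the set of graphs $v\vee H$, where $H$ is a $2$-connected outerplanar graph and $H\neq u\vee P_{n-2}$, where $n=|V(v\vee H)|=|V(H)|+1$ (i.e. $H$ is not the join of a single vertex with a path on $|V(H)|-1$ vertices).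
   Formalization: The equivalence in (2) is stated for G other than K_3, since mc(K_3)=3=m-n+3 but K_3 is not in P_1 (K_2 has no cut-vertex); connected means 1-connected, so K_1, for which (1) fails (mc=0, m-n+2=1), is excluded. *)

(* Defs.v *)
From mathcomp Require Import all_boot all_order all_algebra.
From mathcomp Require Import all_classical all_reals all_analysis.
Import Order.TTheory GRing.Theory Num.Theory.
Import numFieldNormedType.Exports.

Set Implicit Arguments.
Unset Strict Implicit.
Unset Printing Implicit Defensive.

Record sgraph := SGraph {
  vertex :> finType;
  adj : rel vertex;
  adj_sym : symmetric adj;
  adj_irrefl : irreflexive adj }.

Definition isomorphic (G H : sgraph) : Prop :=
  exists f : G -> H, bijective f /\ forall x y, adj (f x) (f y) = adj x y.

Notation "G ≅ H" := (isomorphic G H) (at level 70).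

Definition edges (G : sgraph) : {set {set G}} :=
  [set [set p.1; p.2]%SET | p in [pred p : G * G | adj p.1 p.2]]%SET.

Section Complete.
Variable p : nat.
Definition complete_adj : rel 'I_p := fun i j => i != j.
Lemma complete_adj_sym : symmetric complete_adj.
Proof. by move=> i j; rewrite /complete_adj eq_sym. Qed.
Lemma complete_adj_irrefl : irreflexive complete_adj.
Proof. by move=> i; rewrite /complete_adj eqxx. Qed.
Definition complete := SGraph complete_adj_sym complete_adj_irrefl.
End Complete.

Section Edgeless.
Variable p : nat.
Definition edgeless_adj : rel 'I_p := fun _ _ => false.
Lemma edgeless_adj_sym : symmetric edgeless_adj. Proof. by []. Qed.
Lemma edgeless_adj_irrefl : irreflexive edgeless_adj. Proof. by []. Qed.
Definition edgeless := SGraph edgeless_adj_sym edgeless_adj_irrefl.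
End Edgeless.

Section PathGraph.
Variable p : nat.
Definition path_adj : rel 'I_p :=
  fun i j => (j == i.+1 :> nat) || (i == j.+1 :> nat).
Lemma path_adj_sym : symmetric path_adj.
Proof. by move=> i j; rewrite /path_adj orbC. Qed.
Lemma path_adj_irrefl : irreflexive path_adj.
Proof. by move=> i; rewrite /path_adj orbb ltn_eqF. Qed.
Definition path_graph := SGraph path_adj_sym path_adj_irrefl.
End PathGraph.

(* A cycle with p edges only for 3 <= p; for p < 3 this is [complete p]. *)
Section CycleGraph.
Variable p : nat.
Definition cycle_adj : rel 'I_p := fun i j =>
  (i != j) && ((j == i.+1 %% p :> nat) || (i == j.+1 %% p :> nat)).
Lemma cycle_adj_sym : symmetric cycle_adj.
Proof. by move=> i j; rewrite /cycle_adj eq_sym orbC. Qed.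
Lemma cycle_adj_irrefl : irreflexive cycle_adj.
Proof. by move=> i; rewrite /cycle_adj eqxx. Qed.
Definition cycle_graph := SGraph cycle_adj_sym cycle_adj_irrefl.
End CycleGraph.

Section GraphJoin.
Variables G H : sgraph.
Definition join_adj : rel (G + H)%type := fun u v =>
  match u, v with
  | inl x, inl y => adj x y
  | inr x, inr y => adj x y
  | _, _ => true
  end.
Lemma join_adj_sym : symmetric join_adj.
Proof. by move=> [x|x] [y|y] //=; rewrite adj_sym. Qed.
Lemma join_adj_irrefl : irreflexive join_adj.
Proof. by move=> [x|x] /=; rewrite adj_irrefl. Qed.
Definition graph_join := SGraph join_adj_sym join_adj_irrefl.
End GraphJoin.

Notation "G ∨ H" := (graph_join G H) (at level 50, left associativity).

Definition induced_connected (G : sgraph) (A : {set G}) : bool :=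
  [forall x in A, forall y in A,
     connect [rel u v | [&& u \in A, v \in A & adj u v]] x y].

(* The clause [k < #|G|] makes the complete graph on p vertices
   (p-1)-connected but not p-connected.  "Connected" always means
   [kconnected 1], which for p = 1 rules out the one-vertex graph. *)
Definition kconnected (k : nat) (G : sgraph) : bool :=
  (k < #|G|)%N &&
  [forall S : {set G}, (#|S| < k)%N ==> induced_connected (~: S)].

(* Meant for connected graphs. *)
Definition cut_vertex (G : sgraph) (x : G) : bool :=
  ~~ induced_connected (~: [set x])%SET.

(* Only the values of [c] on edges matter. *)
Definition mono_adj (G : sgraph) (C : finType) (c : {ffun {set G} -> C})
    (k : C) : rel G :=
  [rel x y | adj x y && (c [set x; y]%SET == k)].

Definition mc_coloring (G : sgraph) (C : finType) (c : {ffun {set G} -> C}) :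
    bool :=
  [forall x, forall y, exists k, connect (mono_adj c k) x y].

(* A coloring uses at most as many colors as there are edges, so a palette of
   that size is no restriction. *)
Definition mc (G : sgraph) : nat :=
  \max_(c : {ffun {set G} -> 'I_#|edges G|} | mc_coloring c)
     #|(c @: edges G)%SET|.

Local Open Scope classical_set_scope.
Local Open Scope ring_scope.

Definition plane (R : realType) := (R * R)%type.

Definition simple_arc (R : realType) (a b : plane R) (S : set (plane R)) :
    Prop :=
  exists g : R -> plane R,
    [/\ {within `[0, 1], continuous g}, set_inj `[0, 1] g,
        g 0 = a, g 1 = b & g @` `[0, 1] = S].

Record drawing (R : realType) (G : sgraph) := Drawing {
  point : G -> plane R;
  curve : {set G} -> set (plane R);
  point_inj : injective point;
  curve_arc : forall x y : G, adj x y ->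
    simple_arc (point x) (point y) (curve [set x; y]%SET);
  curve_point : forall (e : {set G}) (z : G),
    e \in edges G -> curve e (point z) -> z \in e;
  curve_disjoint : forall e e' : {set G},
    e \in edges G -> e' \in edges G -> e != e' ->
    curve e `&` curve e' `<=` range point }.

Definition planar (R : realType) (G : sgraph) : Prop :=
  inhabited (drawing R G).

Definition support (R : realType) (G : sgraph) (d : drawing R G) :
    set (plane R) :=
  range (point d) `|` \bigcup_(e in [set` edges G]) curve d e.

Definition face (R : realType) (G : sgraph) (d : drawing R G)
    (F : set (plane R)) : Prop :=
  exists2 p, ~ support d p & F = connected_component (~` support d) p.

Definition boundary (R : realType) (A : set (plane R)) : set (plane R) :=
  closure A `\` interior A.

Definition outerplanar (R : realType) (G : sgraph) : Prop :=
  exists (d : drawing R G) (F : set (plane R)),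
    [/\ face d F, ~ bounded_set F & forall x, boundary F (point d x)].

Definition P1 (R : realType) (G : sgraph) : Prop :=
  exists H : sgraph,
    [/\ G ≅ complete 1 ∨ H, kconnected 1 H, outerplanar R H
      & exists x : H, cut_vertex x].

Definition P2 (R : realType) (G : sgraph) : Prop :=
  exists H : sgraph,
    [/\ G ≅ complete 1 ∨ H, kconnected 2 H, outerplanar R H
      & ~ H ≅ complete 1 ∨ path_graph (#|G| - 2)].

(* Main.v *)
Require Import Defs.
From mathcomp Require Import all_boot all_order all_algebra all_reals.
From mathcomp Require Import zify.

Set Implicit Arguments.
Unset Strict Implicit.
Unset Printing Implicit Defensive.

(* In an MC-coloring with K colors, the components of the color classes that have
   at least three vertices are connected sets B, any two nonadjacent vertices lie
   in one of them, and the sum of the numbers |B| - 2 is at most m - K. A planar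
   graph misses at least (n-3)(n-4)/2 edges, whereas a connected set B spans at
   most (|B|-1)(|B|-2)/2 nonadjacent pairs. Hence K >= m - n + 3 forces, up to small
   cases with n = 6, 7, some B of size n - 1 or n - 2: there is either a dominating
   vertex with a connected rest, or a pair u, w of vertices adjacent to all others
   with a connected rest, which is a path or a cycle since G has no K_{3,3}.
   Conversely, giving one color to a spanning tree of the rest attains the bound.
   For a cut vertex v the sets B containing v form a connected hypergraph on the
   n - 1 other vertices, so the sum of the |B| - 2 is at least n - 2.

   Planarity is used in two ways. To exclude K_5 minors and K_{3,3}, disjoint curves
   are approximated by disjoint polygonal chains; for two such chains, the number
   of segments above the four ends has a parity depending only on the horizontal
   order of the ends, and summing over all independent pairs gives a contradiction.
   Secondly, inversion about a dominating vertex turns a drawing of G into an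
   outerplanar drawing of the rest. *)

(** * Connected sets and clique minors *)

(** Drawings consist of arbitrary arcs, so the edge bound is obtained without faces and without
    Euler's formula. It is Mader's theorem that a graph without K_5 minor has at most 3n - 6 edges,
    and it rests on the fact that a graph without K_4 minor on at least four vertices has two
    nonadjacent vertices of degree at most 2. Hence K_5 has to be excluded as a minor, and the
    parity argument runs on continua, the drawings of unions of two branch sets, rather than on
    arcs. It looks only at pairs of edges without a common end, so continua sharing a branch set may
    meet. K_{3,3} is excluded as a subgraph only. With N = n - 3, counting ordered nonadjacent pairs
    gives N(N - 1) <= sum of (|B| - 1)(|B| - 2) <= (b - 1)W, where b is the largest |B| and W is the
    sum of the |B| - 2. Together with b - 2 <= W this squeezes b, if there is any B at all: W = N -
    1 forces b = N + 1, and W = N forces b to be N + 2, N + 1 or N, the last only for N = 3 and N =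
    4. *)

Section Connectivity.
Variable G : sgraph.
Implicit Types (x y z : G) (A B S : {set G}).

Definition nbr x : {set G} := [set y | adj x y].

Lemma in_nbr x y : (y \in nbr x) = adj x y. Proof. by rewrite inE. Qed.

Lemma adj_neq x y : adj x y -> x != y.
Proof. by apply: contraTneq => ->; rewrite adj_irrefl. Qed.

(** Connectivity is used and proved through sets closed under adjacency inside [A], which avoids
    handling explicit paths. *)
Definition closed_in A S :=
  forall u v, u \in A -> v \in A -> adj u v -> u \in S -> v \in S.

Lemma connected_closed A x S :
  induced_connected A -> x \in A -> x \in S -> closed_in A S -> A \subset S.
Proof.
move=> /'forall_implyP hA xA xS cS; apply/subsetP => y yA.
have /'forall_implyP /(_ _ yA) /connectP[p] := hA _ xA.
elim: p x xA xS => [|z p IH] x xA xS /=; first by move=> _ ->.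
move=> /andP[/and3P[_ zA xz] hp] hy; apply: (IH z) => //.
exact: (cS x).
Qed.

Lemma connected_root A x : x \in A ->
  (forall S, x \in S -> closed_in A S -> A \subset S) -> induced_connected A.
Proof.
move=> xA h; set e := [rel u v | [&& u \in A, v \in A & adj u v]].
have se : connect_sym e.
  by apply: sym_connect_sym => u v /=; rewrite adj_sym andbCA.
have: A \subset [set y | connect e x y].
  apply: h => [|u v uA vA uv]; first by rewrite inE connect0.
  rewrite !inE => /connect_trans; apply; apply: connect1 => /=.
  by rewrite uA vA.
move=> /subsetP hs; apply/'forall_implyP => u uA; apply/'forall_implyP => v vA.
have := hs _ uA; have := hs _ vA; rewrite !inE => xv.
by rewrite se => /connect_trans; apply.
Qed.

Lemma connected_intro A :
  (forall x S, x \in A -> x \in S -> closed_in A S -> A \subset S) ->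
  induced_connected A.
Proof.
move=> h; case: (set_0Vmem A) => [->|[x xA]].
  by apply/'forall_implyP => x; rewrite inE.
by apply: (connected_root xA) => S; apply: h.
Qed.

Lemma connected_set1 x : induced_connected [set x].
Proof.
by apply: (@connected_root _ x) => [|S xS _]; rewrite ?inE // sub1set.
Qed.

Definition touching A B := [exists x in A, exists y in B, adj x y].

Lemma touchingP A B :
  reflect (exists x y, [/\ x \in A, y \in B & adj x y]) (touching A B).
Proof.
apply: (iffP existsP) => [[x /andP[xA /existsP[y /andP[yB xy]]]]|].
  by exists x, y.
by case=> x [y [xA yB xy]]; exists x; rewrite xA; apply/existsP; exists y; rewrite yB.
Qed.

Lemma touching_sym A B : touching A B = touching B A.
Proof.
by apply/touchingP/touchingP => -[x [y [? ?]]]; rewrite adj_sym; exists y, x.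
Qed.

Lemma connected_setU A B : induced_connected A -> induced_connected B ->
  touching A B -> induced_connected (A :|: B).
Proof.
move=> cA cB /touchingP[x [y [xA yB xy]]].
apply: (@connected_root _ x) => [|S xS cS]; first by rewrite inE xA.
rewrite subUset (connected_closed cA xA xS) /=; last first.
  by move=> u v uA vA; apply: cS; rewrite inE ?uA ?vA.
apply: (connected_closed cB yB).
  by apply: (cS x) => //; rewrite inE ?xA ?yB ?orbT.
by move=> u v uB vB; apply: cS; rewrite inE ?uB ?vB orbT.
Qed.

Lemma connected_setU1 x A : induced_connected A ->
  touching [set x] A -> induced_connected (x |: A).
Proof. by move=> cA; apply: connected_setU => //; apply: connected_set1. Qed.

Lemma connected_edge x y : adj x y -> induced_connected [set x; y].
Proof.
move=> xy; apply: connected_setU1; first exact: connected_set1.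
by apply/touchingP; exists x, y; rewrite !inE.
Qed.

Lemma touching1 x y : touching [set x] [set y] = adj x y.
Proof.
apply/touchingP/idP => [[u [w [/set1P-> /set1P->]]] //|xy].
by exists x, y; rewrite !inE.
Qed.

Lemma connected_dominated A x : x \in A ->
  (forall y, y \in A -> y != x -> adj x y) -> induced_connected A.
Proof.
move=> xA h; apply: (connected_root xA) => S xS cS; apply/subsetP => y yA.
by have [->//|yx] := eqVneq y x; apply: (cS x y) => //; apply: h.
Qed.

(** The branch sets of a clique minor. [pairwise] looks at each pair in one order, which suffices
    since disjointness and touching are symmetric. *)
Definition clique_model (s : seq {set G}) :=
  all (fun A => (A != set0) && induced_connected A) s &&
  pairwise (fun A B => [disjoint A & B] && touching A B) s.

Lemma clique_model_cons A s : clique_model (A :: s) =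
  [&& A != set0, induced_connected A,
      all (fun B => [disjoint A & B] && touching A B) s & clique_model s].
Proof. by rewrite /clique_model /= -!andbA; do 2!congr andb; rewrite andbCA. Qed.

End Connectivity.

Definition complete_minor k (G : sgraph) :=
  exists s : seq {set G}, size s = k /\ clique_model s.

(** * Induced subgraphs and their minors *)

Section Induced.
Variables (G : sgraph) (A : {set G}).

Definition induced_adj : rel {x : G | x \in A} := fun x y => adj (val x) (val y).
Lemma induced_adj_sym : symmetric induced_adj.
Proof. by move=> x y; apply: adj_sym. Qed.
Lemma induced_adj_irrefl : irreflexive induced_adj.
Proof. by move=> x; apply: adj_irrefl. Qed.
Definition induced_graph := SGraph induced_adj_sym induced_adj_irrefl.

Lemma card_induced : #|induced_graph| = #|A|.
Proof. exact: card_sig. Qed.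

Definition lift_set (B : {set induced_graph}) : {set G} := [set val x | x in B].

Lemma lift_set_connected (B : {set induced_graph}) :
  induced_connected (lift_set B) = induced_connected B.
Proof.
apply/idP/idP => c; apply: connected_intro.
  move=> x S xB xS cS; have: lift_set B \subset lift_set S.
    apply: (@connected_closed _ _ (val x)) => //; try by apply/imset_f.
    move=> _ _ /imsetP[u uB ->] /imsetP[w wB ->] uw /imsetP[u' u'S /val_inj uu'].
    by apply/imset_f; apply: (cS u) => //; rewrite uu'.
  move=> /subsetP h; apply/subsetP => y yB.
  by have /imsetP[z zS /val_inj->] := h (val y) (imset_f _ yB).
move=> _ S /imsetP[x xB ->] xS cS.
have: B \subset [set z : induced_graph | val z \in S].
  apply: (@connected_closed induced_graph _ x) => //; rewrite ?inE //.
  move=> u w uB wB uw; rewrite !inE; apply: cS => //; exact: imset_f.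
by move=> /subsetP h; apply/subsetP => _ /imsetP[y /h + ->]; rewrite inE.
Qed.

Lemma lift_set_disjoint (B C : {set induced_graph}) :
  [disjoint B & C] -> [disjoint lift_set B & lift_set C].
Proof.
move=> /pred0P d; apply/pred0P => z /=; apply/negP => /andP[/imsetP[x xB ->]].
by case/imsetP => y yC /val_inj xy; have := d x; rewrite /= xB xy yC.
Qed.

Lemma lift_set_touching (B C : {set induced_graph}) :
  touching B C -> touching (lift_set B) (lift_set C).
Proof.
by case/touchingP => x [y [xB yC xy]]; apply/touchingP; exists (val x), (val y);
  split; [exact: imset_f|exact: imset_f|].
Qed.

Lemma lift_clique_model (s : seq {set induced_graph}) :
  clique_model s -> clique_model (map lift_set s).
Proof.
elim: s => [//|B s IH]; rewrite map_cons !clique_model_cons.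
case/and4P => B0 cB /allP hB /IH->; rewrite lift_set_connected cB andbT /=.
rewrite imset_eq0 B0 /=; apply/allP => _ /mapP[C /hB /andP[? ?] ->].
by rewrite lift_set_disjoint // lift_set_touching.
Qed.

(** The new branch set is the single vertex [v]. This turns a K_4 minor in a neighbourhood into a
    K_5 minor. *)
Lemma complete_minor_cone k v : v \notin A -> (forall x, x \in A -> adj v x) ->
  complete_minor k induced_graph -> complete_minor k.+1 G.
Proof.
move=> vA dom [s [<- hs]]; exists ([set v] :: map lift_set s); split.
  by rewrite /= size_map.
rewrite clique_model_cons lift_clique_model // andbT connected_set1.
apply/andP; split; first by apply/set0Pn; exists v; rewrite inE.
apply/allP => _ /mapP[B Bs ->]; have lift_sub : lift_set B \subset A.
  by apply/subsetP => _ /imsetP[x _ ->]; apply: valP.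
rewrite disjoints1 (contra (subsetP lift_sub v)) //=.
move: hs => /andP[/allP /(_ _ Bs) /andP[/set0Pn[x xB] _] _].
apply/touchingP; exists v, (val x); rewrite inE eqxx imset_f //; split => //.
by apply: dom; apply: valP.
Qed.

End Induced.

(** * Contraction of an edge *)

Section Contraction.
Variables (G : sgraph) (x y : G) (xy : adj x y).

Let yx : x != y. Proof. exact: adj_neq. Qed.

(** The edge is contracted onto [x]: the other vertices keep their names, so degrees and adjacency
    can be compared with those of [G] through [val]. [contract_proj] sends [y] to its default value
    [x]. *)
Definition contract_vertex := {z : G | z != y}.
Definition contract_proj (z : G) : contract_vertex :=
  insubd (exist _ x yx : contract_vertex) z.
Definition contract_adj : rel contract_vertex := fun a b => (a != b) &&
  [exists u, exists v, [&& contract_proj u == a, contract_proj v == b & adj u v]].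
Lemma contract_adj_sym : symmetric contract_adj.
Proof.
suff h a b : contract_adj a b -> contract_adj b a by move=> a b; apply/idP/idP; apply: h.
case/andP=> ab /existsP[u /existsP[v /and3P[ua vb uv]]]; rewrite /contract_adj eq_sym ab.
by apply/existsP; exists v; apply/existsP; exists u; rewrite vb ua adj_sym.
Qed.
Lemma contract_adj_irrefl : irreflexive contract_adj.
Proof. by move=> a; rewrite /contract_adj eqxx. Qed.
Definition contract := SGraph contract_adj_sym contract_adj_irrefl.

Lemma val_proj z : val (contract_proj z) = if z == y then x else z.
Proof. by rewrite val_insubd; case: eqP. Qed.

Lemma proj_val (a : contract) : contract_proj (val a) = a.
Proof. by apply: val_inj; rewrite val_proj (negbTE (valP a)). Qed.

Lemma card_contract : #|contract|.+1 = #|G|.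
Proof.
rewrite card_sig -[in RHS](cardsC [set y]) cards1 add1n; congr _.+1.
by rewrite -cardsE; apply: eq_card => z; rewrite !inE.
Qed.

Lemma contract_adjP (a b : contract) : reflect
  (a != b /\ exists u v, [/\ contract_proj u = a, contract_proj v = b & adj u v])
  (adj a b).
Proof.
apply: (iffP andP) => -[ab h]; split=> //.
  by case/existsP: h => u /existsP[v /and3P[/eqP ua /eqP vb uv]]; exists u, v.
case: h => u [v [ua vb uv]].
by apply/existsP; exists u; apply/existsP; exists v; rewrite ua vb uv !eqxx.
Qed.

Definition pull_set (A : {set contract}) : {set G} := [set z | contract_proj z \in A].

Lemma pull_clique_model (s : seq {set contract}) :
  clique_model s -> clique_model (map pull_set s).
Proof.
(* A set closed inside a pulled-back set cannot separate [x] from [y], so it is a union of fibres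
   there and can be tested in the contraction. *)
have fiber (S A : {set G}) z : closed_in A S -> z \in A ->
    val (contract_proj z) \in A -> (val (contract_proj z) \in S) = (z \in S).
  rewrite val_proj; case: eqP => [->|//] cS yA xA.
  by apply/idP/idP; apply: cS => //; rewrite adj_sym.
have pullv A a : (val a \in pull_set A) = (a \in A) by rewrite inE proj_val.
elim: s => [//|A s IH]; rewrite map_cons !clique_model_cons.
case/and4P => /set0Pn[a aA] cA /allP hA /IH->; rewrite andbT; apply/and3P; split.
- by apply/set0Pn; exists (val a); rewrite pullv.
- apply: (@connected_root _ _ (val a)) => [|S aS cS]; first by rewrite pullv.
  have: A \subset [set b : contract | val b \in S].
    apply: (connected_closed cA aA); rewrite ?inE // => b c bA cA' /contract_adjP[_].
    case=> u [v [ub vc uv]]; rewrite !inE.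
    have uA : u \in pull_set A by rewrite inE ub.
    have vA : v \in pull_set A by rewrite inE vc.
    have := fiber S _ u cS uA; have := fiber S _ v cS vA.
    by rewrite ub vc !pullv => -> // -> //; apply: cS.
  move=> /subsetP h; apply/subsetP => z zA.
  have pzA : contract_proj z \in A by move: zA; rewrite inE.
  by have := h _ pzA; have := fiber S _ z cS zA; rewrite inE pullv => ->.
- apply/allP => _ /mapP[B /hA /andP[/pred0P d /touchingP[b [c [bA cB bc]]]] ->].
  case/contract_adjP: bc => _ [u [v [ub vc uv]]]; apply/andP; split.
    by apply/pred0P => z /=; rewrite !inE; apply: d.
  by apply/touchingP; exists u, v; rewrite !inE ub vc.
Qed.

Lemma complete_minor_contract k : complete_minor k contract -> complete_minor k G.
Proof.
by case=> s [<- /pull_clique_model hs]; exists (map pull_set s); rewrite size_map.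
Qed.

Lemma contract_adjE (a b : contract) : val a != x -> val b != x ->
  adj a b = adj (val a) (val b).
Proof.
have same (c : contract) u : val c != x -> contract_proj u = c -> u = val c.
  by move=> cx h; move: cx; rewrite -h val_proj; case: (u == y); rewrite ?eqxx.
move=> ax bx; apply/contract_adjP/idP.
  by case=> _ [u [v [/same-> // /same-> //]]].
move=> ab; split; first by apply: contraTneq ab => ->; rewrite adj_irrefl.
by exists (val a), (val b); rewrite !proj_val.
Qed.

Lemma contract_adj_tip (a b : contract) : val a = x -> val b != x ->
  adj a b = adj x (val b) || adj y (val b).
Proof.
move=> ax bx.
have same (c : contract) u : val c != x -> contract_proj u = c -> u = val c.
  by move=> cx h; move: cx; rewrite -h val_proj; case: (u == y); rewrite ?eqxx.
have px : contract_proj x = a by rewrite -ax proj_val.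
have py : contract_proj y = a by apply: val_inj; rewrite val_proj eqxx.
apply/contract_adjP/idP.
  case=> _ [u [v [ua /same-> // uv]]].
  have: val (contract_proj u) = x by rewrite ua.
  rewrite val_proj; case: (eqVneq u y) uv => [-> -> _|_ uv ux]; first by rewrite orbT.
  by rewrite -ux uv.
move=> h; split.
  by apply: contraNneq bx => <-; rewrite ax.
by case/orP: h => h; [exists x, (val b)|exists y, (val b)]; rewrite ?px ?py proj_val.
Qed.

Lemma card_nbr_contract (a : contract) : val a != x ->
  #|nbr (val a)| = #|nbr a| + (adj x (val a) && adj y (val a)).
Proof.
move=> ax; have -> : #|nbr a| = #|[set z in nbr (val a) | (z != x) && (z != y)]|
    + (adj x (val a) || adj y (val a)).
  rewrite -(card_imset _ val_inj) (cardsD1 x) addnC; congr (_ + _); last first.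
    congr nat_of_bool; have xV : x = val (contract_proj x) by rewrite val_proj (negbTE yx).
    by rewrite {1}xV mem_imset; [rewrite inE adj_sym contract_adj_tip // | exact: val_inj].
  apply: eq_card => z; rewrite !inE; apply/andP/and3P.
    case=> zx /imsetP[b]; rewrite inE => ab zb; rewrite zb in zx *.
    by rewrite -contract_adjE //; split => //; exact: (valP b).
  case=> az zx zy; split=> //; apply/imsetP; exists (contract_proj z).
    by rewrite inE contract_adjE ?val_proj ?(negbTE zy).
  by rewrite val_proj (negbTE zy).
rewrite (cardsD1 x) (cardsD1 y) !inE !(adj_sym (val a)) eq_sym yx /=.
have -> : (nbr (val a) :\ x) :\ y = [set z in nbr (val a) | (z != x) && (z != y)].
  by apply/setP => z; rewrite !inE; case: (z == x); case: (z == y); rewrite ?andbF ?andbT.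
by rewrite addnA addnC -!addnA; case: (adj x _); case: (adj y _).
Qed.

Lemma card_nbr_contract_tip (a : contract) : val a = x ->
  #|nbr a| = #|(nbr x :|: nbr y) :\: [set x; y]|.
Proof.
move=> ax; rewrite -(card_imset _ val_inj); apply: eq_card => z.
rewrite !inE negb_or; apply/imsetP/andP.
  case=> b; rewrite inE => ab ->; have bx : val b != x.
    by apply: contraTneq ab => bx; rewrite -(_ : a = b) ?adj_irrefl //; apply: val_inj; rewrite ax.
  by rewrite bx (valP b) -(contract_adj_tip ax).
case=> /andP[zx zy] h; have vz : val (contract_proj z) = z by rewrite val_proj (negbTE zy).
by exists (contract_proj z); rewrite ?inE ?contract_adj_tip ?vz.
Qed.

End Contraction.

(** * Vertices of low degree and edge bounds *)

Section LowDegree.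
Variable G : sgraph.
Implicit Types (x y z : G) (U : {set G}).

Lemma clique_model_singletons (s : seq G) :
  pairwise (@adj G) s -> clique_model [seq [set x] | x <- s].
Proof.
elim: s => [//|x s IH] /= /andP[/allP hx /IH hs].
rewrite clique_model_cons hs connected_set1 !andbT.
apply/andP; split; first by apply/set0Pn; exists x; rewrite inE.
apply/allP => _ /mapP[y /hx xy ->].
by rewrite touching1 xy disjoints1 inE adj_neq.
Qed.

Lemma clique_minor (s : seq G) :
  pairwise (@adj G) s -> complete_minor (size s) G.
Proof.
by move=> h; exists [seq [set x] | x <- s]; rewrite size_map clique_model_singletons.
Qed.

Lemma card2_of_sub (A : {set G}) x y : x \in A -> y \in A -> x != y ->
  #|A| <= 2 -> A = [set x; y].
Proof.
move=> xA yA xy hA; apply/esym/eqP.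
by rewrite eqEcard subUset !sub1set xA yA cards2 xy.
Qed.

Definition low_pair := exists a b : G,
  [/\ a != b, ~~ adj a b, #|nbr a| <= 2 & #|nbr b| <= 2].

End LowDegree.

(** A property of a single graph, so that it can be assumed of contractions. The induction needs two
    nonadjacent low vertices: one of them may be the contracted vertex, and the other still
    lifts. *)
Definition low_pair_if_K4_free (G : sgraph) := ~ complete_minor 4 G -> 3 < #|G| -> low_pair G.

(** The two alternatives are whether a member of the low pair is the contracted vertex or not. In
    the second one, lifting raises a degree only at a common neighbour of the two ends, and only by
    one. *)
Lemma low_pair_contract (G : sgraph) (x y : G) (xy : adj x y) :
  ~ complete_minor 4 G -> 4 < #|G| -> low_pair_if_K4_free (contract xy) ->
  (exists b, [/\ b != x, b != y, ~~ adj x b, ~~ adj y b & #|nbr b| <= 2] /\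
      #|(nbr x :|: nbr y) :\: [set x; y]| <= 2) \/
  (exists a b, [/\ a != b, ~~ adj a b,
      [/\ a != x, a != y & #|nbr a| <= 2 + (adj x a && adj y a)] &
      [/\ b != x, b != y & #|nbr b| <= 2 + (adj x b && adj y b)]]).
Proof.
move=> K4 n5 h; have [] := h.
- by move/complete_minor_contract.
- by have := card_contract xy; lia.
have tip (a b : contract xy) : val a = x -> a != b -> ~~ adj a b ->
    #|nbr a| <= 2 -> #|nbr b| <= 2 ->
    [/\ val b != x, val b != y, ~~ adj x (val b), ~~ adj y (val b)
      & #|nbr (val b)| <= 2] /\ #|(nbr x :|: nbr y) :\: [set x; y]| <= 2.
  move=> ax ab nab la lb; rewrite -(card_nbr_contract_tip ax) la; split=> //.
  have bx : val b != x by apply: contra ab => /eqP bx; apply/eqP/val_inj; rewrite ax bx.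
  move: nab; rewrite contract_adj_tip // negb_or => /andP[xb yb].
  by rewrite bx xb yb card_nbr_contract // (negbTE xb) addn0 (valP b).
move=> a [b [ab nab la lb]].
have [ax|ax] := eqVneq (val a) x.
  by left; exists (val b); apply: (tip a).
have [bx|bx] := eqVneq (val b) x.
  by left; exists (val a); apply: (tip b); rewrite // 1?eq_sym // adj_sym.
right; exists (val a), (val b); split.
- by rewrite (inj_eq val_inj).
- by rewrite -contract_adjE.
- by rewrite ax (valP a) card_nbr_contract // leq_add2r.
- by rewrite bx (valP b) card_nbr_contract // leq_add2r.
Qed.

Lemma degree3_tip (p q : bool) d : 2 < d -> d <= 2 + (p && q) -> [/\ p, q & d = 3].
Proof. by case: p q => -[] /=; rewrite ?addn0 ?addn1; split => //; lia. Qed.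

(** * A minimal graph without K_4 minor and without a low pair *)

Section MinimalCounterexample.
Variable G : sgraph.
Implicit Types (x y z : G) (U : {set G}).
Hypothesis K4free : ~ complete_minor 4 G.
Hypothesis n5 : 4 < #|G|.
Hypothesis IH : forall H : sgraph, #|H| < #|G| -> low_pair_if_K4_free H.
Hypothesis no_low : forall a b : G, a != b -> ~~ adj a b ->
  #|nbr a| <= 2 -> #|nbr b| <= 2 -> False.

Let step x y (xy : adj x y) := low_pair_contract K4free n5
  (IH (eq_leq (card_contract xy))).

(** Without common neighbours, a low pair away from the contracted vertex stays low in [G]. If the
    contracted vertex is low, the degrees of the two ends add up to at most 4, so one end is low and
    pairs with [b]. *)
Let edge_triangle x y : adj x y -> exists z, adj x z && adj y z.
Proof.
move=> xy; apply/existsP; apply: contraT; rewrite negb_exists => /forallP nt.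
have := step xy; case=> [[b [[bx yb nxb nyb lb] hU]]|[a [b [ab nab]]]]; last first.
  by rewrite !(negbTE (nt _)) !addn0 => -[_ _ la] [_ _ lb]; case: (no_low ab nab).
have : #|nbr x| + #|nbr y| <= 4.
  rewrite -cardsUI (_ : nbr x :&: nbr y = set0); last first.
    by apply/setP => z; rewrite !inE (negbTE (nt z)).
  have := cardsID [set x; y] (nbr x :|: nbr y); have := subset_leq_card
    (subsetIr (nbr x :|: nbr y) [set x; y]); rewrite cards0 cards2; lia.
have [lx _|lx ly] := leqP #|nbr x| 2; first by case: (@no_low x b); rewrite // eq_sym.
by case: (@no_low y b); rewrite // 1?eq_sym //; lia.
Qed.

Definition diamond x y U := [/\ adj x y, #|U| = 2, nbr x = y |: U & nbr y = x |: U].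

(** A pair away from the contracted vertex fails to be low in [G] only if a member is a common
    neighbour of degree exactly 3. If the contracted vertex is low, its partner forces degree at
    least 3 on both ends, so both must be adjacent to all of the at most two merged neighbours. *)
Let edge_tip x y : adj x y ->
  (exists U, diamond x y U) \/ exists z, [/\ adj x z, adj y z & #|nbr z| = 3].
Proof.
move=> xy; have := step xy; case=> [[b [[bx yb nxb nyb lb] hU]]|]; last first.
  case=> a [b [ab nab [ax ay la] [bx yb lb]]]; right.
  have [la2|la2] := leqP #|nbr a| 2; have [lb2|lb2] := leqP #|nbr b| 2.
  - by case: (no_low ab nab).
  - by exists b; apply: degree3_tip.
  - by exists a; apply: degree3_tip.
  - by exists b; apply: degree3_tip.
left; set U := _ :\: _ in hU; exists U.
have d3 z : z != b -> ~~ adj z b -> 2 < #|nbr z|.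
  by rewrite ltnNge => zb nzb; apply/negP => lz; apply: (no_low zb nzb).
have dx := d3 x; have dy := d3 y; rewrite eq_sym in dx; rewrite eq_sym in dy.
have sub z z' : adj z z' -> 2 < #|nbr z| ->
    U = (nbr z :|: nbr z') :\: [set z; z'] -> nbr z = z' |: U /\ #|U| = 2.
  move=> zz' dz UE; have sz : nbr z \subset z' |: U.
    apply/subsetP => t; rewrite UE !inE => zt; rewrite zt /= negb_or.
    by rewrite (eq_sym t z) adj_neq //=; case: (t == z').
  have cz : #|z' |: U| = #|U|.+1 by rewrite cardsU1 UE !inE eqxx orbT.
  split; first by apply/eqP; rewrite eqEcard sz cz; lia.
  by have := subset_leq_card sz; lia.
have [xE U2] := sub x y xy (dx bx nxb) erefl.
have [yE _] := sub y x (etrans (adj_sym _ _) xy) (dy yb nyb)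
  (congr2 (fun A B => A :\: B) (setUC _ _) (setUC _ _)).
by split.
Qed.

Let K4 x y z t : adj x y -> adj x z -> adj x t -> adj y z -> adj y t -> adj z t ->
  False.
Proof.
move=> xy xz xt yz yt zt; apply: K4free.
by apply: (@clique_minor _ [:: x; y; z; t]); rewrite /= xy xz xt yz yt zt.
Qed.

Let adj_symm x y : adj x y -> adj y x. Proof. by rewrite adj_sym. Qed.

(** Let z be a common neighbour of degree 3 and w its third neighbour. The edge zw lies in a
    triangle through x or y; applying [edge_tip] to the edge from z to the other of these two gives
    a diamond or a K_4. *)
Let has_diamond x y : adj x y -> exists x z U, diamond x z U.
Proof.
move=> xy; have [[U d]|[z [xz yz z3]]] := edge_tip xy; first by exists x, y, U.
have [zx zy] : adj z x /\ adj z y by split; exact: adj_symm.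
have /set0Pn[w]: nbr z :\: [set x; y] != set0.
  rewrite -card_gt0; have := cardsID [set x; y] (nbr z).
  have := subset_leq_card (subsetIr (nbr z) [set x; y]); rewrite cards2; lia.
rewrite !inE negb_or => /andP[/andP[wx wy] zw].
have nzE : nbr z = [set x; y; w].
  apply/esym/eqP; rewrite eqEcard !subUset !sub1set !inE zx zy zw z3.
  by rewrite -setUA cardsU1 cards2 !inE negb_or (eq_sym x w) wx adj_neq // eq_sym wy.
wlog xw : x y xy xz yz zx zy wx wy nzE / adj x w.
  have [t /andP[zt wt]] := edge_triangle zw.
  have: t \in nbr z by rewrite inE.
  rewrite nzE !inE -orbA => /or3P[] /eqP tE; rewrite tE in zt wt => hw.
  - by apply: (hw x y) => //; apply: adj_symm.
  - apply: (hw y x) => //; [exact: adj_symm| |exact: adj_symm].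
    by rewrite (setUC [set x]).
  - by rewrite adj_irrefl in wt.
have [[U d]|[t [zt yt t3]]] := edge_tip zy; first by exists z, y, U.
have: t \in nbr z by rewrite inE.
rewrite nzE !inE -orbA => /or3P[] /eqP tE; rewrite tE in zt yt t3.
- exists x, z, [set y; w]; split => //.
  + by rewrite cards2 eq_sym wy.
  + apply/esym/eqP; rewrite eqEcard !subUset !sub1set !inE xy xz xw t3.
    by rewrite cardsU1 cards2 !inE negb_or (adj_neq zy) (adj_neq zw) eq_sym wy.
  + by rewrite nzE setUA.
- by rewrite adj_irrefl in yt.
- by case: (@K4 x y z w).
Qed.

Let diamond_absurd x z U : diamond x z U -> False.
Proof.
case=> xz U2 xE zE; have zx := adj_symm xz.
have xU t : t \in U -> adj x t by rewrite -(in_nbr x) xE !inE => ->; rewrite orbT.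
have zU t : t \in U -> adj z t by rewrite -(in_nbr z) zE !inE => ->; rewrite orbT.
have indep y w : y \in U -> w \in U -> ~~ adj y w.
  by move=> yU wU; apply/negP => yw; apply: (@K4 x z y w); auto.
(* The triangle on the edge from y to a third neighbour t has x or z as its third vertex, so t would
   be in [U] and adjacent to y. *)
have d3 y : y \in U -> #|nbr y| <= 3 -> #|nbr y| <= 2.
  move=> yU hy; rewrite leqNgt; apply/negP => y3.
  have /set0Pn[t]: nbr y :\: [set x; z] != set0.
    rewrite -card_gt0; have := cardsID [set x; z] (nbr y).
    have := subset_leq_card (subsetIr (nbr y) [set x; z]); rewrite cards2; lia.
  rewrite !inE negb_or => /andP[/andP[tx tz] yt].
  have yE : nbr y = [set x; z; t].
    apply/esym/eqP; rewrite eqEcard !subUset !sub1set !inE yt.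
    rewrite !(adj_sym y) xU // zU //= -setUA cardsU1 cards2 !inE negb_or.
    by rewrite (eq_sym z) tz (eq_sym x t) tx adj_neq.
  have [s /andP[ys ts]] := edge_triangle yt.
  have: s \in nbr y by rewrite inE.
  rewrite yE !inE -orbA => /or3P[] /eqP sE; rewrite sE in ys ts.
  - have: t \in nbr x by rewrite inE adj_sym.
    rewrite xE !inE (negbTE tz) /= => tU; exact: (negP (indep _ _ yU tU)).
  - have: t \in nbr z by rewrite inE adj_sym.
    rewrite zE !inE (negbTE tx) /= => tU; exact: (negP (indep _ _ yU tU)).
  - by rewrite adj_irrefl in ts.
have /cards2P[y [w [yw UE]]] : #|U| == 2 by rewrite U2.
have [yU wU] : y \in U /\ w \in U by rewrite UE !inE !eqxx orbT.
have [n6|n6] := leqP #|G| 5.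
  have dU t s : t \in U -> s \in U -> t != s -> #|nbr t| <= 2.
    move=> tU sU ts; apply: d3 => //.
    have: nbr t \subset ~: [set t; s].
      apply/subsetP => r; rewrite !inE => tr; rewrite negb_or eq_sym adj_neq //=.
      by apply: contraTneq tr => ->; apply: indep.
    move/subset_leq_card; have := cardsC [set t; s]; rewrite cards2 ts; lia.
  by apply: (no_low yw (indep _ _ yU wU)); [apply: (dU y w)|apply: (dU w y)];
    rewrite // eq_sym.
(* Contracting xz leaves a vertex [x1] whose neighbours are exactly y and w. As these are
   nonadjacent, [x1] and [y1] have no common neighbour, so contracting that edge as well lowers no
   degree elsewhere. *)
pose x1 : contract xz := contract_proj xz x; pose y1 : contract xz := contract_proj xz y.
have zNU : z \notin U by apply/negP => /zU; rewrite adj_irrefl.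
have xNU : x \notin U by apply/negP => /xU; rewrite adj_irrefl.
have vx1 : val x1 = x by rewrite val_proj (negbTE (adj_neq xz)).
have vU t : t \in U -> val (contract_proj xz t) = t.
  by move=> tU; rewrite val_proj; case: eqP zNU => // <-; rewrite tU.
have U_neq t : t \in U -> t != x by apply: contraTneq => ->.
have x1_adj (t : contract xz) : val t != x -> adj x1 t = (val t \in U).
  move=> tx; rewrite contract_adj_tip // -!in_nbr xE zE !inE (negbTE tx).
  by rewrite (negbTE (valP t)) orbb.
have y1x1 : adj y1 x1 by rewrite adj_sym x1_adj vU // U_neq.
have cc := card_contract xz.
have cc2 := card_contract y1x1.
have n5' : 4 < #|contract xz| by lia.
have ih : low_pair_if_K4_free (contract y1x1) by apply: IH; lia.
have K4free' : ~ complete_minor 4 (contract xz).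
  by move=> h; apply: K4free; apply: complete_minor_contract h.
have := low_pair_contract K4free' n5' ih.
have deg (t : contract xz) : val t != x -> #|nbr t| <= 2 -> #|nbr (val t)| <= 2.
  move=> tx t2; have := card_nbr_contract tx; rewrite -!in_nbr xE zE !inE.
  rewrite (negbTE tx) (negbTE (valP t)) andbb /=.
  case tU: (val t \in U) => tE; last by rewrite tE addn0.
  by apply: d3 => //; rewrite tE addn1.
case=> [[b [[by1 bx1 nyb nxb lb] hU]]|[a [b [ab nab [ay ax la] [ yb bx lb]]]]].
  have bx : val b != x by rewrite -vx1 (inj_eq val_inj).
  apply: (@no_low y (val b)).
  - by rewrite eq_sym -(vU y yU) (inj_eq val_inj).
  - by rewrite -(vU y yU) -contract_adjE // vU ?U_neq.
  - rewrite -(vU y yU); apply: deg; first by rewrite vU ?U_neq.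
    pose w1 : contract xz := contract_proj xz w.
    have w1y : ~~ adj y1 w1.
      by rewrite contract_adjE ?vU ?U_neq //; apply: indep.
    (* The merged neighbourhood has at most two elements and contains w besides the other neighbours
       of [y1]. So [y1] has degree at most 2, and y has degree at most 3 in [G], where [d3]
       applies. *)
    have : w1 |: (nbr y1 :\ x1) \subset (nbr y1 :|: nbr x1) :\: [set y1; x1].
      rewrite subUset sub1set !inE x1_adj vU ?U_neq // wU orbT andbT negb_or.
      apply/andP; split; last first.
        apply/subsetP => t; rewrite !inE => /andP[tx ty].
        by rewrite ty (negbTE tx) orbF andbT eq_sym (adj_neq ty).
      by rewrite -!(inj_eq val_inj) (vU y yU) (vU w wU) vx1 eq_sym yw U_neq.
    move/subset_leq_card; rewrite cardsU1 !inE (negbTE w1y) andbF.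
    by rewrite [X in _ -> X <= _](cardsD1 x1) inE y1x1 => h; apply: leq_trans h hU.
  - exact: deg.
have low (t : contract xz) : t != y1 -> t != x1 ->
    #|nbr t| <= 2 + (adj y1 t && adj x1 t) -> val t != x /\ #|nbr (val t)| <= 2.
  move=> ty tx; have tx' : val t != x by rewrite -vx1 (inj_eq val_inj).
  rewrite x1_adj // => tl; split=> //; apply: deg => //.
  suff: ~~ (adj y1 t && (val t \in U)) by move/negbTE => h; rewrite h addn0 in tl.
  rewrite negb_and orbC -implybE; apply/implyP => tU.
  by rewrite contract_adjE ?vU ?U_neq //; apply: indep.
have [ax' la'] := low a ay ax la; have [bx' lb'] := low b yb bx lb.
by apply: (@no_low (val a) (val b)); rewrite ?(inj_eq val_inj) // -contract_adjE.
Qed.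

Lemma minimal_counterexample_absurd : False.
Proof.
have [|none] := boolP [exists x : G, exists y, adj x y].
  by case/existsP => x /existsP[y /has_diamond[a [b [U /diamond_absurd]]]].
have noadj (a b : G) : ~~ adj a b.
  by apply: contra none => ab; apply/existsP; exists a; apply/existsP; exists b.
have nbr0 (a : G) : #|nbr a| = 0 by apply: eq_card0 => b; rewrite inE (negbTE (noadj _ _)).
have [a [b ab]] : exists a b : G, a != b.
  by have /card_gt1P[a [b [_ _ ab]]] : 1 < #|G| := ltnW (ltnW (ltnW n5)); exists a, b.
by apply: (no_low ab (noadj _ _)); rewrite nbr0.
Qed.

End MinimalCounterexample.

Theorem K4_minor_free_low (G : sgraph) : low_pair_if_K4_free G.
Proof.
have [k leGk] := ubnP #|G|; elim: k G leGk => // k IH G leGk K4 n4.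
have [n5|n5] := ltnP 4 #|G|; last first.
  have n4E : #|G| = 4 by lia.
  have [cl|] := boolP (pairwise (@adj G) (enum G)).
    by case: K4; rewrite -n4E cardE; apply: clique_minor.
  move=> ncl; have: ~~ [forall x : G, forall y : G, (x != y) ==> adj x y].
    apply: contra ncl => /'forall_'forall_implyP h.
    have := enum_uniq G; rewrite uniq_pairwise; apply: sub_pairwise => x y /=; exact: h.
  rewrite negb_forall => /existsP[x]; rewrite negb_forall => /existsP[y].
  rewrite negb_imply => /andP[xy nxy].
  have low (a b : G) : a != b -> ~~ adj a b -> #|nbr a| <= 2.
    move=> ab nab; have : nbr a \subset ~: [set a; b].
      apply/subsetP => r; rewrite !inE => ar; rewrite negb_or eq_sym adj_neq //=.
      by apply: contraTneq ar => ->.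
    move/subset_leq_card; have := cardsC [set a; b]; rewrite cards2 ab; lia.
  by exists x, y; split=> //; [apply: (low x y)|apply: (low y x); rewrite // 1?eq_sym // adj_sym].
have [/existsP[a /existsP[b /and4P[]]]|none] := boolP [exists a : G, exists b : G,
  [&& a != b, ~~ adj a b, #|nbr a| <= 2 & #|nbr b| <= 2]]; first by exists a, b.
case: (@minimal_counterexample_absurd G) => // [H HG|a b ab nab la lb].
  by apply: IH; lia.
move/negP: none; apply; apply/existsP; exists a; apply/existsP; exists b.
by rewrite ab nab la.
Qed.

(** Twice the number of edges; a sum over vertices can be followed through a contraction term by
    term. *)
Definition arcs (G : sgraph) := \sum_(x : G) #|nbr x|.

Lemma edgesP (G : sgraph) (e : {set G}) :
  reflect (exists x y, adj x y /\ e = [set x; y]) (e \in edges G).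
Proof.
apply: (iffP imsetP) => [[[x y] /= xy ->]|[x [y [xy ->]]]]; first by exists x, y.
by exists (x, y).
Qed.

Lemma edge_mem (G : sgraph) (x y : G) : ([set x; y] \in edges G) = adj x y.
Proof.
apply/edgesP/idP => [[u [v [uv /setP h]]]|xy]; last by exists x, y.
have := h u; have := h v; have := h x; have := h y; rewrite !inE !eqxx !orbT /=.
move=> /esym/orP[] /eqP -> /esym/orP[] /eqP ->; rewrite ?orbb => /eqP vE /eqP uE //.
- by rewrite -vE adj_irrefl in uv.
- by rewrite adj_sym.
- by rewrite uE adj_irrefl in uv.
Qed.

Lemma card_edge (G : sgraph) (e : {set G}) : e \in edges G -> #|e| = 2.
Proof. by case/edgesP => x [y [xy ->]]; rewrite cards2 adj_neq. Qed.

Lemma arcsE (G : sgraph) : arcs G = 2 * #|edges G|.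
Proof.
have degE (x : G) : #|nbr x| = \sum_(e in edges G) (x \in e).
  transitivity #|[set e in edges G | x \in e]|.
    have inj : {in nbr x &, injective (fun y => [set x; y])}.
      move=> y z; rewrite !inE => xy xz /setP /(_ z); rewrite !inE eqxx orbT.
      by rewrite eq_sym (negbTE (adj_neq xz)) => /eqP.
    rewrite -(card_in_imset inj); apply: eq_card => e; rewrite inE.
    apply/imsetP/andP => [[y]|[/edgesP[u [v [uv ->]]]]].
      by rewrite in_nbr -edge_mem => xy ->; rewrite xy !inE eqxx.
    rewrite !inE => /orP[] /eqP ->; first by exists v; rewrite ?inE.
    by exists u; rewrite 1?setUC // inE adj_sym.
  rewrite -sum1_card big_mkcond [RHS]big_mkcond; apply: eq_bigr => e _.
  by rewrite inE; case: (e \in edges G); case: (x \in e).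
rewrite /arcs; under eq_bigr => x _ do rewrite degE.
rewrite exchange_big /=.
rewrite mulnC -sum_nat_const; apply: eq_bigr => e /card_edge <-.
by rewrite -sum1_card [RHS]big_mkcond; apply: eq_bigr => x _; case: (x \in e).
Qed.

Lemma card_nbr_lt (G : sgraph) (x : G) : #|nbr x| < #|G|.
Proof.
by apply/proper_card/properP; split; [apply/subsetP|exists x; rewrite // inE adj_irrefl].
Qed.

(** Contraction destroys the edge itself and merges the two other edges of each triangle on it; both
    losses count in two directions. *)
Lemma arcs_contract (G : sgraph) (x y : G) (xy : adj x y) :
  arcs G = arcs (contract xy) + 2 + 2 * #|nbr x :&: nbr y|.
Proof.
have yx := adj_neq xy; set t := #|_ :&: _|.
have [a ax] : exists a : contract xy, val a = x.
  by exists (contract_proj xy x); rewrite val_proj (negbTE yx).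
pose F z := #|nbr z|; rewrite /arcs (bigD1 y) //= (bigD1 x) //=.
rewrite [in RHS](bigD1 a) //= card_nbr_contract_tip //.
have -> : \sum_(i : G | (i != y) && (i != x)) #|nbr i| =
    \sum_(b : contract xy | b != a) (#|nbr b| + (val b \in nbr x :&: nbr y)).
  rewrite (reindex_onto (fun b : contract xy => val b) (contract_proj xy)) /=; last first.
    by move=> z /andP[zy _]; rewrite val_proj (negbTE zy).
  apply: eq_big => [b|b /andP[/andP[_ bx] _]]; last by rewrite (@card_nbr_contract _ _ _ xy) // !inE.
  by rewrite (valP b) proj_val eqxx andbT -(inj_eq val_inj) ax.
rewrite big_split /=.
have -> : \sum_(b : contract xy | b != a) (val b \in nbr x :&: nbr y) = t.
  rewrite /t -sum1_card.
  rewrite (reindex_onto (fun b : contract xy => val b) (contract_proj xy)) /=; last first.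
    move=> z; rewrite !inE val_proj => /andP[_ yz].
    by rewrite eq_sym (negbTE (adj_neq yz)).
  rewrite big_mkcond [RHS]big_mkcond /=; apply: eq_bigr => b _.
  rewrite proj_val eqxx andbT -(inj_eq val_inj) ax.
  case: eqVneq => [->|_]; first by rewrite !inE adj_irrefl.
  by case: (_ \in _).
have : #|nbr x| + #|nbr y| = #|(nbr x :|: nbr y) :\: [set x; y]| + 2 + t.
  rewrite -cardsUI -/t -(cardsID [set x; y] (nbr x :|: nbr y)).
  have -> : (nbr x :|: nbr y) :&: [set x; y] = [set x; y]; last by rewrite cards2 yx; lia.
  apply/setIidPr; rewrite subUset !sub1set !inE.
  have yx1 : adj y x by rewrite adj_sym.
  by rewrite xy yx1 orbT.
by move: #|_ :\: _| (\sum_(_ | _) _) => u v; lia.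
Qed.

Lemma card_nbr_induced (G : sgraph) (A : {set G}) (a : induced_graph A) :
  #|nbr a| = #|nbr (val a) :&: A|.
Proof.
rewrite -(card_imset _ val_inj); apply: eq_card => z; rewrite !inE.
apply/imsetP/andP => [[b]|[az zA]].
  by rewrite inE => ab ->; split=> //; apply: (valP b).
by exists (exist _ z zA); rewrite ?inE.
Qed.

(* If every edge lies in three triangles, a neighbourhood has minimum degree 3,
   hence contains a clique minor of order 4; otherwise contract. *)
Theorem K5_minor_free_arcs (G : sgraph) :
  ~ complete_minor 5 G -> 3 <= #|G| -> arcs G + 12 <= 6 * #|G|.
Proof.
have [k leGk] := ubnP #|G|; elim: k G leGk => // k IH G leGk K5 n3.
have [n5|n5] := ltnP 4 #|G|; last first.
  have : arcs G <= #|G| * #|G|.-1.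
    rewrite -sum_nat_const; apply: leq_sum => x _.
    by have := card_nbr_lt x; lia.
  move: (#|G|) n3 n5 => [|[|[|[|[|?]]]]] //; lia.
have [/existsP[x /existsP[y /andP[xy t2]]]|tri] := boolP [exists x : G, exists y : G,
    adj x y && (#|nbr x :&: nbr y| <= 2)].
  have c := card_contract xy; have := arcs_contract xy.
  have := IH (contract xy) _ (fun h => K5 (complete_minor_contract h)).
  move: c; set n := #|contract xy| => c; move=> /(_ ltac:(lia) ltac:(lia)).
  by lia.
have [/existsP[x /existsP[y xy]]|none] := boolP [exists x : G, exists y, adj x y];
  last first.
  suff -> : arcs G = 0 by rewrite add0n (leq_trans _ (leq_mul (leqnn 6) n3)).
  rewrite /arcs big1 // => x _; apply: eq_card0 => y; rewrite inE.
  apply: contraNF none => xy; apply/existsP; exists x; apply/existsP; by exists y.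
have t3 (u v : G) : adj u v -> 2 < #|nbr u :&: nbr v|.
  move=> uv; rewrite ltnNge; apply: contra tri => h.
  by apply/existsP; exists u; apply/existsP; exists v; rewrite uv.
case: (@K4_minor_free_low (induced_graph (nbr x))).
- move=> h; apply: K5; apply: (@complete_minor_cone _ (nbr x) 4 x _ _ h); first by rewrite inE adj_irrefl.
  by move=> z; rewrite inE.
- rewrite card_induced; apply: leq_ltn_trans (t3 _ _ xy) _.
  apply: proper_card; apply/properP; split; first exact: subsetIl.
  by exists y; rewrite !inE ?xy ?adj_irrefl ?andbF.
move=> a [b [_ _ la _]]; have := t3 x (val a); rewrite -in_nbr => /(_ (valP a)).
by rewrite setIC -card_nbr_induced ltnNge la.
Qed.

(** * Colorings from trees and trees from colorings *)

Definition tree_rel (G : sgraph) (T : {set {set G}}) : rel G :=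
  [rel x y | [set x; y] \in T].

Lemma tree_rel_sym (G : sgraph) (T : {set {set G}}) : connect_sym (tree_rel T).
Proof. by apply: sym_connect_sym => x y; rewrite /tree_rel /= setUC. Qed.

(** The tree grows by edges leaving the part already reached. Acyclicity is encoded in the number of
    edges. *)
Lemma spanning_tree (G : sgraph) (A : {set G}) x0 :
  x0 \in A -> induced_connected A ->
  exists T : {set {set G}}, [/\ T \subset edges G, #|T|.+1 = #|A|,
    {in T, forall e : {set G}, e \subset A} &
    {in A &, forall x y, connect (tree_rel T) x y}].
Proof.
move=> x0A cA.
suff h k : k < #|A| -> exists (B : {set G}) (T : {set {set G}}),
    [/\ B \subset A, #|B| = k.+1, x0 \in B & [/\ T \subset edges G, #|T| = k,
    {in T, forall e : {set G}, e \subset B} &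
    {in B, forall x, connect (tree_rel T) x0 x}]].
  have A0 : 0 < #|A| by rewrite (cardD1 x0) x0A.
  have [|B [T [sB cB _ [TE cT TB Tc]]]] := h #|A|.-1; first by rewrite prednK.
  have BA : B = A by apply/eqP; rewrite eqEcard sB cB leqSpred.
  rewrite BA in TB Tc; exists T; split=> //; first by rewrite cT prednK.
  move=> x y xA yA; apply: (@connect_trans _ _ x0); last exact: Tc.
  by rewrite (tree_rel_sym T); apply: Tc.
elim: k => [_|k IH kA].
  exists [set x0], set0; rewrite sub1set x0A cards1 cards0 inE eqxx sub0set.
  split=> //; split=> // [e|x]; first by rewrite inE.
  by move=> /set1P->; apply: connect0.
have [B [T [sB cB x0B [TE cT TB Tc]]]] := IH (ltnW kA).
have [u [v [uB vA vB uv]]] : exists u v, [/\ u \in B, v \in A, v \notin B & adj u v].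
  have [/existsP[u /existsP[v /and4P[]]]|none] := boolP [exists u, exists v,
    [&& u \in B, v \in A, v \notin B & adj u v]]; first by exists u, v.
  suff: A \subset B by move/subset_leq_card; rewrite cB leqNgt kA.
  apply: (connected_closed cA x0A x0B) => u v uA vA uv uB; apply: contraNT none => vB.
  by apply/existsP; exists u; apply/existsP; exists v; rewrite uB vA vB.
have nT : [set u; v] \notin T.
  by apply: contra vB => /TB /subsetP; apply; rewrite !inE eqxx orbT.
exists (v |: B), ([set u; v] |: T); split.
- by rewrite subUset sub1set vA.
- by rewrite cardsU1 vB cB.
- by rewrite inE x0B orbT.
have mono : subrel (tree_rel T) (tree_rel ([set u; v] |: T)).
  by move=> x y; rewrite /tree_rel /= => h; rewrite in_setU h orbT.
have cmono x y : connect (tree_rel T) x y -> connect (tree_rel ([set u; v] |: T)) x y.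
  by apply: connect_sub => a b /mono; apply: connect1.
split.
- by rewrite subUset sub1set edge_mem uv.
- by rewrite cardsU1 nT cT.
- move=> e; rewrite inE => /orP[/set1P->|/TB sub].
    by rewrite subUset !sub1set !inE uB eqxx orbT.
  exact: subset_trans sub (subsetUr _ _).
move=> x; rewrite inE => /orP[/set1P->|/Tc]; last exact: cmono.
by apply: connect_trans (cmono _ _ (Tc _ uB)) (connect1 _); rewrite /tree_rel /= !inE eqxx.
Qed.

Lemma card_edges_in_connected (G : sgraph) (A : {set G}) : induced_connected A ->
  #|A| <= #|[set e in edges G | e \subset A]|.+1.
Proof.
move=> cA; have [->|[x xA]] := set_0Vmem A; first by rewrite cards0.
have [T [TE <- TA _]] := spanning_tree xA cA; rewrite ltnS.
by apply/subset_leq_card/subsetP => e eT; rewrite inE (subsetP TE) ?TA.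
Qed.

Lemma kconnected1P (G : sgraph) : kconnected 1 G -> induced_connected [set: G].
Proof.
by case/andP => _ /forallP /(_ set0); rewrite cards0 setC0.
Qed.

(** * Colorings obtained from spanning trees *)

Section LowerBound.
Variable G : sgraph.
Implicit Types (A : {set G}) (T : {set {set G}}).

(** Edges themselves serve as colors; ranking them gives a coloring with the palette of [mc]. *)
Lemma mc_ge_recolor (f : {set G} -> {set G}) :
  {in edges G, forall e, f e \in edges G} ->
  (forall x y, exists k, connect [rel u v | adj u v && (f [set u; v] == k)] x y) ->
  #|f @: edges G| <= mc G.
Proof.
move=> fE h; have [->|[e0 e0E]] := set_0Vmem (edges G); first by rewrite imset0 cards0.
pose r := enum_rank_in e0E; pose c := [ffun e => r (f e)].
have rinj : {in edges G &, injective r}.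
  by move=> e e' eE e'E /(congr1 enum_val); rewrite !enum_rankK_in.
have <- : #|c @: edges G| = #|f @: edges G|.
  have -> : c @: edges G = r @: (f @: edges G).
    apply/setP => k; apply/imsetP/imsetP => [[e eE ->]|[_ /imsetP[e eE ->] ->]].
      by exists (f e); rewrite ?ffunE ?imset_f.
    by exists e; rewrite ?ffunE.
  rewrite card_in_imset // => e e' /imsetP[a aE ->] /imsetP[b bE ->].
  by apply: rinj; apply: fE.
apply: (@leq_bigmax_cond _ (fun c => mc_coloring c) (fun c => #|c @: edges G|)).
apply/forallP => x; apply/forallP => y; apply/existsP.
have [k hk] := h x y; exists (r k).
apply: connect_sub hk => u v /andP[uv /eqP fk]; apply: connect1.
by rewrite /mono_adj /= uv ffunE fk eqxx.
Qed.

Lemma adj_connect (f : {set G} -> {set G}) x y : adj x y ->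
  exists k, connect [rel u v | adj u v && (f [set u; v] == k)] x y.
Proof. by move=> xy; exists (f [set x; y]); apply: connect1; rewrite /= xy eqxx. Qed.

Lemma tree_connect (f : {set G} -> {set G}) T e x y :
  T \subset edges G -> {in T, forall e', f e' = e} -> connect (tree_rel T) x y ->
  connect [rel u v | adj u v && (f [set u; v] == e)] x y.
Proof.
move=> TE fT; apply: connect_sub => u v uvT; apply: connect1.
by move: uvT; rewrite /tree_rel /= => uvT; rewrite fT // eqxx andbT -edge_mem (subsetP TE).
Qed.

(** One color on a spanning tree of [A] and distinct colors elsewhere: the |A| - 1 tree edges cost
    |A| - 2 colors. *)
Lemma mc_ge_tree A : induced_connected A -> 1 < #|A| ->
  (forall x y, x != y -> ~~ adj x y -> x \in A /\ y \in A) ->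
  #|edges G| + 2 <= mc G + #|A|.
Proof.
move=> cA A1 hA; have /card_gt0P[x0 x0A] : 0 < #|A| := ltnW A1.
have [T [TE cT _ Tc]] := spanning_tree x0A cA.
have /card_gt0P[e0 e0T] : 0 < #|T| by rewrite -ltnS cT.
pose f e := if e \in T then e0 else e.
have fT : {in T, forall e, f e = e0} by move=> e eT; rewrite /f eT.
have cE : #|f @: edges G| + #|T| = #|edges G|.+1.
  rewrite -(cardsID T (edges G)) (setIidPr TE) addnC -addnS; congr (_ + _).
  rewrite -add1n -(_ : (e0 \notin edges G :\: T) = 1 :> nat); last by rewrite inE e0T.
  rewrite -cardsU1; apply: eq_card => e; rewrite !inE; apply/imsetP/orP.
    case=> e' e'E ->; rewrite /f; case: ifP => e'T; first by left.
    by right; rewrite e'T.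
  case=> [/eqP->|/andP[nT eE]]; first by exists e0; rewrite /f ?e0T // (subsetP TE).
  by exists e; rewrite // /f (negbTE nT).
have : #|f @: edges G| <= mc G; last by move: cE cT; clear; lia.
apply: mc_ge_recolor => [e eE|x y].
  by rewrite /f; case: ifP => // _; apply: (subsetP TE).
have [->|xy] := eqVneq x y; first by exists e0; apply: connect0.
have [|nxy] := boolP (adj x y); first exact: adj_connect.
have [xA yA] := hA x y xy nxy.
by exists e0; apply: tree_connect TE fT _; apply: Tc.
Qed.

(* A second colour joins the only nonadjacent pair not inside [A] by a path of
   length two. *)
Lemma mc_ge_two_trees A u w x : induced_connected A -> 1 < #|A| ->
  u \notin A -> w \notin A -> x \in A -> u != w -> adj u x -> adj w x ->
  (forall y z, y != z -> ~~ adj y z ->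
    (y \in A /\ z \in A) \/ [set y; z] = [set u; w]) ->
  #|edges G| + 1 <= mc G + #|A|.
Proof.
move=> cA A1 uA wA xA uw ux wx hA.
have [T [TE cT TA Tc]] := spanning_tree xA cA.
have /card_gt0P[e0 e0T] : 0 < #|T| by rewrite -ltnS cT.
pose eu := [set u; x]; pose ew := [set w; x].
have euT : eu \notin T.
  by apply: contra uA => /TA /subsetP; apply; rewrite !inE eqxx.
have ewT : ew \notin T.
  by apply: contra wA => /TA /subsetP; apply; rewrite !inE eqxx.
have euw : eu != ew.
  apply: contra uw => /eqP/setP/(_ u); rewrite !inE eqxx /= => /esym/orP[//|/eqP uE].
  by rewrite uE xA in uA.
pose T2 := [set eu; ew].
have T2E : T2 \subset edges G by rewrite subUset !sub1set !edge_mem ux wx.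
pose f e := if e \in T then e0 else if e \in T2 then eu else e.
have fT : {in T, forall e, f e = e0} by move=> e eT; rewrite /f eT.
have fT2 : {in T2, forall e, f e = eu}.
  move=> e eT2; rewrite /f eT2; case: ifP => // eT.
  by move: eT2 eT; rewrite !inE => /orP[] /eqP->; rewrite ?(negbTE euT) ?(negbTE ewT).
have : #|edges G| <= #|f @: edges G| + #|T|.
  have : edges G \subset (f @: edges G) :|: ((T :\ e0) :|: [set ew]).
    apply/subsetP => e eE; rewrite !inE.
    have [->|ne0] := eqVneq e e0.
      by rewrite -(fT _ e0T) imset_f // (subsetP TE).
    have [->|new] := eqVneq e ew; first by rewrite !orbT.
    have [eT|neT] := boolP (e \in T); first by rewrite orbT.
    rewrite !orbF; apply/imsetP; exists e => //; rewrite /f (negbTE neT) !inE (negbTE new).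
    by case: eqP.
  move/subset_leq_card; have := (leq_card_setU (f @: edges G) ((T :\ e0) :|: [set ew])).1.
  have := (leq_card_setU (T :\ e0) [set ew]).1; rewrite cards1.
  by have := cardsD1 e0 T; rewrite e0T; clear; lia.
have : #|f @: edges G| <= mc G; last by move: cT; clear; lia.
apply: mc_ge_recolor => [e eE|y z].
  rewrite /f; case: ifP => _; first exact: (subsetP TE).
  by case: ifP => // _; apply: (subsetP T2E); rewrite !inE eqxx.
have [->|yz] := eqVneq y z; first by exists e0; apply: connect0.
have [|nyz] := boolP (adj y z); first exact: adj_connect.
have [[yA zA]|yzE] := hA y z yz nyz.
  by exists e0; apply: tree_connect TE fT _; apply: Tc.
exists eu; apply: tree_connect T2E fT2 _.
have conn a b : a \in [set u; w] -> b \in [set u; w] -> connect (tree_rel T2) a b.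
  have cx c : c \in [set u; w] -> connect (tree_rel T2) c x.
    by rewrite !inE => /orP[] /eqP->; apply: connect1; rewrite /tree_rel /= !inE eqxx ?orbT.
  by move=> /cx ax /cx bx; apply: connect_trans ax _; rewrite tree_rel_sym.
by apply: conn; rewrite -yzE !inE eqxx ?orbT.
Qed.

Lemma mc_ge_connected : kconnected 1 G -> #|edges G| + 2 <= mc G + #|G|.
Proof.
move=> c; rewrite -cardsT; apply: mc_ge_tree; first exact: kconnected1P.
  by case/andP: c; rewrite cardsT.
by move=> x y; rewrite !inE.
Qed.

End LowerBound.

(** Components with two vertices are single edges; they cost no color and join no nonadjacent pair,
    hence the bound on the size. *)
Definition tree_cover (G : sgraph) (F : {set {set G}}) :=
  {in F, forall B : {set G}, induced_connected B /\ 2 < #|B|} /\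
  forall x y : G, x != y -> ~~ adj x y -> exists2 B, B \in F & (x \in B) && (y \in B).

(** A monochromatic tree on B has |B| - 1 edges and a single color, so it loses |B| - 2 colors. *)
Definition waste (T : finType) (F : {set {set T}}) := \sum_(B in F) (#|B| - 2).

(** * Covers obtained from colorings *)

Section ColorClasses.
Variables (G : sgraph) (C : finType) (c : {ffun {set G} -> C}).

Section OneColor.
Variable k : C.
Lemma mono_adj_sym : symmetric (mono_adj c k).
Proof. by move=> x y; rewrite /mono_adj /= adj_sym setUC. Qed.
Lemma mono_adj_irrefl : irreflexive (mono_adj c k).
Proof. by move=> x; rewrite /mono_adj /= adj_irrefl. Qed.
Definition mono_graph := SGraph mono_adj_sym mono_adj_irrefl.

Definition color_component (x : G) : {set G} := [set y | connect (mono_adj c k) x y].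

Lemma mem_color_component x : x \in color_component x.
Proof. by rewrite inE connect0. Qed.

Let csym : connect_sym (mono_adj c k).
Proof. exact: (sym_connect_sym mono_adj_sym). Qed.

Lemma color_component_eq x y z :
  z \in color_component x -> z \in color_component y ->
  color_component x = color_component y.
Proof.
rewrite !inE => xz yz; have xy : connect (mono_adj c k) x y.
  by apply: connect_trans xz _; rewrite csym.
by apply/setP => t; rewrite !inE; apply: (same_connect csym).
Qed.

Lemma color_component_mono_connected x :
  @induced_connected mono_graph (color_component x).
Proof.
apply: (@connected_root mono_graph _ x) => [|S xS cS].
  exact: mem_color_component.
apply/subsetP => y; rewrite inE => /connectP[p].
elim/last_ind: p y => [|p z IH] y /=; first by move=> _ ->.
rewrite rcons_path last_rcons => /andP[hp hz] ->.
have pS := IH (last x p) hp erefl.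
apply: (cS (last x p)) => //; rewrite !inE; first by apply/connectP; exists p.
by apply/connectP; exists (rcons p z); rewrite ?rcons_path ?hp ?last_rcons.
Qed.

Lemma color_component_connected x : induced_connected (color_component x).
Proof.
apply: (@connected_root _ _ x) => [|S xS cS]; first exact: mem_color_component.
have := connected_closed (color_component_mono_connected x) (mem_color_component x) xS.
by apply => u v uB vB /andP[uv _]; apply: cS.
Qed.

Lemma card_color_component x :
  #|color_component x| <=
  #|[set e in edges G | (c e == k) && (e \subset color_component x)]|.+1.
Proof.
apply: leq_trans (card_edges_in_connected (color_component_mono_connected x)) _.
rewrite ltnS; apply/subset_leq_card/subsetP => e; rewrite !inE.
case/andP => /edgesP[u [v [/andP[uv ck] ->]]] ->.
by rewrite edge_mem uv ck.
Qed.

End OneColor.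

Definition color_cover : {set {set G}} :=
  [set B : {set G} | (2 < #|B|) && [exists k, exists x, B == color_component k x]].

Lemma color_cover_tree_cover : mc_coloring c -> tree_cover color_cover.
Proof.
move=> mcc; split=> [B|x y xy nxy].
  rewrite inE => /andP[B3 /existsP[k /existsP[x /eqP BE]]]; split=> //.
  by rewrite BE; apply: color_component_connected.
have /existsP[k kxy] := forallP (forallP mcc x) y.
have yB : y \in color_component k x by rewrite inE.
exists (color_component k x); last by rewrite mem_color_component.
rewrite inE; apply/andP; split; last first.
  by apply/existsP; exists k; apply/existsP; exists x.
case/connectP: kxy => -[|z p] /=; first by move=> _ yx; rewrite yx eqxx in xy.
case/andP => xz _ _.
have zB : z \in color_component k x by rewrite inE; apply: connect1.
have /andP[axz _] := xz.
apply: (@leq_trans #|[set x; y; z]|).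
  rewrite -setUA cardsU1 cards2 !inE negb_or xy (adj_neq axz).
  by rewrite (contraTneq _ axz) // => <-.
by apply/subset_leq_card; rewrite !subUset !sub1set mem_color_component yB zB.
Qed.

Lemma waste_color_cover : waste color_cover + #|c @: edges G| <= #|edges G|.
Proof.
set F := color_cover.
(* The same vertex set may be a component of several colors but occurs once in [F]; [kf] charges it
   to one of them. The default is never taken on [F]. *)
pose kf (B : {set G}) : C :=
  odflt (c set0) [pick k | [exists x, B == color_component k x]].
have kfP B : B \in F -> 2 < #|B| /\ exists x, B = color_component (kf B) x.
  rewrite /F inE => /andP[B3 /existsP[k hk]]; split=> //; rewrite /kf.
  case: pickP => [k' /existsP[x /eqP ->]|/(_ k)]; first by exists x.
  by rewrite hk.
pose E k := [set e in edges G | c e == k].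
have -> : #|edges G| = \sum_k #|E k|.
  rewrite -sum1_card (partition_big c predT) //=; apply: eq_bigr => k _.
  by rewrite -sum1_card; apply: eq_bigl => e; rewrite inE.
have -> : #|c @: edges G| = \sum_k (k \in c @: edges G).
  by rewrite -sum1_card big_mkcond; apply: eq_bigr => k _; case: (k \in _).
rewrite /waste (partition_big kf predT) //= -big_split; apply: leq_sum => k _ /=.
have [/existsP[B0 /andP[B0F /eqP kB0]]|none] :=
    boolP [exists B, (B \in F) && (kf B == k)]; last first.
  rewrite big_pred0 => [|B]; last first.
    by apply: contraNF none => h; apply/existsP; exists B.
  rewrite add0n; case kK: (k \in _) => //; rewrite card_gt0; apply/set0Pn.
  by case/imsetP: kK => e eE ->; exists e; rewrite inE eE eqxx.
(* Replacing |B| - 2 by |B| - 1 for the one component [B0] already pays for the color itself. *)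
apply: (@leq_trans (\sum_(B in F | kf B == k) (#|B| - 1))).
  have PB0 : (B0 \in F) && (kf B0 == k) by rewrite B0F kB0 eqxx.
  rewrite !(bigD1 B0 PB0) /=.
  have : \sum_(B in F | (kf B == k) && (B != B0)) (#|B| - 2) <=
      \sum_(B in F | (kf B == k) && (B != B0)) (#|B| - 1).
    by apply: leq_sum => B _; apply: leq_sub2l.
  under eq_bigl => B do rewrite andbA.
  under [X in _ <= X -> _]eq_bigl => B do rewrite andbA.
  have [B03 _] := kfP _ B0F; have := leq_b1 (k \in c @: edges G); move: B03.
  move: (\sum_(_ | _) _) (\sum_(_ | _) _) (nat_of_bool _) => p q d.
  by clear; lia.
apply: (@leq_trans (\sum_(B in F | kf B == k) \sum_(e in E k) (e \subset B))).
  apply: leq_sum => B /andP[BF /eqP kB]; have [_ [x BE]] := kfP _ BF.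
  rewrite leq_subLR; have := card_color_component k x; rewrite kB in BE; rewrite -BE.
  move=> h; apply: leq_trans h _; rewrite ltnS -sum1_card big_mkcond /=.
  rewrite [leqRHS]big_mkcond /=; apply: leq_sum => e _; rewrite !inE.
  by case: (e \in edges G); case: (c e == k); case: (e \subset B).
rewrite exchange_big -sum1_card; apply: leq_sum => e /=; rewrite inE => /andP[eE _].
(* Components of one color are disjoint, so an edge lies inside at most one of them. *)
rewrite -big_mkcondr sum1_card; apply/card_le1_eqP => B B'.
rewrite !unfold_in /= => /andP[/andP[/kfP[_ [x BE]] /eqP kB] eB].
case/andP=> [/andP[/kfP[_ [x' BE']] /eqP kB'] eB'].
case/edgesP: eE => u [v [_ eE]]; have uE : u \in e by rewrite eE !inE eqxx.
have := subsetP eB _ uE; have := subsetP eB' _ uE; rewrite BE BE' kB kB' => h h'.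
exact: color_component_eq h h'.
Qed.

End ColorClasses.

Lemma mc_cover (G : sgraph) : kconnected 1 G ->
  exists2 F : {set {set G}}, tree_cover F & waste F + mc G <= #|edges G|.
Proof.
move=> c1; have cG := kconnected1P c1.
have [/existsP[c0 mc0]|none] :=
    boolP [exists c : {ffun {set G} -> 'I_#|edges G|}, mc_coloring c].
  have [|c mcc cE] := @eq_bigmax_cond _ [pred c : {ffun {set G} -> 'I_#|edges G|} |
      mc_coloring c] (fun c => #|c @: edges G|).
    by apply/card_gt0P; exists c0.
  exists (color_cover c); first exact: color_cover_tree_cover.
  by have := waste_color_cover c; rewrite -cE.
(* The maximum in [mc] is attained because the constant coloring is admissible. Its color exists
   because a connected graph on at least two vertices has an edge. *)
have m0 : 0 < #|edges G|.
  have [n2 _] := andP c1; have := leq_trans n2 (eq_leq (esym (cardsT G))).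
  move=> /leq_trans /(_ (card_edges_in_connected cG)); rewrite ltnS => h.
  by apply: leq_trans h _; apply/subset_leq_card/subsetP => e; rewrite inE => /andP[].
case/negP: none; apply/existsP; exists [ffun=> Ordinal m0].
apply/forallP => x; apply/forallP => y; apply/existsP; exists (Ordinal m0).
have := forall_inP (forall_inP cG x (in_setT x)) y (in_setT y).
apply: connect_sub => u v /= /and3P[_ _ uv]; apply: connect1.
by rewrite /mono_adj /= uv ffunE eqxx.
Qed.

(** * Structure of colorings of small waste *)

Definition dominating (G : sgraph) (v : G) := forall x, x != v -> adj v x.

(** Here and in the next two definitions the rest has to be connected, so that one color on a
    spanning tree of it joins all missing pairs inside it. *)
Definition apex_graph (G : sgraph) :=
  exists2 v : G, dominating v & induced_connected (~: [set v]).

Definition double_apex (G : sgraph) (u w : G) :=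
  [/\ u != w, ~~ adj u w, (forall x, x != u -> x != w -> adj u x && adj w x)
    & induced_connected (~: [set u; w])].

Definition double_hub (G : sgraph) (u w : G) :=
  [/\ u != w, dominating u, dominating w & induced_connected (~: [set u; w])].

(** The two sides are automatically disjoint, since no vertex is adjacent to itself. *)
Definition K33_free (G : sgraph) := forall A B : {set G},
  2 < #|A| -> 2 < #|B| -> ~ {in A & B, forall x y, adj x y}.

Section Counting.
Variable G : sgraph.
Implicit Types (A B : {set G}).

Lemma dominated_connected A x : x \in A -> dominating x -> induced_connected A.
Proof. by move=> xA dx; apply: (connected_dominated xA) => y _; apply: dx. Qed.

Lemma card_pairs (S : {set G * G}) : #|S| = \sum_x #|[set y | (x, y) \in S]|.
Proof.
under eq_bigr => x _ do rewrite -sum1_card.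
rewrite pair_big_dep /= -sum1_card; apply: eq_bigl => -[x y] /=.
by rewrite inE.
Qed.

Definition nonarcs A : {set G * G} :=
  [set q | [&& q.1 \in A, q.2 \in A, q.1 != q.2 & ~~ adj q.1 q.2]].

Lemma card_nonarcs A :
  #|nonarcs A| + arcs (induced_graph A) + #|A| = #|A| * #|A|.
Proof.
have -> : arcs (induced_graph A) = \sum_(x in A) #|nbr x :&: A|.
  rewrite big_sub; apply: eq_bigr => x _; exact: card_nbr_induced.
have -> : #|nonarcs A| = \sum_(x in A) #|(A :\ x) :\: nbr x|.
  rewrite card_pairs [RHS]big_mkcond; apply: eq_bigr => x _.
  case xA: (x \in A); last by apply: eq_card0 => y; rewrite !inE /= xA.
  apply: eq_card => y; rewrite !inE /= xA (eq_sym y x).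
  by case: (y \in A); case: (x == y); case: (adj x y).
rewrite -[X in _ + X = _]sum1_card -!big_split -sum_nat_const.
apply: eq_bigr => x xA /=.
rewrite (cardsD1 x A) xA -(cardsID (nbr x) (A :\ x)) addnC; congr (_ + _).
rewrite addnC; congr (_ + _); apply: eq_card => y; rewrite !inE.
by case: eqVneq => [->|_]; rewrite ?adj_irrefl // andbC.
Qed.

(** At least |A| - 1 of the pairs are edges, that is 2(|A| - 1) of the |A|(|A| - 1) ordered
    pairs. *)
Lemma card_nonarcs_connected A : induced_connected A ->
  #|nonarcs A| <= (#|A| - 2) * (#|A| - 1).
Proof.
move=> cA; have := card_nonarcs A; rewrite arcsE.
have cT : induced_connected [set: induced_graph A].
  rewrite -lift_set_connected (_ : lift_set _ = A) //.
  apply/setP => x; apply/imsetP/idP => [[y _ ->]|xA]; first exact: (valP y).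
  by exists (exist _ x xA).
have := card_edges_in_connected cT; rewrite cardsT card_induced.
set E := [set e in _ | _].
have : #|E| <= #|edges (induced_graph A)|.
  by apply/subset_leq_card/subsetP => e; rewrite inE => /andP[].
move: #|E| #|edges _| #|nonarcs A| #|A| => a b c d; clear.
case: d => [|[|d]]; rewrite ?subn2 ?subn1 /=; nia.
Qed.

(** For n = N + 3 one has n(n - 1) - (6n - 12) = N(N - 1); the inequality is arranged without
    subtraction. *)
Lemma K5_minor_free_nonarcs N : ~ complete_minor 5 G -> #|G| = N + 3 ->
  N * N <= #|nonarcs [set: G]| + N.
Proof.
move=> K5 nE; have := K5_minor_free_arcs K5; rewrite nE.
have := card_nonarcs [set: G]; rewrite cardsT nE.
have -> : arcs (induced_graph [set: G]) = arcs G.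
  transitivity (\sum_(x in [set: G]) #|nbr x|); last by apply: eq_bigl => x; rewrite inE.
  rewrite big_sub; apply: eq_bigr => x _; rewrite card_nbr_induced; congr #|pred_of_set _|.
  exact: setIT.
move: #|nonarcs _| (arcs G) => a b; clear; nia.
Qed.

Lemma tree_cover_nonarcs (F : {set {set G}}) : tree_cover F ->
  #|nonarcs [set: G]| <= \sum_(B in F) (#|B| - 2) * (#|B| - 1).
Proof.
case=> hF cov; apply: (@leq_trans (\sum_(B in F) #|nonarcs B|)); last first.
  by apply: leq_sum => B /hF[cB _]; apply: card_nonarcs_connected.
apply: (@leq_trans (\sum_(B in F) \sum_(q in nonarcs [set: G]) (q \in nonarcs B))).
  rewrite exchange_big -sum1_card; apply: leq_sum => -[x y] /=.
  rewrite !inE /= => /andP[xy nxy]; have [B BF /andP[xB yB]] := cov x y xy nxy.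
  by rewrite (bigD1 B) //= !inE /= xB yB xy nxy.
apply: leq_sum => B _; rewrite -sum1_card big_mkcond [leqRHS]big_mkcond.
by apply: leq_sum => q _; case: (q \in nonarcs B); case: ifP.
Qed.

End Counting.

(** * Covers of waste at most n - 3 *)

Section Structure.
Variables (G : sgraph) (N : nat) (F : {set {set G}}).
Hypothesis nE : #|G| = N + 3.
Hypothesis K5free : ~ complete_minor 5 G.
Hypothesis covF : tree_cover F.

Let N2 : N * N <= \sum_(B in F) (#|B| - 2) * (#|B| - 1) + N.
Proof.
apply: leq_trans (K5_minor_free_nonarcs K5free nE) _.
by rewrite leq_add2r tree_cover_nonarcs.
Qed.

Let cov (x y : G) : x != y -> ~~ adj x y -> exists2 B, B \in F & (x \in B) && (y \in B).
Proof. exact: covF.2. Qed.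

Let waste_max (B0 : {set G}) : B0 \in F -> {in F, forall B : {set G}, #|B| <= #|B0|} ->
  N * N <= (#|B0| - 1) * waste F + N.
Proof.
move=> B0F Bmax; apply: leq_trans N2 _; rewrite leq_add2r /waste big_distrr /=.
apply: leq_sum => B BF; rewrite mulnC leq_mul2r leq_sub2r ?orbT //.
exact: Bmax.
Qed.

Let waste_ge (D : {set {set G}}) : D \subset F -> waste D + #|F :\: D| <= waste F.
Proof.
move=> DF; rewrite /waste [leqRHS](big_setID D) /= (setIidPr DF) leq_add2l.
rewrite -sum1_card; apply: leq_sum => B; rewrite inE => /andP[_ /covF.1[_]].
by move: #|B| => b; clear; lia.
Qed.

Let F_maximum : F != set0 ->
  {B0 | B0 \in F & {in F, forall B : {set G}, #|B| <= #|B0|}}.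
Proof.
move=> /set0Pn/sigW[B BF]; exists [arg max_(B' > B in F) #|B'|]; by case: arg_maxnP.
Qed.

Let waste1 (B : {set G}) : waste [set B] = #|B| - 2. Proof. by rewrite /waste big_set1. Qed.

Let all_adjacent : F = set0 -> forall x y : G, x != y -> adj x y.
Proof. by move=> F0 x y xy; apply: contraT => /(cov xy)[B]; rewrite F0 inE. Qed.

Let small : F = set0 -> N <= 1.
Proof. by move=> F0; move: N2; rewrite F0 big_set0; clear; nia. Qed.

Lemma tree_cover_waste_ge : N <= waste F + 1.
Proof.
have [F0|/F_maximum[B0 B0F Bmax]] := eqVneq F set0.
  by rewrite (leq_trans (small F0)) ?leq_addl.
have [c3 p0] := covF.1 B0 B0F.
have := waste_max B0F Bmax.
have := waste_ge (D := [set B0]); rewrite sub1set => /(_ B0F); rewrite waste1.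
move: p0; move: #|B0| #|_ :\: _| (waste F) => b d W; clear; nia.
Qed.

Let compl_card (A : {set G}) : #|~: A| = N + 3 - #|A|.
Proof. by rewrite -nE -(cardsC A) addKn. Qed.

Lemma tree_cover_hub : waste F < N -> exists u w : G, double_hub u w.
Proof.
move=> WN; have [F0|/F_maximum[B0 B0F Bmax]] := eqVneq F set0.
  have /card_gt1P[u [w [_ _ uw]]] : 1 < #|G| by rewrite nE addn3.
  have dom (x : G) : dominating x by move=> y yx; rewrite all_adjacent // eq_sym.
  exists u, w; split=> //.
  have [->|[x xA]] := set_0Vmem (~: [set u; w]); last exact: dominated_connected xA (dom _).
  by apply/connected_intro => x S; rewrite inE.
have [c3 p0] := covF.1 B0 B0F.
have := waste_ge (D := [set B0]); rewrite sub1set => /(_ B0F); rewrite waste1 => hW.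
have [b0 F1] : #|B0| = N + 1 /\ #|F :\: [set B0]| = 0.
  move: p0 WN hW (waste_max B0F Bmax); move: #|B0| #|_ :\: _| (waste F) => b d W.
  clear; nia.
have FE (B : {set G}) : B \in F -> B = B0.
  move=> BF; apply/eqP; apply: contraT => BB0.
  by have := cards0_eq F1 => /setP/(_ B); rewrite !inE BB0 BF.
have : #|~: B0| == 2 by rewrite compl_card b0; apply/eqP; clear; lia.
move=> /cards2P[u [w [uw E]]]; have BE : B0 = ~: [set u; w] by rewrite -E setCK.
have dom (x : G) : x \notin B0 -> dominating x.
  move=> xB y yx; apply: contraT => /cov; rewrite eq_sym => /(_ yx)[B /FE->].
  by rewrite (negbTE xB).
exists u, w; split=> //; rewrite -?BE //; apply: dom;
  by rewrite BE !inE eqxx ?orbT.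
Qed.

(* In the extremal cases below the graph has 6 or 7 vertices and is covered by
   three sets of size 3, respectively two sets of size 4. *)
Let nonarcs6_apex : N = 3 -> #|nonarcs [set: G]| <= 6 ->
  apex_graph G \/ exists u w : G, double_apex u w.
Proof.
move=> N3 h6.
have nonarcT (x y : G) : ((x, y) \in nonarcs [set: G]) = (x != y) && ~~ adj x y by rewrite !inE.
have [/existsP[v /forallP dv]|none] := boolP [exists v, forall x : G, (x != v) ==> adj v x].
  left; exists v => [x|]; first exact/implyP.
  apply/connected_intro => x S xA xS cS; apply/subsetP => y yA; apply: contraT => yS.
  set A := ~: [set v] in xA yA cS *.
  (* Splitting the five other vertices into separated parts of sizes a and b would give 2ab >= 8
     ordered nonadjacent pairs. *)
  have XY : setX (A :&: S) (A :\: S) :|: setX (A :\: S) (A :&: S) \subset nonarcs [set: G].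
    have nadj a b : a \in A -> b \in A -> a \in S -> b \notin S -> (a != b) && ~~ adj a b.
      move=> aA bA aS bS; apply/andP; split; first by apply: contraNneq bS => <-.
      by apply: contra bS => ab; apply: (cS a).
    apply/subsetP => -[a b]; rewrite nonarcT in_setU !in_setX !in_setI !in_setD.
    case/orP => /andP[/andP[h1 h2] /andP[h3 h4]]; first exact: nadj.
    by rewrite eq_sym adj_sym; apply: nadj.
  have := leq_trans (subset_leq_card XY) h6.
  rewrite cardsU (_ : setX _ _ :&: setX _ _ = set0) ?cardsX; last first.
    apply/setP => -[a b]; rewrite in_setI !in_setX !in_setI !in_setD in_set0.
    by case: (a \in S) => /=; rewrite ?andbF.
  rewrite cards0; have := cardsID S A; rewrite compl_card cards1 N3.
  have : 0 < #|A :&: S| by apply/card_gt0P; exists x; rewrite inE xA.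
  have : 0 < #|A :\: S| by apply/card_gt0P; exists y; rewrite inE yS yA.
  by move: #|_ :&: _| #|_ :\: _| => a b; clear; nia.
(* Now each of the six vertices misses at least one other. Six ordered pairs leave exactly one for
   each, so the graph is the octahedron. *)
right; pose d (x : G) := #|[set y | (x, y) \in nonarcs [set: G]]|.
have d1 (x : G) : 0 < d x.
  have /forallPn[y] : ~~ [forall y : G, (y != x) ==> adj x y].
    by apply: contra none => h; apply/existsP; exists x.
  by rewrite negb_imply eq_sym => xy; apply/card_gt0P; exists y; rewrite inE nonarcT.
have dE (x : G) : d x = 1.
  have : \sum_x (d x - 1) = 0.
    have : \sum_x (d x - 1) + \sum_(x : G) 1 = #|nonarcs [set: G]|.
      by rewrite card_pairs -big_split; apply: eq_bigr => z _ /=; rewrite subnK ?d1.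
    by move: h6; rewrite sum1_card nE N3; move: (\sum_(_ | _) _) #|_|; clear; lia.
  move/eqP; rewrite sum_nat_eq0 => /forallP /(_ x) /= /eqP.
  by move: (d1 x); move: (d x); clear; lia.
have uniq_non (x y z : G) : x != y -> ~~ adj x y -> x != z -> ~~ adj x z -> y = z.
  move=> xy nxy xz nxz; have /eqP/cards1P[t tE] := dE x.
  have : y \in [set t] by rewrite -tE inE nonarcT xy.
  have : z \in [set t] by rewrite -tE inE nonarcT xz.
  by move=> /set1P-> /set1P->.
have ex_non (x : G) : exists2 y, x != y & ~~ adj x y.
  by have /card_gt0P[y] := d1 x; rewrite inE nonarcT => /andP[]; exists y.
have /card_gt0P[u _] : 0 < #|G| by rewrite nE N3.
have [w uw nuw] := ex_non u; exists u, w; split=> //.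
  move=> x xu xw; apply/andP; split; apply: contraT => nx.
    by rewrite (uniq_non u w x) ?eqxx // 1?eq_sym in xw.
  by rewrite (uniq_non w u x) ?eqxx // 1?eq_sym // adj_sym in xu.
have R4 : #|~: [set u; w]| = 4 by rewrite compl_card cards2 uw N3.
have /card_gt0P[x xR] : 0 < #|~: [set u; w]| by rewrite R4.
apply: (connected_root xR) => S xS cS; apply/subsetP => y yR.
have nearS z : z \in ~: [set u; w] -> adj x z -> z \in S by move=> zR xz; apply: (cS x).
have [<-//|xy] := eqVneq x y; have [xay|nxy] := boolP (adj x y); first exact: nearS.
have /set0Pn[z] : ~: [set u; w] :\: [set x; y] != set0.
  rewrite -card_gt0; have := cardsID [set x; y] (~: [set u; w]).
  have := subset_leq_card (subsetIr (~: [set u; w]) [set x; y]); rewrite cards2 R4.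
  by move: #|_ :&: _| #|_ :\: _| => a b; clear; case: (x != y) => /=; lia.
rewrite in_setD in_set2 negb_or => /andP[/andP[zx zy] zR].
have xz : adj x z by apply: contraT => nxz; rewrite (uniq_non x y z) ?eqxx // 1?eq_sym in zy.
have yz : adj y z.
  apply: contraT => nyz; rewrite (uniq_non y x z) ?eqxx // 1?eq_sym // in zx.
  by rewrite adj_sym.
by apply: (cS z) => //; [rewrite adj_sym|apply: nearS].
Qed.

(** Two 4-sets covering all seven vertices would share one vertex and leave three and three mutually
    adjacent vertices, a K_{3,3}. So some vertex is uncovered and therefore dominating. *)
Let two_blocks_apex (B1 B2 : {set G}) : N = 4 -> F = [set B1; B2] -> #|B1| = 4 -> #|B2| = 4 ->
  K33_free G -> apex_graph G.
Proof.
move=> N4 FE b1 b2 K33.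
have c1 : induced_connected B1 by apply: (covF.1 _ _).1; rewrite FE !inE eqxx.
have c2 : induced_connected B2 by apply: (covF.1 _ _).1; rewrite FE !inE eqxx orbT.
have outside (x y : G) : x != y -> ~~ adj x y -> (x \in B1) && (y \in B1) || (x \in B2) && (y \in B2).
  move=> xy nxy; have [B] := cov xy nxy; rewrite FE !inE => /orP[] /eqP-> -> //.
  by rewrite orbT.
have dom (v : G) : v \notin B1 :|: B2 -> dominating v.
  rewrite inE negb_or => /andP[v1 v2] x xv; apply: contraT => nvx.
  by have := outside v x; rewrite eq_sym (negbTE v1) (negbTE v2) => /(_ xv nvx).
have := cardsUI B1 B2; rewrite b1 b2 => cUI.
have [vU|[v vU]] := set_0Vmem (~: (B1 :|: B2)); last first.
  exists v; first by apply: dom; rewrite -in_setC.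
  have [BE|[x]] := set_0Vmem (~: (v |: (B1 :|: B2))); last first.
    rewrite !inE !negb_or => /andP[xv xB]; apply: (@dominated_connected _ _ x).
      by rewrite !inE.
    by apply: dom; rewrite inE negb_or.
  have -> : ~: [set v] = B1 :|: B2.
    apply/setP => x; have /setP/(_ x) := BE; rewrite !inE negb_or.
    case: eqVneq => [->|_ /= /negbFE->] //=.
    by move: vU; rewrite !inE => /negbTE->.
  have [z zI] : exists z, z \in B1 :&: B2.
    apply/card_gt0P; have := compl_card (B1 :|: B2); rewrite N4.
    have : 0 < #|~: (B1 :|: B2)| by apply/card_gt0P; exists v.
    by move: cUI; move: #|B1 :|: B2| #|_| #|_| => a b c; clear; lia.
  have /andP[z1 z2] : (z \in B1) && (z \in B2) by rewrite -in_setI.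
  apply: (@connected_root _ _ z); first by rewrite inE z1.
  move=> S zS cS; rewrite subUset; apply/andP; split.
    by apply: (connected_closed c1 z1 zS) => a b aB bB; apply: cS; rewrite inE ?aB ?bB.
  by apply: (connected_closed c2 z2 zS) => a b aB bB; apply: cS; rewrite inE ?aB ?bB orbT.
have cU : #|B1 :|: B2| = 7.
  by have := cardsC (B1 :|: B2); rewrite vU cards0 nE N4 addn0.
have cI : #|B1 :&: B2| = 1 by move: cUI; rewrite cU; clear; lia.
case: (K33 (B1 :\: B2) (B2 :\: B1)).
- by have := cardsID B2 B1; rewrite b1 cI; clear; lia.
- by have := cardsID B1 B2; rewrite setIC b2 cI; clear; lia.
move=> x y; rewrite !inE => /andP[x2 x1] /andP[y1 y2]; apply: contraT => nxy.
have := outside x y; rewrite x1 y2 (negbTE x2) (negbTE y1); apply=> //.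
by apply: contraNneq x2 => ->.
Qed.

Lemma tree_cover_apex : K33_free G -> waste F <= N ->
  apex_graph G \/ exists u w : G, double_apex u w.
Proof.
move=> K33 WN; have [F0|/F_maximum[B0 B0F Bmax]] := eqVneq F set0.
  have /card_gt1P[u [w [_ _ uw]]] : 1 < #|G| by rewrite nE addn3.
  have dom (x : G) : dominating x by move=> y yx; rewrite all_adjacent // eq_sym.
  left; exists u => //; apply: (@dominated_connected _ _ w) => //.
  by rewrite !inE eq_sym.
have [c3 p0] := covF.1 B0 B0F.
have := waste_ge (D := [set B0]); rewrite sub1set => /(_ B0F); rewrite waste1 => hW.
have hmax := waste_max B0F Bmax.
have uncovered (v : G) : {in F, forall B : {set G}, v \notin B} -> dominating v.
  move=> nB x xv; apply: contraT => nvx; have := cov _ nvx; rewrite eq_sym => /(_ xv)[B BF].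
  by rewrite (negbTE (nB B BF)).
have [b0|[b0|b0]] : #|B0| = N + 2 \/ #|B0| = N + 1 \/ #|B0| <= N.
- move: hW WN; move: #|B0| (waste F) #|_ :\: _| => b W d; clear; lia.
- left; have F1 : #|F :\: [set B0]| = 0.
    by move: hW WN; rewrite b0; move: (waste F) #|_ :\: _| => W d; clear; lia.
  have : #|~: B0| == 1 by rewrite compl_card b0; apply/eqP; clear; lia.
  move=> /cards1P[v E]; have BE : B0 = ~: [set v] by rewrite -E setCK.
  exists v; last by rewrite -BE.
  apply: uncovered => B BF; have -> : B = B0; last by rewrite BE !inE eqxx.
  apply/eqP; apply: contraT => BB0.
  by have := cards0_eq F1 => /setP/(_ B); rewrite !inE BB0 BF.
- have : #|~: B0| == 2 by rewrite compl_card b0; apply/eqP; clear; lia.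
  move=> /cards2P[u [w [uw E]]]; have BE : B0 = ~: [set u; w] by rewrite -E setCK.
  have uB0 : u \notin B0 by rewrite BE !inE eqxx.
  have wB0 : w \notin B0 by rewrite BE !inE eqxx orbT.
  (* [B0] alone accounts for N - 1 of the waste N, which leaves room for at most one further set, of
     size 3. *)
  have F1 : #|F :\: [set B0]| <= 1.
    by move: hW WN; rewrite b0; move: (waste F) #|_ :\: _| => W d; clear; lia.
  (* A connected set of size 3 misses at most one pair, so all missing pairs with an end outside
     [B0] coincide. *)
  have key (a b c d : G) : a \notin B0 -> c \notin B0 -> a != b -> c != d ->
      ~~ adj a b -> ~~ adj c d -> (c, d) \in [set (a, b); (b, a)].
    move=> aB0 cB0 ab cd nab ncd.
    have [B BF /andP[aB bB]] := cov ab nab; have [B' B'F /andP[cB dB]] := cov cd ncd.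
    have BD : B \in F :\: [set B0] by rewrite !inE BF andbT; apply: contraNneq aB0 => <-.
    have B'D : B' \in F :\: [set B0] by rewrite !inE B'F andbT; apply: contraNneq cB0 => <-.
    have BB' : B' = B by have /card_le1_eqP := F1; apply.
    rewrite BB' in cB dB; have B0B : B0 != B by apply: contraNneq aB0 => ->.
    have b3 : #|B| <= 3.
      have w2 : waste [set B0; B] = (#|B0| - 2) + (#|B| - 2).
        rewrite /waste (big_setD1 B0) ?inE ?eqxx //= (_ : _ :\ B0 = [set B]) ?big_set1 //.
        apply/setP => Z; rewrite !inE.
        by case: (eqVneq Z B0) => [->|_] //=; rewrite (negbTE B0B).
      have := waste_ge (D := [set B0; B]); rewrite subUset !sub1set B0F BF => /(_ isT).
      rewrite w2; move: WN p0; rewrite b0.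
      by move: (waste F) #|B| #|_ :\: _| => W e f; clear; lia.
    apply: contraT => ncdE.
    have := card_nonarcs_connected (covF.1 B BF).1.
    have sub : [set (c, d); (a, b); (b, a)] \subset nonarcs B.
      rewrite !subUset !sub1set !inE /= aB bB cB dB ab cd nab ncd adj_sym nab.
      by rewrite (eq_sym b) ab.
    move/(leq_trans (subset_leq_card sub)).
    rewrite -setUA cardsU1 ncdE cards2.
    rewrite (_ : (a, b) != (b, a)); last by rewrite xpair_eqE negb_and ab.
    by move: b3; move: #|B| => [|[|[|[|?]]]].
  have B3 : 2 < #|B0| by [].
  have apex (a b : G) : [set a; b] = [set u; w] -> dominating a -> apex_graph G.
    move=> abE da; exists a => //.
    have bB0 : b \notin B0 by rewrite BE inE negbK -abE !inE eqxx orbT.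
    have ab : a != b.
      by apply/eqP => ab; have := cards2 u w; rewrite -abE ab setUid cards1 uw.
    have -> : ~: [set a] = b |: B0.
      apply/setP => x; rewrite BE -abE !inE; case: (eqVneq x b) => [->|_]; last by rewrite orbF.
      by rewrite eq_sym ab.
    apply: connected_setU1 => //.
    have [/existsP[x /andP[xB bx]]|none] := boolP [exists x in B0, adj b x].
      by apply/touchingP; exists b, x; rewrite inE.
    have nadj x : x \in B0 -> b != x /\ ~~ adj b x.
      move=> xB; split; first by apply: contraNneq bB0 => ->.
      by apply: contra none => bx; apply/existsP; exists x; rewrite xB.
    have /card_gt1P[x [y [xB yB xy]]] : 1 < #|B0| := ltnW p0.
    have [[bx nbx] [b_y nby]] := (nadj x xB, nadj y yB).
    have := key b x b y bB0 bB0 bx b_y nbx nby.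
    by rewrite !inE !xpair_eqE eqxx (eq_sym y) (negbTE xy) (negbTE bx).
  have domP (a : G) : dominating a \/ exists2 b, a != b & ~~ adj a b.
    have [/existsP[b /andP[]]|none] := boolP [exists b, (a != b) && ~~ adj a b].
      by right; exists b.
    left=> x xa; apply: contraNT none => nax; apply/existsP; exists x.
    by rewrite eq_sym xa.
  have [du|[x ux nux]] := domP u; first by left; apply: (apex u w).
  have [dw|[y wy nwy]] := domP w; first by left; apply: (apex w u); rewrite // setUC.
  have := key u x w y uB0 wB0 ux wy nux nwy.
  rewrite !inE !xpair_eqE (eq_sym w u) (negbTE uw) /= => /andP[/eqP wx /eqP yu].
  move: ux nux wy nwy; rewrite -wx yu => _ nuw wu nwu {x y wx yu}.
  right; exists u, w; split; rewrite -?BE // => z zu zw.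
  apply/andP; split; apply: contraT => nz.
    have := key u w u z uB0 uB0 uw _ nuw nz; rewrite (eq_sym u z) => /(_ zu).
    by rewrite !inE !xpair_eqE (negbTE zw) (negbTE uw) andbF.
  have := key w u w z wB0 wB0 wu _ nwu nz; rewrite (eq_sym w z) => /(_ zw).
  by rewrite !inE !xpair_eqE (negbTE zu) (negbTE wu) andbF.
(* With b <= N and W <= N the inequality N(N - 1) <= (b - 1)W is an equality. Hence all sets have
   size N and N = |F|(N - 2). *)
have [WE bN N3] : [/\ waste F = N, #|B0| = N & 2 < N].
  by move: b0 p0 WN hmax; move: #|B0| (waste F) => b W; clear => h1 h2 h3 h4; split; nia.
have sizes : {in F, forall B : {set G}, #|B| = N}.
  have : \sum_(B in F) (#|B| - 2) * (N - #|B|) = 0.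
    have : \sum_(B in F) (#|B| - 2) * (#|B| - 1) + \sum_(B in F) (#|B| - 2) * (N - #|B|)
        = waste F * (N - 1).
      rewrite -big_split big_distrl /=; apply: eq_bigr => B BF.
      have := Bmax B BF; have := (covF.1 B BF).2; rewrite bN -mulnDr.
      by move: #|B| => b; clear => h1 h2; congr (_ * _); lia.
    rewrite WE; move: N2 N3; move: (\sum_(_ | _) _) (\sum_(_ | _) _) => a b; clear; nia.
  move=> /eqP; rewrite sum_nat_eq0 => /forall_inP h B BF.
  have := h B BF; rewrite muln_eq0; have := Bmax B BF; have := (covF.1 B BF).2.
  by rewrite bN; move: #|B| => b; clear; lia.
have cF : N = #|F| * (N - 2).
  by rewrite -{1}WE /waste -sum_nat_const; apply: eq_bigr => B /sizes->.
have [[NE FE]|[NE FE]] : (N = 3 /\ #|F| = 3) \/ (N = 4 /\ #|F| = 2).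
  by move: cF N3; move: #|F| => f; clear; case: f => [|[|[|[|f]]]]; nia.
- apply: nonarcs6_apex => //; apply: leq_trans (tree_cover_nonarcs covF) _.
  by rewrite (eq_bigr (fun=> 2)) ?sum_nat_const ?FE // => B /sizes->; rewrite NE.
- left; have /cards2P[B1 [B2 [_ FE']]] : #|F| == 2 by rewrite FE.
  by apply: (two_blocks_apex NE FE'); rewrite // sizes ?NE // FE' !inE eqxx ?orbT.
Qed.

End Structure.

(** * Waste in the presence of a cut vertex *)

Lemma disconnectedP (G : sgraph) (A : {set G}) : ~~ induced_connected A ->
  exists x y (S : {set G}), [/\ x \in A, y \in A, x \in S, y \notin S & closed_in A S].
Proof.
case/forall_inPn => x xA /forall_inPn[y yA nxy].
exists x, y, [set z | connect [rel u v | [&& u \in A, v \in A & adj u v]] x z].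
split; rewrite ?inE ?connect0 // => u v uA vA uv; rewrite !inE => /connect_trans; apply.
by apply: connect1; rewrite /= uA vA.
Qed.

(* A cover set joining the two sides of a cut vertex [v] contains [v], so it
   contributes only [#|B| - 1] vertices to a connected hypergraph on the rest. *)
Lemma cut_vertex_waste (G : sgraph) (v : G) (F : {set {set G}}) :
  cut_vertex v -> tree_cover F -> #|G| <= waste F + 2.
Proof.
move=> /disconnectedP[x [y [S [xA yA xS yS cS]]]] [conF cov].
set A := ~: [set v] in xA yA cS.
(* [Q] records the count obtained by attaching sets one after the other: without [v] a set has |B| -
   1 elements, and at least one of them is already reached, so at most |B| - 2 are new. The term for
   [x] is the starting vertex. *)
pose T (D : {set {set G}}) := x |: \bigcup_(B in D) (B :\ v).
pose Q (D : {set {set G}}) := (D \subset F) && (#|T D| <= (waste D).+1).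
have Q0 : Q set0 by rewrite /Q sub0set /T big_set0 setU0 cards1.
have [D /andP[DF hD] Dmax] := arg_maxnP (fun D : {set {set G}} => #|D|) Q0.
have TA : T D \subset A.
  rewrite subUset sub1set xA; apply/bigcupsP => B _; apply/subsetP => z.
  by rewrite !inE => /andP[].
have wDF : waste D <= waste F.
  by rewrite /waste [leqRHS](big_setID D) /= (setIidPr DF) leq_addr.
have [AT|] := boolP (A \subset T D).
  have := subset_leq_card AT; have := cardsC [set v]; rewrite cards1 -/A.
  by move: hD wDF; move: #|T D| #|A| (waste D) (waste F) => a b c d; clear; lia.
case/subsetPn => t tA tT.
(* [x] is reached and [y] lies on the other side, so whenever some vertex is missing, a reached and
   an unreached vertex exist on opposite sides. The cover set joining them must pass through [v] and
   could be attached. *)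
have [a [b [aT bA bT abS]]] : exists a b, [/\ a \in T D, b \in A, b \notin T D &
    (a \in S) != (b \in S)].
  have xT : x \in T D by rewrite !inE eqxx.
  have [tS|tS] := boolP (t \in S); last by exists x, t; rewrite xT xS (negbTE tS).
  have [/existsP[z /andP[zT zS]]|none] := boolP [exists z, (z \in T D) && (z \notin S)].
    by exists z, t; rewrite tS (negbTE zS).
  exists x, y; rewrite xS (negbTE yS) xT; split=> //.
  by apply: contra none => yT; apply/existsP; exists y; rewrite yT.
have aA := subsetP TA _ aT.
have ab : a != b by apply: contraNneq bT => <-.
have [B BF /andP[aB bB]] : exists2 B, B \in F & (a \in B) && (b \in B).
  apply: cov => //; apply: contra abS => ab'; apply/eqP; apply/idP/idP; first exact: cS.
  by apply: cS; rewrite // adj_sym.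
have [cB B3] := conF B BF.
have vB : v \in B.
  apply: contraT => vB; have BA : B \subset A.
    by apply/subsetP => z zB; rewrite !inE; apply: contraNneq vB => <-.
  have cBS : closed_in B S.
    by move=> p q pB qB; apply: cS; apply: (subsetP BA).
  case/negP: abS; apply/eqP; apply/idP/idP => hS.
    exact: (subsetP (connected_closed cB aB hS cBS)).
  exact: (subsetP (connected_closed cB bB hS cBS)).
have BD : B \notin D.
  apply: contra bT => BD; rewrite !inE; apply/orP; right; apply/bigcupP; exists B => //.
  by rewrite !inE bB andbT; move: bA; rewrite !inE.
have : Q (B |: D).
  rewrite /Q subUset sub1set BF DF /=.
  have -> : T (B |: D) = T D :|: (B :\ v).
    by rewrite /T bigcup_setU big_set1 setUA setUAC.
  have wE : waste (B |: D) = #|B| - 2 + waste D.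
    by rewrite /waste (big_setU1 _ BD).
  have := cardsUI (T D) (B :\ v); have := cardsD1 v B; rewrite vB wE.
  have : 0 < #|T D :&: (B :\ v)|.
    apply/card_gt0P; exists a; rewrite inE aT !inE aB andbT.
    by move: aA; rewrite !inE.
  move: hD B3; move: #|_ :|: _| #|_ :&: _| #|_ :\ _| #|B| (waste D) #|T D| => p q r s w z.
  by clear; lia.
by move=> /Dmax; rewrite /= cardsU1 BD add1n ltnn.
Qed.

(** * Isomorphisms, joins, paths and cycles *)

Lemma iso_sym (G H : sgraph) : G ≅ H -> H ≅ G.
Proof.
case=> f [[g fK gK] hf]; exists g; split; first by exists f.
by move=> x y; rewrite -hf !gK.
Qed.

Lemma iso_trans (G H K : sgraph) : G ≅ H -> H ≅ K -> G ≅ K.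
Proof.
case=> f [fb hf] [g [gb hg]]; exists (g \o f); split; first exact: bij_comp.
by move=> x y; rewrite /= hg hf.
Qed.

Lemma iso_join (G G' H H' : sgraph) : G ≅ G' -> H ≅ H' -> G ∨ H ≅ G' ∨ H'.
Proof.
case=> f [[f' fK f'K] hf] [g [[g' gK g'K] hg]].
exists (fun z : G ∨ H => match z with inl x => inl (f x) | inr y => inr (g y) end : G' ∨ H').
split; last by move=> [x|x] [y|y] //=.
by exists (fun z : G' ∨ H' =>
  match z with inl x => inl (f' x) | inr y => inr (g' y) end : G ∨ H);
  move=> [x|x] /=; rewrite ?fK ?gK ?f'K ?g'K.
Qed.

Lemma iso_complete (H : sgraph) : (forall x y : H, x != y -> adj x y) ->
  H ≅ complete #|H|.
Proof.
move=> h; exists (enum_rank : H -> complete #|H|); split; first exact: enum_rank_bij.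
move=> x y; rewrite /= /complete_adj (inj_eq enum_rank_inj).
by have [->|/h->] := eqVneq x y; rewrite ?adj_irrefl.
Qed.

Lemma iso_edgeless (H : sgraph) : (forall x y : H, ~~ adj x y) -> H ≅ edgeless #|H|.
Proof.
move=> h; exists (enum_rank : H -> edgeless #|H|); split; first exact: enum_rank_bij.
by move=> x y; rewrite /= /edgeless_adj (negbTE (h x y)).
Qed.

Lemma join_split (G : sgraph) (A : {set G}) :
  (forall x y, x \in A -> y \notin A -> adj x y) ->
  G ≅ induced_graph A ∨ induced_graph (~: A).
Proof.
move=> hA; apply: iso_sym.
pose f (z : induced_graph A ∨ induced_graph (~: A)) : G :=
  match z with inl x => val x | inr y => val y end.
exists f; split; last first.
  move=> [[x xA]|[x xA]] [[y yA]|[y yA]] //=; first by apply: hA; rewrite // -in_setC.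
  by rewrite adj_sym; apply: hA; rewrite // -in_setC.
apply: inj_card_bij.
  move=> [[x xA]|[x xA]] [[y yA]|[y yA]] /= h; first by congr inl; apply: val_inj.
  - by exfalso; have := yA; rewrite in_setC -h xA.
  - by exfalso; have := xA; rewrite in_setC h yA.
  - by congr inr; apply: val_inj.
by rewrite card_sum !card_induced cardsC.
Qed.

Definition embedding (H G : sgraph) (g : H -> G) :=
  injective g /\ forall x y, adj (g x) (g y) = adj x y.

Lemma embedding_connected (H G : sgraph) (g : H -> G) (A : {set H}) :
  embedding g -> induced_connected A -> induced_connected (g @: A).
Proof.
move=> [gi ga] cA; apply: connected_intro => _ S /imsetP[x xA ->] xS cS.
apply/subsetP => _ /imsetP[y yA ->].
have: A \subset [set z | g z \in S].
  apply: (connected_closed cA xA); rewrite ?inE // => u v uA vA uv; rewrite !inE.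
  by apply: cS; rewrite ?imset_f // ga.
by move=> /subsetP /(_ _ yA); rewrite inE.
Qed.

Lemma embedding_connected_inv (H G : sgraph) (g : H -> G) (A : {set H}) :
  embedding g -> induced_connected (g @: A) -> induced_connected A.
Proof.
move=> [gi ga] cA; apply: connected_intro => x S xA xS cS.
have: g @: A \subset g @: S.
  apply: (connected_closed cA (imset_f g xA)); first exact: imset_f.
  move=> _ _ /imsetP[u uA ->] /imsetP[v vA ->]; rewrite ga => uv.
  by rewrite !(mem_imset _ _ gi); apply: cS.
move=> /subsetP h; apply/subsetP => y yA.
by have := h _ (imset_f g yA); rewrite (mem_imset _ _ gi).
Qed.

Lemma embedding_val (G : sgraph) (A : {set G}) :
  embedding (fun x : induced_graph A => val x).
Proof. by split=> //; apply: val_inj. Qed.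

Lemma embedding_comp (K H G : sgraph) (f : K -> H) (g : H -> G) :
  embedding f -> embedding g -> embedding (g \o f).
Proof.
by move=> [fi fa] [gi ga]; split=> [|x y]; [apply: inj_comp|rewrite /= ga fa].
Qed.

Lemma join_embeddings (G K H : sgraph) : G ≅ K ∨ H ->
  exists (a : K -> G) (g : H -> G), [/\ embedding a, embedding g,
    (forall x y, adj (a x) (g y)),
    (forall x y, a x != g y) &
    forall z, (exists x, z = a x) \/ (exists y, z = g y)].
Proof.
case=> f [[f' fK f'K] hf].
have f'i := can_inj f'K.
exists (fun x => f' (inl x)), (fun y => f' (inr y)); split.
- by split=> [x y /f'i[]|x y] //; rewrite -hf !f'K.
- by split=> [x y /f'i[]|x y] //; rewrite -hf !f'K.
- by move=> x y; rewrite -hf !f'K.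
- by move=> x y; rewrite (inj_eq f'i).
- by move=> z; rewrite -(fK z); case: (f z) => x; [left|right]; exists x.
Qed.

(** * Connected graphs of maximum degree two *)

Section MaxDegreeTwo.
Variable H : sgraph.
Implicit Types (x y z : H) (s p : seq H).
Hypothesis connH : induced_connected [set: H].
Hypothesis deg2 : forall x, #|nbr x| <= 2.

Lemma maximal_path x : exists p, [/\ uniq (x :: p), path (@adj H) x p &
  forall y, adj (last x p) y -> y \in x :: p].
Proof.
suff h k p : #|H| <= k + size p -> uniq (x :: p) -> path (@adj H) x p ->
    exists p, [/\ uniq (x :: p), path (@adj H) x p &
      forall y, adj (last x p) y -> y \in x :: p].
  by apply: (h #|H| [::]) => //; rewrite addn0.
elim: k p => [|k IH] p hk up pp.
  by have := max_card (mem (x :: p)); rewrite (card_uniqP up) leqNgt ltnS hk.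
have [/forallP none|] := boolP [forall y, adj (last x p) y ==> (y \in x :: p)].
  by exists p; split=> // y; apply/implyP.
rewrite negb_forall => /existsP[y]; rewrite negb_imply => /andP[py yp].
apply: (IH (rcons p y)); first by rewrite size_rcons addnS.
  by rewrite -rcons_cons rcons_uniq yp.
by rewrite rcons_path pp py.
Qed.

Section Along.
Variables (x0 : H) (p : seq H).
Let s := x0 :: p.
Hypothesis us : uniq s.
Hypothesis ps : path (@adj H) x0 p.
Hypothesis ms : forall y, adj (last x0 p) y -> y \in s.

Let nths i := nth x0 s i.

Let adjS i : i < size p -> adj (nths i) (nths i.+1).
Proof. by move=> hi; apply: (pathP x0 ps). Qed.

Lemma path_inner i y : 0 < i -> i < size p -> adj (nths i) y -> y = nths i.-1 \/ y = nths i.+1.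
Proof.
case: i => // i _ hi; have := adjS (ltnW hi); rewrite adj_sym => a1; have a2 := adjS hi.
have ne : nths i != nths i.+2.
  by rewrite nth_uniq // ?(ltnW (ltnW hi)) ?ltn_eqF //= ltnS ltnW // ltnW.
have := card2_of_sub (x := nths i) (y := nths i.+2) (A := nbr (nths i.+1)).
rewrite !in_nbr => /(_ a1 a2 ne (deg2 _)) E; rewrite -in_nbr E !inE.
by case/orP => /eqP; [left|right].
Qed.

Let s_index y : y \in s -> exists2 i, i < size s & y = nths i.
Proof. by move=> ys; exists (index y s); rewrite ?index_mem // /nths nth_index. Qed.

Hypothesis end0 : forall y, adj x0 y -> y = nths 1 \/ y = last x0 p.

(** No vertex of the path has a neighbour off it, so connectedness makes the path span. The
    assumption [end0] fits both a start of degree at most 1 and a path that closes up, so paths and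
    cycles share this part. *)
Lemma maximal_path_all y : y \in s.
Proof.
have : [set: H] \subset [set y in s].
  apply: (connected_closed connH (in_setT x0)); first by rewrite !inE eqxx.
  move=> u v _ _ uv; rewrite !in_set => /s_index[i hi uE]; rewrite uE in uv.
  have [i0|i0] := posnP i.
    rewrite i0 in uv; case: (end0 uv) => ->; last exact: mem_last.
    have [p1|] := ltnP 1 (size s); first exact: mem_nth.
    by move=> h; rewrite /nths nth_default // mem_head.
  have [hp|hp] := ltnP i (size p).
    by case: (path_inner i0 hp uv) => ->; apply: mem_nth => //=; lia.
  apply: ms; rewrite (_ : last _ _ = nths i) //.
  by rewrite /nths (_ : i = size p) ?nth_last //; move: hi => /=; lia.
by move=> /subsetP /(_ y (in_setT y)); rewrite inE.
Qed.

Lemma size_maximal_path : size s = #|H|.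
Proof.
rewrite -(card_uniqP us); apply: eq_card => y.
by have := maximal_path_all y; rewrite !inE.
Qed.

Lemma adj_along i j : i < j -> j < size s -> adj (nths i) (nths j) =
  (j == i.+1) || ((i == 0) && (j == size p) && adj x0 (last x0 p)).
Proof.
move=> ij hj; have hip : i < size p by move: hj => /=; lia.
apply/idP/orP => [a|[/eqP->|/andP[/andP[/eqP-> /eqP->]]]]; last 2 first.
- exact: adjS.
- by rewrite /nths nth_last.
have nE k : k < size s -> nths j = nths k -> j = k.
  by move=> hk /eqP; rewrite nth_uniq // => /eqP.
have [i0|i0] := posnP i; last first.
  case: (path_inner i0 hip a) => /nE; last by move=> -> //; left.
  by move=> h; move: ij; rewrite h //=; lia.
rewrite i0 in a *; case: (end0 a) => h.
  left; apply/eqP; apply: nE => //=; lia.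
by right; rewrite -h a andbT /=; apply/eqP/nE => //; rewrite /nths nth_last.
Qed.

Definition path_position y : 'I_#|H| :=
  Ordinal (leq_trans (eq_ind_r is_true (maximal_path_all y) (index_mem y s))
    (eq_leq size_maximal_path)).

Lemma path_position_bij : bijective path_position.
Proof.
apply: inj_card_bij; last by rewrite card_ord.
move=> y z /(congr1 val) h; have {}h : index y s = index z s := h.
by rewrite -(nth_index x0 (maximal_path_all y)) h nth_index ?maximal_path_all.
Qed.

Lemma adj_position (e : rel 'I_#|H|) : symmetric e -> irreflexive e ->
  (forall i j : 'I_#|H|, i < j -> e i j =
    (j == i.+1 :> nat) || ((i == 0 :> nat) && (j == size p :> nat) && adj x0 (last x0 p))) ->
  forall y z, e (path_position y) (path_position z) = adj y z.
Proof.
move=> es ei he y z.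
wlog yz : y z / path_position y < path_position z => [hw|].
  case: (ltngtP (path_position y) (path_position z)) => h; first exact: hw.
    by rewrite es adj_sym; apply: hw.
  by rewrite (bij_inj path_position_bij (val_inj h)) ei adj_irrefl.
have zs : index z s < size s by rewrite index_mem maximal_path_all.
have := adj_along (i := index y s) (j := index z s) yz zs.
by rewrite he // /nths !nth_index ?maximal_path_all // => ->.
Qed.

End Along.

(* Follow a maximal path from an end if there is one, from anywhere otherwise. *)
Lemma path_or_cycle (x1 : H) :
  (H ≅ path_graph #|H| /\ exists x, #|nbr x| <= 1) \/
  [/\ H ≅ cycle_graph #|H|, 2 < #|H| & forall x, #|nbr x| = 2].
Proof.
have [/existsP[x0 x0d]|no_end] := boolP [exists x : H, #|nbr x| <= 1].
  left; split; last by exists x0.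
  have [p [us ps ms]] := maximal_path x0.
  have end0 y : adj x0 y -> y = nth x0 (x0 :: p) 1.
    move=> x0y; case: p us ps ms => [|z p] _ /= ps ms.
      by have := ms _ x0y; rewrite inE => /eqP yx; rewrite yx adj_irrefl in x0y.
    by have /card_le1_eqP := x0d; apply; rewrite in_nbr //; case/andP: ps.
  have end0' y : adj x0 y -> y = nth x0 (x0 :: p) 1 \/ y = last x0 p.
    by move=> /end0; left.
  exists (path_position us ps ms end0'); split; first exact: path_position_bij.
  apply: adj_position => [||i j ij]; [exact: path_adj_sym|exact: path_adj_irrefl|].
  rewrite /= /path_adj.
  have -> : (i == j.+1 :> nat) = false by apply: ltn_eqF; apply: ltn_trans ij (ltnSn j).
  rewrite orbF.
  case: eqVneq => //= ji; apply/esym/negbTE; apply/negP => /andP[/andP[/eqP i0 /eqP jp] /end0].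
  move=> h; have: nth x0 (x0 :: p) j = nth x0 (x0 :: p) 1.
    by rewrite jp -h nth_last.
  move: ij ji jp; rewrite i0 => j0 j1 jp /eqP.
  have jn : j < size (x0 :: p) by rewrite jp.
  have n1 : 1 < size (x0 :: p) by rewrite /= -jp ltnS.
  by rewrite nth_uniq // (negbTE j1).
right; have deg x : #|nbr x| = 2.
  move/existsPn: no_end => /(_ x); rewrite -ltnNge => h.
  by apply/eqP; rewrite eqn_leq deg2.
have [p [us ps ms]] := maximal_path x1.
have n3 : 2 < #|H| by have := card_nbr_lt x1; rewrite deg.
have nbr_ne x z : exists2 y, adj x y & y != z.
  have : 0 < #|nbr x :\ z| by have := cardsD1 z (nbr x); rewrite deg; case: (z \in _); lia.
  by case/card_gt0P => y; rewrite !inE => /andP[yz xy]; exists y.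
have p0 : 0 < size p.
  have [y xy _] := nbr_ne x1 x1; case: p us ps ms => //= _ _ /(_ y xy); rewrite inE => /eqP yx.
  by rewrite yx adj_irrefl in xy.
have inner i y : 0 < i -> i < size p -> adj (nth x1 (x1 :: p) i) y ->
    y = nth x1 (x1 :: p) i.-1 \/ y = nth x1 (x1 :: p) i.+1.
  exact: (path_inner us ps).
(* The last vertex has a second neighbour, which lies on the path by maximality. Inner vertices
   already have their two neighbours, so it is the first one. *)
have closing : adj x1 (last x1 p).
  have lE : last x1 p = nth x1 (x1 :: p) (size p) by rewrite nth_last.
  have [y ly yn] := nbr_ne (last x1 p) (nth x1 (x1 :: p) (size p).-1).
  have ys := ms _ ly; have yE := nth_index x1 ys.
  have hi : index y (x1 :: p) <= size p by rewrite -ltnS -/(size (x1 :: p)) index_mem.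
  have [i0|i0] := posnP (index y (x1 :: p)).
    by rewrite i0 in yE; rewrite adj_sym; move: ly; rewrite -yE.
  have [ip|ip] := ltnP (index y (x1 :: p)) (size p); last first.
    have iE : index y (x1 :: p) = size p by lia.
    by rewrite -yE iE -lE adj_irrefl in ly.
  move: yE i0 ip {hi}; move: (index y (x1 :: p)) => i yE i0 ip.
  have := inner _ (last x1 p) i0 ip; rewrite yE adj_sym => /(_ ly).
  rewrite lE; case=> /eqP; rewrite nth_uniq //= ?ltnS ?(leq_trans (leq_pred _) (ltnW ip)) //.
    by move=> /eqP h; move: ip i0; rewrite h; clear; lia.
  by move=> /eqP h; case/eqP: yn; rewrite -yE h.
have end0 y : adj x1 y -> y = nth x1 (x1 :: p) 1 \/ y = last x1 p.
  have a1 : adj x1 (nth x1 (x1 :: p) 1) by apply: (pathP x1 ps 0).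
  have p1 : 1 < size p.
    rewrite ltnNge; apply/negP => h; have pE : size p = 1 by lia.
    have [z lz zx] := nbr_ne (last x1 p) x1.
    have := ms _ lz; rewrite inE (negbTE zx) /=; case: p pE lz {us ps ms p0 inner closing a1 h} => [|a []] //= _ az.
    by rewrite inE => /eqP za; rewrite za adj_irrefl in az.
  have ne : nth x1 (x1 :: p) 1 != last x1 p.
    rewrite (_ : last x1 p = nth x1 (x1 :: p) (size p)); last by rewrite nth_last.
    by rewrite nth_uniq //= ?ltnS ?ltn_eqF.
  rewrite -in_nbr (card2_of_sub (A := nbr x1) _ _ ne) ?in_nbr ?deg // !inE.
  by case/orP => /eqP; [left|right].
split=> //; exists (path_position us ps ms end0); split; first exact: path_position_bij.
apply: adj_position => [||i j ij]; [exact: cycle_adj_sym|exact: cycle_adj_irrefl|].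
have sE : (size p).+1 = #|H| := size_maximal_path us ps ms end0.
have jn := ltn_ord j.
have ij_ne : i != j by apply: contraTneq ij => ->; rewrite ltnn.
rewrite /= /cycle_adj closing andbT ij_ne /=.
rewrite (modn_small (leq_ltn_trans ij jn)); congr (_ || _).
have [jl|jl] := eqVneq (j : nat) (size p); last first.
  have jS : j.+1 < #|H| by rewrite ltn_neqAle jn -[X in _ != X]sE eqSS jl.
  by rewrite modn_small // andbF; apply: ltn_eqF; apply: ltn_trans ij (ltnSn j).
by rewrite jl [X in X %% _]sE modnn andbT.
Qed.

End MaxDegreeTwo.

(** * Graphs with two poles *)

(** The common part of [double_apex] and [double_hub], which differ only in whether the two poles
    are adjacent. *)
Definition poles (G : sgraph) (u w : G) :=
  [/\ u != w, (forall x, x != u -> x != w -> adj u x && adj w x)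
    & induced_connected (~: [set u; w])].

Lemma double_apexE (G : sgraph) (u w : G) :
  double_apex u w <-> poles u w /\ ~~ adj u w.
Proof. by split=> [[uw nuw h c]|[[uw h c] nuw]]. Qed.

Lemma double_hubE (G : sgraph) (u w : G) : double_hub u w <-> poles u w /\ adj u w.
Proof.
split=> [[uw du dw c]|[[uw h c] auw]].
  by split; [split=> // x xu xw; rewrite du // dw|apply: du; rewrite eq_sym].
split=> // x; [have [->|xw] := eqVneq x w|have [->|xu] := eqVneq x u] => // h'.
- by case/andP: (h x h' xw).
- by rewrite adj_sym.
- by case/andP: (h x xu h').
Qed.

(** Otherwise deleting the neighbours of [x] would cut it off; k < |G| guarantees that another
    vertex is left. *)
Lemma kconnected_degree k (G : sgraph) (x : G) : kconnected k G -> k <= #|nbr x|.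
Proof.
case/andP=> kn /forallP h; rewrite leqNgt; apply/negP => dx.
have /implyP/(_ dx) c := h (nbr x).
have xN : x \in ~: nbr x by rewrite !inE adj_irrefl.
have := connected_closed c xN (set11 x).
have /[swap] /[apply] : closed_in (~: nbr x) [set x].
  by move=> u v _ + uv; rewrite !inE => + /eqP uE; rewrite -uE uv.
move/subset_leq_card; rewrite cards1; have := cardsC (nbr x); move: dx kn.
by move: #|G| #|nbr x| #|~: _| => a b d; clear; lia.
Qed.

Lemma nonempty_compl (T : finType) (A : {set T}) : #|A| < #|T| -> exists x, x \notin A.
Proof.
move=> h; have /card_gt0P[x] : 0 < #|~: A| by have := cardsC A; move: h; clear; lia.
by rewrite inE; exists x.
Qed.

Section Poles.
Variables (G : sgraph) (u w : G).
Hypothesis puw : poles u w.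

Let uw : u != w. Proof. by case: puw. Qed.
Let adju x : x != u -> x != w -> adj u x.
Proof. by case: puw => _ h _ xu /(h _ xu)/andP[]. Qed.
Let adjw x : x != u -> x != w -> adj w x.
Proof. by case: puw => _ h _ xu /(h _ xu)/andP[]. Qed.
Let conn : induced_connected (~: [set u; w]). Proof. by case: puw. Qed.

Let card_rest : #|~: [set u; w]| = #|G| - 2.
Proof. by rewrite -(cardsC [set u; w]) cards2 uw addKn. Qed.

(** If one pole remains, it dominates what is left. If both remain, the bound on [S] leaves a third
    vertex, which joins them. *)
Lemma poles_sub_connected (S : {set G}) : #|S| < #|G| - 2 -> (u \notin S) || (w \notin S) ->
  induced_connected (~: S).
Proof.
have one a b : [set a; b] = [set u; w] -> a \notin S -> b \in S ->
    induced_connected (~: S).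
  move=> E aS bS; apply: (@connected_dominated _ _ a); rewrite ?inE //.
  move=> y; rewrite inE => yS ya; have yb : y != b by apply: contraNneq yS => ->.
  have /set2P[aE|aE] : a \in [set u; w] by rewrite -E !inE eqxx.
    have : w \in [set a; b] by rewrite E !inE eqxx orbT.
    rewrite !inE aE eq_sym (negbTE uw) /= => /eqP wb; apply: adju; rewrite -?aE //.
    by rewrite wb.
  have : u \in [set a; b] by rewrite E !inE eqxx.
  rewrite !inE aE (negbTE uw) /= => /eqP ub; rewrite -aE in ya *; rewrite aE; apply: adjw.
    by rewrite ub.
  by rewrite -aE.
move=> hS; have [uS|uS] := boolP (u \in S); have [wS|wS] := boolP (w \in S) => //= _.
- by apply: (one w u); rewrite // setUC.
- exact: (one u w).
have [|x] := @nonempty_compl G ([set u; w] :|: S).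
  have := cardsUI [set u; w] S; rewrite cards2 uw; move: hS.
  by move: #|_ :|: _| #|_ :&: _| #|S| #|G| => a b c d; clear; lia.
rewrite !inE !negb_or => /andP[/andP[xu xw] xS].
apply: (@connected_root _ _ x); rewrite ?inE // => D xD cD.
have uD : u \in D by apply: (cD x); rewrite ?inE // adj_sym adju.
have wD : w \in D by apply: (cD x); rewrite ?inE // adj_sym adjw.
apply/subsetP => y; rewrite inE => yS.
have [->//|yu] := eqVneq y u; have [->//|yw] := eqVneq y w.
by apply: (cD u); rewrite ?inE //; apply: adju.
Qed.

Let sub_poles_card (S : {set G}) : u \in S -> w \in S -> [set u; w] \subset S.
Proof. by move=> uS wS; rewrite subUset !sub1set uS wS. Qed.

Lemma poles_3connected : 4 < #|G| -> kconnected 3 G.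
Proof.
move=> n5; rewrite /kconnected ltnW //; apply/forallP => S; apply/implyP => S3.
have [|] := boolP ((u \notin S) || (w \notin S)).
  by apply: poles_sub_connected; move: n5 S3; clear; lia.
rewrite negb_or !negbK => /andP[uS wS].
suff <- : [set u; w] = S by [].
by apply/eqP; rewrite eqEcard sub_poles_card // cards2 uw.
Qed.

Lemma hub_3connected : adj u w -> 3 < #|G| -> kconnected 3 G.
Proof.
move=> auw n4; have [uw' du dw c] : double_hub u w by apply/double_hubE.
rewrite /kconnected n4; apply/forallP => S; apply/implyP => S3.
have [uS|uS] := boolP (u \in S); last first.
  by apply: (@dominated_connected _ _ u); rewrite ?inE.
have [wS|wS] := boolP (w \in S); last first.
  by apply: (@dominated_connected _ _ w); rewrite ?inE.
suff <- : [set u; w] = S by [].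
by apply/eqP; rewrite eqEcard sub_poles_card // cards2 uw.
Qed.

Lemma poles_4connected : 5 < #|G| ->
  (forall x, x != u -> x != w -> induced_connected (~: [set u; w; x])) ->
  kconnected 4 G.
Proof.
move=> n6 hx; rewrite /kconnected (ltnW n6); apply/forallP => S; apply/implyP => S4.
have [|] := boolP ((u \notin S) || (w \notin S)).
  by apply: poles_sub_connected; move: n6 S4; clear; lia.
rewrite negb_or !negbK => /andP[uS wS]; have sub := sub_poles_card uS wS.
have [/eqP|[x]] := set_0Vmem (S :\: [set u; w]).
  rewrite setD_eq0 => Ssub; suff <- : [set u; w] = S by [].
  by apply/eqP; rewrite eqEsubset sub.
rewrite !inE negb_or => /andP[/andP[xu xw] xS].
suff <- : [set u; w; x] = S by apply: hx.
apply/eqP; rewrite eqEcard setUC subUset sub1set xS sub.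
by rewrite cardsU1 !inE negb_or xu xw cards2 uw.
Qed.

Lemma hub_mc : adj u w -> 3 < #|G| -> #|edges G| + 4 <= mc G + #|G|.
Proof.
move=> auw n4; have A1 : 1 < #|~: [set u; w]| by rewrite card_rest; move: n4; clear; lia.
have [_ du dw _] : double_hub u w by apply/double_hubE.
have := mc_ge_tree conn A1; rewrite card_rest => h.
have {}h : #|edges G| + 2 <= mc G + (#|G| - 2).
  apply: h => x y xy nxy; rewrite !inE !negb_or.
  have out (a b : G) : dominating a -> b != a -> ~~ adj a b -> False by move=> da /da->.
  by split; apply/andP; split; apply/eqP => E; rewrite E in xy nxy;
    [case: (out u y)|case: (out w y)|case: (out u x)|case: (out w x)];
    rewrite // 1?eq_sym // adj_sym.
by move: n4 h; clear; lia.
Qed.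

Lemma poles_mc : 3 < #|G| -> #|edges G| + 3 <= mc G + #|G|.
Proof.
move=> n4; have A1 : 1 < #|~: [set u; w]| by rewrite card_rest; move: n4; clear; lia.
have [auw|nauw] := boolP (adj u w); first by have := hub_mc auw n4; clear; lia.
have /card_gt0P[x xA] := ltnW A1.
have [xu xw] : x != u /\ x != w by move: xA; rewrite !inE negb_or => /andP[].
have := @mc_ge_two_trees G (~: [set u; w]) u w x conn A1.
rewrite !inE !eqxx orbT => /(_ isT isT); rewrite negb_or xu xw => /(_ isT uw).
move=> /(_ (adju xu xw) (adjw xu xw)); rewrite card_rest => h.
have {}h : #|edges G| + 1 <= mc G + (#|G| - 2).
  apply: h => y z yz nyz; rewrite !inE !negb_or.
  have other a b : a != b -> ~~ adj a b -> (a == u) || (a == w) ->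
      [set a; b] = [set u; w].
    move=> ab nab /orP[] /eqP aE; rewrite aE in ab nab *.
      suff -> : b = w by []; apply/eqP; apply: contraNT nab => bw.
      by apply: adju; rewrite // eq_sym.
    rewrite setUC; suff -> : b = u by []; apply/eqP; apply: contraNT nab => bu.
    by apply: adjw; rewrite // eq_sym.
  have [yu|] := boolP ((y == u) || (y == w)); first by right; apply: other.
  have [zu|] := boolP ((z == u) || (z == w)).
    by right; rewrite setUC; apply: other; rewrite // 1?eq_sym // adj_sym.
  by rewrite !negb_or => -> ->; left.
by move: n4 h; clear; lia.
Qed.

Section Rest.
Variables (K : sgraph) (g : K -> G).
Hypotheses (eg : embedding g) (gT : g @: [set: K] = ~: [set u; w]).

Let g_rest x : g x != u /\ g x != w.
Proof.
have : g x \in ~: [set u; w] by rewrite -gT imset_f ?inE.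
by rewrite !inE negb_or => /andP[].
Qed.

Lemma nbr_rest (x : K) : nbr (g x) = [set u; w] :|: g @: nbr x.
Proof.
have [gu gw] := g_rest x; apply/setP => z; rewrite !inE.
have [->|zu] := eqVneq z u; first by rewrite adj_sym adju.
have [->|zw] := eqVneq z w; first by rewrite adj_sym adjw.
have : z \in g @: [set: K] by rewrite gT !inE negb_or zu.
by case/imsetP => y _ ->; rewrite (mem_imset _ _ eg.1) inE eg.2.
Qed.

Lemma card_nbr_rest (x : K) : #|nbr (g x)| = #|nbr x| + 2.
Proof.
have -> : #|nbr x| = #|g @: nbr x| by rewrite card_imset //; exact: eg.1.
rewrite nbr_rest cardsU cards2 uw (_ : _ :&: _ = set0) ?cards0 ?subn0 1?addnC //.
apply/setP => z; rewrite !inE; apply/negbTE/negP => /andP[zuw /imsetP[y _ zE]].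
by have [gu gw] := g_rest y; rewrite zE (negbTE gu) (negbTE gw) in zuw.
Qed.

Lemma card_K : #|K| = #|G| - 2.
Proof. by rewrite -card_rest -gT card_imset ?cardsT //; exact: eg.1. Qed.

Hypothesis K33 : K33_free G.

(** Three neighbours in the rest would form a K_{3,3} with the two poles and the vertex itself. *)
Lemma rest_degree (x : K) : #|nbr x| <= 2.
Proof.
rewrite leqNgt; apply/negP => d3; have [gu gw] := g_rest x.
apply: (K33 (A := [set u; w; g x]) (B := g @: nbr x)).
- rewrite setUC cardsU1 cards2 uw !inE negb_or.
  by have [-> ->] := g_rest x.
- by rewrite card_imset //; exact: eg.1.
move=> a b; rewrite !inE => /orP[/orP[]|] /eqP-> /imsetP[y xy ->]; have [yu yw] := g_rest y.
- exact: adju.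
- exact: adjw.
- by rewrite eg.2 -in_nbr.
Qed.

(** An end of the path has degree at most 3 in [G], which later rules out 4-connectivity. The
    degrees on the cycle serve to count edges. *)
Lemma rest_path_or_cycle : 2 < #|G| ->
  (K ≅ path_graph (#|G| - 2) /\ exists x : G, #|nbr x| <= 3) \/
  [/\ K ≅ cycle_graph (#|G| - 2), 4 < #|G| & forall x : K, #|nbr x| = 2].
Proof.
move=> n3; have cK : induced_connected [set: K].
  by apply: (embedding_connected_inv eg); rewrite gT.
have /card_gt0P[x1 _] : 0 < #|K| by rewrite card_K subn_gt0.
have := path_or_cycle cK rest_degree x1; rewrite card_K.
case=> [[iso [x hx]]|[iso n h]]; [left|right]; split=> //.
  by exists (g x); rewrite card_nbr_rest; move: hx; clear; lia.
by move: n; clear; lia.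
Qed.

(** With adjacent poles a cycle would give degree sum 2(n - 1) + 4(n - 2) = 6n - 10, exceeding the
    bound 6n - 12. *)
Lemma hub_rest_path : adj u w -> ~ complete_minor 5 G -> 2 < #|G| ->
  K ≅ path_graph (#|G| - 2) /\ exists x : G, #|nbr x| <= 3.
Proof.
move=> auw K5 n3; case: (rest_path_or_cycle n3) => // -[_ n5 d2].
have := K5_minor_free_arcs K5 n3; suff -> : arcs G = 2 * (#|G| - 1) + 4 * (#|G| - 2).
  by move: n5; clear; lia.
have [_ du dw _] : double_hub u w by apply/double_hubE.
have dom (a : G) : dominating a -> #|nbr a| = #|G| - 1.
  move=> da; rewrite -(cardsC [set a]) cards1 addKn; apply: eq_card => y; rewrite !inE.
  by have [->|/da->] := eqVneq y a; rewrite ?adj_irrefl.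
rewrite /arcs (bigD1 u) //= (bigD1 w) 1?eq_sym //= !dom // addnA addnn -mul2n.
congr (_ + _); rewrite mulnC -card_rest -sum_nat_const.
apply: eq_big => [z|z /andP[zu zw]]; first by rewrite !inE negb_or.
have : z \in g @: [set: K] by rewrite gT !inE negb_or zu zw.
by case/imsetP => y _ ->; rewrite card_nbr_rest d2.
Qed.

End Rest.

Let A := [set u; w].

Lemma poles_join : G ≅ induced_graph A ∨ induced_graph (~: A).
Proof.
apply: join_split => x y; rewrite !inE negb_or => xA /andP[yu yw].
by case/orP: xA => /eqP->; [apply: adju|apply: adjw].
Qed.

Lemma induced_image (B : {set G}) : [set val x | x in [set: induced_graph B]] = B.
Proof.
apply/setP => x; apply/imsetP/idP => [[y _ ->]|xB]; first exact: (valP y).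
by exists (exist _ x xB).
Qed.

Lemma induced_poles_edgeless : ~~ adj u w -> induced_graph A ≅ edgeless 2.
Proof.
move=> nuw; rewrite -(_ : #|induced_graph A| = 2); last by rewrite card_induced cards2 uw.
apply: iso_edgeless => -[x xA] [y yA]; change (~~ adj x y).
move: xA yA; rewrite !inE => /orP[] /eqP-> /orP[] /eqP->; rewrite ?adj_irrefl //.
by rewrite adj_sym.
Qed.

Lemma induced_poles_complete : adj u w -> induced_graph A ≅ complete 2.
Proof.
move=> auw; rewrite -(_ : #|induced_graph A| = 2); last by rewrite card_induced cards2 uw.
apply: iso_complete => -[x xA] [y yA]; rewrite -(inj_eq val_inj) /= => xy.
change (adj x y); move: xA yA xy.
rewrite !inE => /orP[] /eqP-> /orP[] /eqP->; rewrite ?eqxx //.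
by rewrite adj_sym.
Qed.

End Poles.

(** * Connectivity of paths and cycles, and joins read as dominating vertices or poles *)

Lemma path_graph_connected k : induced_connected [set: path_graph k].
Proof.
case: k => [|k]; first by apply/connected_intro => -[].
apply: (@connected_root _ _ (ord0 : path_graph k.+1)) => // S S0 cS.
apply/subsetP => -[i hi] _; elim: i hi => [|i IH] hi.
  by rewrite (_ : Ordinal hi = ord0) //; apply: val_inj.
apply: (cS (Ordinal (ltnW hi) : path_graph k.+1)); rewrite ?inE // /path_adj /=.
by rewrite /path_adj /= eqxx.
Qed.

Lemma cycle_graph_connected k : 2 < k -> induced_connected [set: cycle_graph k].
Proof.
case: k => // k k2.
apply: (@connected_root _ _ (ord0 : cycle_graph k.+1)) => // S S0 cS.
apply/subsetP => -[i hi] _; elim: i hi => [|i IH] hi.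
  by rewrite (_ : Ordinal hi = ord0) //; apply: val_inj.
apply: (cS (Ordinal (ltnW hi) : cycle_graph k.+1)); rewrite ?inE //.
rewrite /= /cycle_adj -(inj_eq val_inj) /= modn_small ?eqxx //.
by rewrite ltn_eqF.
Qed.

Lemma cycle_graph_minus_connected k (i : cycle_graph k) : 2 < k ->
  induced_connected (~: [set i]).
Proof.
move=> k2; have k0 : 0 < k by apply: leq_trans k2.
(* The remaining vertices in cyclic order, starting just after [i]; here t runs below k - 1. *)
pose v t : cycle_graph k := Ordinal (ltn_pmod (i + t.+1) k0).
have vi t : t < k.-1 -> v t \in ~: [set i].
  move=> ht; rewrite !inE -(inj_eq val_inj) /=.
  have : i + 0 != i + t.+1 %[mod k].
    by rewrite eqn_modDl mod0n modn_small // -(ltn_predK k2) ltnS.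
  by rewrite addn0 eq_sym (modn_small (ltn_ord i)).
have step t : t.+1 < k.-1 -> adj (v t) (v t.+1).
  move=> ht; rewrite /= /cycle_adj -(inj_eq val_inj) /=.
  rewrite [_.+1 %% k](_ : _ = (i + t.+2) %% k); last first.
    by rewrite -addn1 modnDml addn1 -addnS.
  rewrite eqxx andbT.
  have : i + t.+1 + 0 != i + t.+1 + 1 %[mod k].
    by rewrite eqn_modDl mod0n modn_small // ltnW.
  by rewrite addn0 addn1 -addnS.
apply: (@connected_root _ _ (v 0)) => [|S S0 cS].
  by apply: vi; rewrite -subn1 subn_gt0 ltnW.
have all t : t < k.-1 -> v t \in S.
  elim: t => // t IH ht; apply: (cS (v t)); [apply: vi|exact: vi|exact: step|apply: IH]; exact: ltnW.
apply/subsetP => j; rewrite !inE => ji.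
have [lt|ge] := ltnP i j.
  have jE : v (j - i.+1) = j.
    by apply: val_inj; rewrite /= -subSn // subSS subnKC ?modn_small // ltnW.
  rewrite -jE; apply: all; have := ltn_ord j; move: lt; move: (nat_of_ord i) (nat_of_ord j).
  by move=> a b; clear; lia.
have lt : j < i by rewrite ltn_neqAle ge andbT.
have jE : v (j + k - i.+1) = j.
  apply: val_inj => /=; have -> : i + (j + k - i.+1).+1 = j + k.
    by have := ltn_ord i; move: lt; move: (nat_of_ord i) (nat_of_ord j) => a b; clear; lia.
  by rewrite modnDr modn_small.
rewrite -jE; apply: all; have := ltn_ord i; move: lt.
by move: (nat_of_ord i) (nat_of_ord j) => a b; clear; lia.
Qed.

Lemma embedding_compl (K H G : sgraph) (a : K -> G) (g : H -> G) (A : {set K}) :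
  (forall x y, a x != g y) ->
  (forall z, (exists x, z = a x) \/ (exists y, z = g y)) -> A = [set: K] ->
  g @: [set: H] = ~: (a @: A).
Proof.
move=> ag cov ->; apply/setP => z; rewrite inE; apply/imsetP/idP => [[y _ ->]|h].
  by apply/imsetP => -[x _ /eqP]; rewrite eq_sym (negbTE (ag x y)).
case: (cov z) => -[y zE]; last by exists y.
by case/imsetP: h; exists y.
Qed.

Lemma join1_dominating (G H : sgraph) : G ≅ complete 1 ∨ H ->
  exists (v : G) (g : H -> G), [/\ dominating v, embedding g & g @: [set: H] = ~: [set v]].
Proof.
case/join_embeddings => a [g [ea eg ag disj cov]].
have a0 x : a x = a ord0 by rewrite (ord1 x).
exists (a ord0), g; split=> //.
  move=> z; case: (cov z) => -[x ->]; last by rewrite ag.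
  by rewrite (a0 x) eqxx.
rewrite (embedding_compl disj cov erefl); congr (~: _); apply/setP => z.
rewrite inE; apply/imsetP/eqP => [[x _ ->]|->]; first exact: a0.
by exists ord0.
Qed.

(** The enumeration [iK] abstracts from the two-vertex graph, so that [complete 2] and [edgeless 2]
    are treated together. *)
Lemma join2_poles (G K H : sgraph) (iK : 'I_2 -> K) : bijective iK ->
  induced_connected [set: H] -> G ≅ K ∨ H ->
  exists (u w : G) (g : H -> G), [/\ poles u w, adj u w = adj (iK ord0) (iK ord_max),
    embedding g & g @: [set: H] = ~: [set u; w]].
Proof.
move=> bK cH /join_embeddings[a [g [ea eg ag disj cov]]].
have [j jK Kj] := bK.
have two (x : K) : x = iK ord0 \/ x = iK ord_max.
  by rewrite -(Kj x); case: (j x) => -[|[|//]] h; [left|right]; congr (iK _); apply: val_inj.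
have gT : g @: [set: H] = ~: [set a (iK ord0); a (iK ord_max)].
  rewrite (embedding_compl disj cov erefl); congr (~: _); apply/setP => z.
  rewrite !inE; apply/imsetP/orP => [[x _ ->]|]; last first.
    by case=> /eqP ->; [exists (iK ord0)|exists (iK ord_max)].
  by case: (two x) => ->; [left|right].
exists (a (iK ord0)), (a (iK ord_max)), g; split=> //; last by rewrite ea.2.
split; first by rewrite (inj_eq ea.1) (inj_eq (bij_inj bK)).
  move=> z; case: (cov z) => -[x ->]; last by rewrite !ag.
  by case: (two x) => ->; rewrite eqxx.
by rewrite -gT; apply: embedding_connected.
Qed.

Lemma complete2_join (G H : sgraph) : induced_connected [set: H] ->
  G ≅ complete 2 ∨ H -> exists (u w : G) (g : H -> G),
  [/\ poles u w, adj u w, embedding g & g @: [set: H] = ~: [set u; w]].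
Proof.
move=> cH iso; have [u [w [g [p auw eg gT]]]] :=
  join2_poles (iK := id : 'I_2 -> complete 2) (Bijective (fun=> erefl) (fun=> erefl)) cH iso.
by exists u, w, g; rewrite auw.
Qed.

Lemma edgeless2_join (G H : sgraph) : induced_connected [set: H] ->
  G ≅ edgeless 2 ∨ H -> exists (u w : G) (g : H -> G),
  [/\ poles u w, ~~ adj u w, embedding g & g @: [set: H] = ~: [set u; w]].
Proof.
move=> cH iso; have [u [w [g [p auw eg gT]]]] :=
  join2_poles (iK := id : 'I_2 -> edgeless 2) (Bijective (fun=> erefl) (fun=> erefl)) cH iso.
by exists u, w, g; rewrite auw.
Qed.

Lemma apex_join (G : sgraph) (v : G) : dominating v ->
  G ≅ complete 1 ∨ induced_graph (~: [set v]).
Proof.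
move=> dv; have iso1 : induced_graph [set v] ≅ complete 1.
  rewrite -(_ : #|induced_graph [set v]| = 1); last by rewrite card_induced cards1.
  apply: iso_complete => -[x xA] [y yA]; rewrite -(inj_eq val_inj) /= => xy.
  by exfalso; move: xy; rewrite (set1P xA) (set1P yA) eqxx.
apply: iso_trans (join_split _) (iso_join iso1 _); last by exists id; split=> //; exists id.
by move=> x y; rewrite !inE => /eqP->; apply: dv.
Qed.

Lemma apex_mc (G : sgraph) : apex_graph G -> 2 < #|G| -> #|edges G| + 3 <= mc G + #|G|.
Proof.
case=> v dv cv n3; have cE : #|~: [set v]| = #|G| - 1.
  by rewrite -(cardsC [set v]) cards1 addKn.
have := mc_ge_tree cv; rewrite cE => h.
have {}h : #|edges G| + 2 <= mc G + (#|G| - 1).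
  apply: h; first by move: n3; clear; lia.
  move=> x y xy nxy; rewrite !inE; split; apply/eqP => E; rewrite E in xy nxy.
    by rewrite dv // eq_sym in nxy.
  by rewrite adj_sym dv in nxy.
by move: n3 h; clear; lia.
Qed.

(** Without the apex there is no K_4 minor, hence a vertex of degree at most 2 there, which has
    degree at most 3 in [G]. *)
Lemma apex_not_4connected (G : sgraph) : ~ complete_minor 5 G -> apex_graph G ->
  kconnected 4 G -> False.
Proof.
move=> K5 [v dv _] k4; have [n4 _] := andP k4.
case: (@K4_minor_free_low (induced_graph (~: [set v]))).
- move=> h; apply: K5; apply: (@complete_minor_cone _ (~: [set v]) 4 v _ _ h).
    by rewrite !inE eqxx.
  by move=> x; rewrite !inE; apply: dv.
- rewrite card_induced; have := cardsC [set v]; rewrite cards1; move: n4.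
  by move: #|G| #|~: _| => a b; clear; lia.
move=> a [b [_ _ la _]]; have := kconnected_degree (val a) k4.
have : #|nbr (val a)| <= #|nbr (val a) :&: ~: [set v]| + 1.
  rewrite -(cardsID (~: [set v]) (nbr (val a))) leq_add2l setDE setCK.
  by apply: leq_trans (subset_leq_card (subsetIr _ _)) _; rewrite cards1.
by rewrite -card_nbr_induced; move: la; move: #|nbr a| #|nbr (val a)| => p q; clear; lia.
Qed.

(** * Consequences of covers for [mc] *)

Section UpperBound.
Variable G : sgraph.
Hypothesis c1 : kconnected 1 G.

Lemma mc_le_edges : mc G <= #|edges G|.
Proof. by have [F _] := mc_cover c1; apply: leq_trans; rewrite leq_addl. Qed.

Lemma not_2connected_mc : ~~ kconnected 2 G -> mc G + #|G| = #|edges G| + 2.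
Proof.
move=> nk2; apply/eqP; rewrite eqn_leq mc_ge_connected // andbT.
(* K_2 is not 2-connected and yet has no cut vertex; there the bound by the number of edges is
   enough. *)
have [n3|n2] := ltnP 2 #|G|; last by apply: leq_add n2; exact: mc_le_edges.
have [v cv] : exists v : G, cut_vertex v.
  move: nk2; rewrite /kconnected n3 /= negb_forall => /existsP[S].
  rewrite negb_imply => /andP[S2 dS]; have [S0|[v vS]] := set_0Vmem S.
    by rewrite S0 setC0 kconnected1P in dS.
  exists v; rewrite /cut_vertex (_ : [set v] = S) //.
  by apply/eqP; rewrite eqEcard sub1set vS cards1.
have [F tF wF] := mc_cover c1; have := cut_vertex_waste cv tF.
by move: wF; move: (waste F) => W; clear; lia.
Qed.

Hypothesis K5 : ~ complete_minor 5 G.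

Lemma mc_upper : mc G + #|G| <= #|edges G| + 4.
Proof.
have [n3|n2] := ltnP 2 #|G|; last by have := mc_le_edges; move: n2; clear; lia.
have [F tF wF] := mc_cover c1.
have := tree_cover_waste_ge (esym (subnK n3)) K5 tF.
by move: wF n3; move: (waste F) => W; clear; lia.
Qed.

Lemma mc_hub : #|edges G| + 4 <= mc G + #|G| ->
  3 < #|G| /\ exists u w : G, poles u w /\ adj u w.
Proof.
move=> h; have n4 : 3 < #|G| by have := mc_le_edges; move: h; clear; lia.
split=> //; have [F tF wF] := mc_cover c1.
have [|u [w hub]] := tree_cover_hub (esym (subnK (ltnW n4))) K5 tF.
  by move: wF h n4; move: (waste F) => W; clear; lia.
by exists u, w; apply/double_hubE.
Qed.

Lemma mc_apex : K33_free G -> #|edges G| + 3 <= mc G + #|G| ->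
  2 < #|G| /\ (apex_graph G \/ exists u w : G, poles u w /\ ~~ adj u w).
Proof.
move=> K33 h; have n3 : 2 < #|G| by have := mc_le_edges; move: h; clear; lia.
split=> //; have [F tF wF] := mc_cover c1.
case: (tree_cover_apex (esym (subnK n3)) K5 tF K33); last 1 [by left|move=> [u [w d]]].
- by move: wF h n3; move: (waste F) => W; clear; lia.
by right; exists u, w; apply/double_apexE.
Qed.

End UpperBound.

(** * The cases by connectivity *)

Section Cases.
Variables (R : realType) (G : sgraph).
Hypothesis c1 : kconnected 1 G.
Hypothesis K5 : ~ complete_minor 5 G.
Hypothesis K33 : K33_free G.
Hypothesis outer : forall v : G, dominating v -> outerplanar R (induced_graph (~: [set v])).

Let valT (B : {set G}) := induced_image B.

Lemma kconnectedW k l (H : sgraph) : l <= k -> kconnected k H -> kconnected l H.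
Proof.
move=> lk /andP[kn /forallP h]; apply/andP; split; first exact: leq_ltn_trans kn.
by apply/forallP => S; apply/implyP => /leq_trans/(_ lk); exact/implyP.
Qed.

Lemma kconnected_connected k (H : sgraph) : 0 < k -> kconnected k H ->
  induced_connected [set: H].
Proof. by move=> k0 /(kconnectedW k0); apply: kconnected1P. Qed.

Lemma join1_apex (H : sgraph) : induced_connected [set: H] -> G ≅ complete 1 ∨ H ->
  apex_graph G.
Proof.
move=> cH /join1_dominating[v [g [dv eg gT]]]; exists v => //.
by rewrite -gT; apply: embedding_connected.
Qed.

Let hub_low_vertex (u w : G) : poles u w -> adj u w -> 2 < #|G| ->
  exists x : G, #|nbr x| <= 3.
Proof.
move=> p auw n3.
by have [] := hub_rest_path p (embedding_val _) (valT _) K33 auw K5 n3.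
Qed.

(** A larger value would give adjacent poles, and these make the graph 3-connected. *)
Lemma mc_2connected_le : ~~ kconnected 3 G -> mc G + #|G| <= #|edges G| + 3.
Proof.
move=> nk3; rewrite leqNgt -addnS; apply: contra nk3 => /(mc_hub c1 K5)[n4 [u [w [p auw]]]].
exact: hub_3connected p auw n4.
Qed.

Lemma mc_2connected_P1 : kconnected 2 G -> ~~ kconnected 3 G -> ~ G ≅ complete 3 ->
  (mc G + #|G| = #|edges G| + 3 <-> P1 R G).
Proof.
move=> k2 nk3 nC3; split=> [mE|[H [iso c1H _ _]]]; last first.
  apply/eqP; rewrite eqn_leq mc_2connected_le //; apply: apex_mc; last by case/andP: k2.
  exact: join1_apex (kconnected1P c1H) iso.
have [n3 ap] := mc_apex c1 K5 K33 (eq_leq (esym mE)).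
have [v dv cv] : apex_graph G.
  (* From five vertices on, poles make the graph 3-connected. With four, the rest is an edge xy, so
     the graph is K_4 minus an edge and x is an apex. *)
  case: ap => // -[u [w [p nauw]]]; have [uw adjs cr] := p.
  have [n5|n5] := ltnP 4 #|G|; first by rewrite (poles_3connected p n5) in nk3.
  have cR : #|~: [set u; w]| = #|G| - 2 by rewrite -(cardsC [set u; w]) cards2 uw addKn.
  have du := kconnected_degree u k2.
  have nuR : nbr u \subset ~: [set u; w].
    apply/subsetP => x; rewrite !inE => ux; rewrite negb_or eq_sym adj_neq //.
    by apply: contraTneq ux => ->.
  have := leq_trans du (subset_leq_card nuR); rewrite cR => R2.
  have /card_gt1P[x [y [xR yR xy]]] : 1 < #|~: [set u; w]| by rewrite cR.
  have RE : ~: [set u; w] = [set x; y].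
    apply/esym/eqP; rewrite eqEcard subUset !sub1set xR yR cards2 xy cR.
    by move: n5; clear; lia.
  have axy : adj x y.
    apply: contraT => nxy; have := connected_closed cr xR (set11 x).
    have /[swap] /[apply] : closed_in (~: [set u; w]) [set x].
      move=> a b _; rewrite RE => /set2P[|] -> ab /set1P aE; first by rewrite inE.
      by move: nxy; rewrite -aE ab.
    by move/subsetP/(_ y yR); rewrite inE eq_sym (negbTE xy).
  have dom (a b : G) : a \in ~: [set u; w] -> [set a; b] = [set x; y] -> adj a b -> dominating a.
    rewrite !inE negb_or => /andP[au aw] abE ab z za.
    have [->|zu] := eqVneq z u; first by rewrite adj_sym; case/andP: (adjs a au aw).
    have [->|zw] := eqVneq z w; first by rewrite adj_sym; case/andP: (adjs a au aw).
    have : z \in [set a; b] by rewrite abE -RE !inE negb_or zu.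
    by rewrite !inE (negbTE za) => /eqP->.
  exists x; first exact: (dom x y).
  apply: (@dominated_connected _ _ y); first by rewrite !inE eq_sym.
  by apply: (dom y x) => //; [exact: setUC|rewrite adj_sym].
(* On three vertices a 2-connected graph is the triangle, which fails to be 3-connected by its size
   and not because of a separating pair. *)
have n4 : 3 < #|G|.
  rewrite ltn_neqAle n3 andbT; apply/eqP => n3E; apply: nC3; rewrite n3E.
  apply: iso_complete => x y xy; have := kconnected_degree x k2.
  have sub : nbr x \subset ~: [set x] by apply/subsetP => z; rewrite !inE eq_sym => /adj_neq.
  move=> d2; have /setP/(_ y) : nbr x = ~: [set x].
    apply/eqP; rewrite eqEcard sub; have := cardsC [set x]; rewrite cards1 -n3E; move: d2.
    by move: #|nbr _| #|~: _| => a b; clear; lia.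
  by rewrite !inE eq_sym xy.
exists (induced_graph (~: [set v])); have ev := embedding_val (~: [set v]).
have cH : induced_connected [set: induced_graph (~: [set v])].
  by apply: (embedding_connected_inv ev); rewrite valT.
split; [exact: apex_join| |exact: outer|].
  apply/andP; split.
    rewrite card_induced; have := cardsC [set v]; rewrite cards1; move: n4.
    by move: #|G| #|~: _| => a b; clear; lia.
  apply/forallP => S; apply/implyP; rewrite ltnS leqn0 cards_eq0 => /eqP->.
  by rewrite setC0.
(* A separating set of at most two vertices contains the dominating vertex; its other element is a
   cut vertex of the rest. *)
move: nk3; rewrite /kconnected n4 /= negb_forall => /existsP[S].
rewrite negb_imply => /andP[S3 dS].
have vS : v \in S.
  by apply: contraNT dS => vS; apply: (@dominated_connected _ _ v); rewrite ?inE.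
have [/eqP|[x]] := set_0Vmem (S :\ v).
  rewrite setD_eq0 => Sv; rewrite (_ : S = [set v]) ?cv // in dS.
  by apply/eqP; rewrite eqEsubset Sv sub1set.
rewrite !inE => /andP[xv xS].
have xH : x \in ~: [set v] by rewrite !inE.
exists (exist _ x xH); rewrite /cut_vertex; apply: contra dS => /(embedding_connected ev).
suff -> : [set val y | y in ~: [set exist _ x xH : induced_graph (~: [set v])]] = ~: S by [].
have SE : S = [set v; x].
  by apply/esym/eqP; rewrite eqEcard subUset !sub1set vS xS cards2 eq_sym xv.
apply/setP => y; rewrite SE; apply/imsetP/idP => [[z]|].
  rewrite !inE -(inj_eq val_inj) /= => zx ->; rewrite negb_or zx andbT.
  by have := valP z; rewrite !inE.
rewrite !inE negb_or => /andP[yv yx].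
have yH : y \in ~: [set v] by rewrite !inE.
by exists (exist _ y yH); rewrite // !inE -(inj_eq val_inj).
Qed.

Lemma mc_hub_iso : 2 < #|G| -> kconnected 3 G ->
  (mc G + #|G| = #|edges G| + 4 <-> G ≅ complete 2 ∨ path_graph (#|G| - 2)).
Proof.
move=> n3 k3; have [n4 _] := andP k3; split=> [mE|iso]; last first.
  have [u [w [g [p auw eg gT]]]] := complete2_join (path_graph_connected _) iso.
  by apply/eqP; rewrite eqn_leq mc_upper // (hub_mc p auw n4).
have [_ [u [w [p auw]]]] := mc_hub c1 K5 (eq_leq (esym mE)).
apply: iso_trans (poles_join p) (iso_join _ _); first exact: induced_poles_complete.
by have [] := hub_rest_path p (embedding_val _) (valT _) K33 auw K5 n3.
Qed.

Lemma mc_3connected : kconnected 3 G -> ~~ kconnected 4 G ->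
  (mc G + #|G| = #|edges G| + 3 <->
   P2 R G \/ G ≅ edgeless 2 ∨ path_graph (#|G| - 2)).
Proof.
move=> k3 nk4; have [n4 _] := andP k3; have n3 := ltnW n4.
split=> [mE|].
  have no_hub (u w : G) : poles u w -> adj u w -> False.
    by move=> p auw; have := hub_mc p auw n4; rewrite mE; clear; lia.
  have [_ [[v dv cv]|[u [w [p nauw]]]]] := mc_apex c1 K5 K33 (eq_leq (esym mE)).
    left; exists (induced_graph (~: [set v])); have ev := embedding_val (~: [set v]).
    have iso := apex_join dv.
    split=> //; [|exact: outer|].
      apply/andP; split.
        rewrite card_induced; have := cardsC [set v]; rewrite cards1; move: n4.
        by move: #|G| #|~: _| => a b; clear; lia.
      apply/forallP => S; apply/implyP => S2; apply: (embedding_connected_inv ev).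
      have -> : [set val y | y in ~: S] = ~: (v |: [set val y | y in S]).
        apply/setP => y; apply/imsetP/idP => [[z zS ->]|].
          rewrite in_setC in_setU1 negb_or (mem_imset _ _ val_inj) -in_setC zS andbT.
          by have := valP z; rewrite !inE.
        rewrite !inE negb_or => /andP[yv yS]; have yH : y \in ~: [set v] by rewrite !inE.
        exists (exist _ y yH) => //; rewrite inE; apply: contra yS => yS.
        by apply/imsetP; exists (exist _ y yH).
      move: k3 => /andP[_ /forallP/(_ (v |: [set val y | y in S]))/implyP]; apply.
      rewrite cardsU1 card_imset; last exact: val_inj.
      by case: (_ \notin _); [rewrite add1n ltnS|rewrite add0n; apply: ltnW].
    (* If the rest were u joined with a path, then u and the apex would be adjacent poles, and [mc]
       would be larger by one. *)
    move=> isoH; have [a [g [ea eg ag disj cov]]] := join_embeddings iso.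
    have [b [h [eb eh bh disj' cov']]] := join_embeddings isoH.
    have a0 x : a x = a ord0 by rewrite (ord1 x).
    have b0 x : b x = b ord0 by rewrite (ord1 x).
    apply: (no_hub (a ord0) (g (b ord0))); last exact: ag.
    have gT : (g \o h) @: [set: path_graph (#|G| - 2)] = ~: [set a ord0; g (b ord0)].
      apply/setP => z; rewrite !inE negb_or; apply/imsetP/andP => [[y _ ->]|[]].
        by rewrite /= eq_sym disj (inj_eq eg.1) eq_sym disj'.
      case: (cov z) => -[x ->]; first by rewrite (a0 x) eqxx.
      case: (cov' x) => -[y ->]; first by rewrite (b0 y) eqxx.
      by exists y.
    split; first exact: disj.
      move=> z; case: (cov z) => -[x ->]; first by rewrite (a0 x) eqxx.
      rewrite ag (inj_eq eg.1) => _; case: (cov' x) => -[y ->]; first by rewrite (b0 y) eqxx.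
      by rewrite eg.2 bh.
    by rewrite -gT; apply: embedding_connected (embedding_comp eh eg) (path_graph_connected _).
  have := rest_path_or_cycle p (embedding_val _) (valT _) K33 n3; case=> [[iso _]|[iso n5 d2]].
    right; apply: iso_trans (poles_join p) (iso_join _ iso); exact: induced_poles_edgeless.
  (* A cycle as rest is impossible: from six vertices on the graph would be 4-connected, and on five
     it would be K_5 minus an edge, in which two vertices of the triangle are adjacent poles. *)
  exfalso; have [uw adjs cr] := p.
  have [n6|n5'] := ltnP 5 #|G|.
    case/negP: nk4; apply: (poles_4connected p n6) => x xu xw.
    have xH : x \in ~: [set u; w] by rewrite !inE negb_or xu.
    have [f [[f' fK f'K] hf]] := iso.
    have := cycle_graph_minus_connected (f (exist _ x xH)) _.
    have -> : 2 < #|G| - 2 by move: n6; clear; lia.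
    move=> /(_ isT) cc; have ef' : embedding f'.
      by split; [exact: can_inj f'K|move=> a b; rewrite -hf !f'K].
    have := embedding_connected (embedding_comp ef' (embedding_val _)) cc.
    congr (is_true (induced_connected _)); apply/setP => z.
    have -> : (z \in ~: [set u; w; x]) = (z != x) && (z \in ~: [set u; w]).
      by rewrite !inE negb_or andbC.
    apply/imsetP/andP => [[y]|[zx zR]].
      rewrite in_setC in_set1 => yx zE; have -> : z = val (f' y) := zE.
      split; last exact: (valP (f' y)).
      apply: contra yx => /eqP h; rewrite -[y]f'K; apply/eqP; congr f.
      exact: val_inj.
    exists (f (exist _ z zR)); last by rewrite /= fK.
    by rewrite !inE (can_eq fK) -(inj_eq val_inj).
  have nE : #|G| = 5 by move: n5 n5'; clear; lia.
  have cR : #|~: [set u; w]| = 3.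
    by have := cardsC [set u; w]; rewrite cards2 uw nE; clear; lia.
  have adjR (x y : induced_graph (~: [set u; w])) : x != y -> adj x y.
    move=> xy; have /setP/(_ y) : nbr x = ~: [set x]; last by rewrite !inE eq_sym xy.
    apply/eqP; rewrite eqEcard d2; apply/andP; split.
      by apply/subsetP => z; rewrite !inE eq_sym => /adj_neq.
    by have := cardsC [set x]; rewrite cards1 card_induced cR; clear; lia.
  have dom (x : induced_graph (~: [set u; w])) : dominating (val x).
    move=> z zx; have := valP x; rewrite !inE negb_or => /andP[xu xw].
    have [->|zu] := eqVneq z u; first by rewrite adj_sym; case/andP: (adjs _ xu xw).
    have [->|zw] := eqVneq z w; first by rewrite adj_sym; case/andP: (adjs _ xu xw).
    have zR : z \in ~: [set u; w] by rewrite !inE negb_or zu.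
    apply: (adjR x (exist _ z zR)); rewrite -(inj_eq val_inj) eq_sym; exact: zx.
  have /card_gt2P[x [y [z [[_ _ _] [xy yz zx]]]]] : 2 < #|induced_graph (~: [set u; w])|.
    by rewrite card_induced cR.
  apply: (no_hub (val x) (val y)); last first.
    by apply: dom; rewrite (inj_eq val_inj) eq_sym.
  split; first by rewrite (inj_eq val_inj).
    by move=> t tx ty; rewrite !dom.
  apply: (@dominated_connected _ _ (val z)); last exact: dom.
  by rewrite !inE !(inj_eq val_inj) negb_or zx eq_sym yz.
have no_hub : (forall u w : G, poles u w -> adj u w -> False) ->
    #|edges G| + 3 <= mc G + #|G| -> mc G + #|G| = #|edges G| + 3.
  move=> nh h; apply/eqP; rewrite eqn_leq h andbT leqNgt -addnS; apply/negP.
  by case/(mc_hub c1 K5) => _ [u [w [p auw]]]; apply: (nh u w).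
case=> [[H [iso k2H _ nH]]|iso]; apply: no_hub.
- move=> u w p auw; apply: nH.
  (* The dominating vertex [v] may or may not be one of the given poles. In each case some other
     dominating vertex forms adjacent poles with it; that vertex dominates [H], and what remains of
     [H] is a path. *)
  have [v [g [dv eg gT]]] := join1_dominating iso.
  have [w' [p' avw']] : exists w', poles v w' /\ adj v w'.
    have [_ du dw cuw] : double_hub u w by apply/double_hubE.
    have [->|vu] := eqVneq v u; first by exists w.
    have [->|vw] := eqVneq v w.
      exists u; apply/double_hubE; split=> //; last by rewrite setUC.
      by rewrite eq_sym; case: p.
    exists w; apply/double_hubE; split=> //.
    apply: (@dominated_connected _ _ u) => //.
    by rewrite !inE negb_or eq_sym vu; case: p.
  have dw' : dominating w' by have /double_hubE[] : poles v w' /\ adj v w' by [].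
  have [h hE] : exists h, w' = g h.
    have : w' \in g @: [set: H] by rewrite gT !inE eq_sym; case: p'.
    by case/imsetP => h _ ->; exists h.
  have dh : dominating h.
    by move=> z zh; rewrite -eg.2 -hE; apply: dw'; rewrite hE (inj_eq eg.1).
  apply: iso_trans (apex_join dh) (iso_join _ _); first by exists id; split=> //; exists id.
  have e2 := embedding_comp (embedding_val (~: [set h])) eg.
  have g2T : (g \o val) @: [set: induced_graph (~: [set h])] = ~: [set v; w'].
    apply/setP => z; rewrite hE setUC in_setC in_setU1 negb_or -in_setC -gT.
    apply/imsetP/andP => [[y _ ->]|[zh /imsetP[y _ zE]]].
      rewrite /= (inj_eq eg.1) imset_f ?inE //; split=> //.
      by have := valP y; rewrite !inE.
    have yH : y \in ~: [set h] by rewrite !inE -(inj_eq eg.1) -zE.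
    by exists (exist _ y yH).
  by have [] := hub_rest_path p' e2 g2T K33 avw' K5 n3.
- apply: apex_mc => //; apply: join1_apex iso; exact: (kconnected_connected _ k2H).
- have [a [g [ea eg ag disj cov]]] := join_embeddings iso.
  have deg0 : 2 < #|G| - 2.
    have := leq_trans (kconnected_degree (a ord0) k3) (subset_leq_card
      (_ : nbr (a ord0) \subset g @: [set: path_graph (#|G| - 2)])).
    rewrite card_imset; last exact: eg.1.
    rewrite cardsT card_ord; apply; apply/subsetP => z; rewrite inE.
    by case: (cov z) => -[x ->]; [rewrite ea.2|rewrite imset_f ?inE].
  move=> u w p auw; have [uw du dw _] : double_hub u w by apply/double_hubE.
  (* Each vertex of [edgeless 2] misses the other, so dominating vertices lie on the path. Two of
     them and any third path vertex would form a triangle in the path. *)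
  have inH (t : G) : dominating t -> exists i, t = g i.
    move=> dt; case: (cov t) => -[x tE]; last by exists x.
    have [y xy] : exists y : 'I_2, y != x.
      by exists (if x == ord0 then ord_max else ord0); case: x {tE} => -[|[|]].
    by have := dt (a y); rewrite tE (inj_eq ea.1) ea.2 => /(_ xy).
  have [i uE] := inH u du; have [j wE] := inH w dw.
  have adj_dom t l : dominating (g t) -> l != t -> path_adj t l.
    by move=> dt lt; have := dt (g l); rewrite (inj_eq eg.1) eg.2; apply.
  rewrite uE in du uw; rewrite wE in dw uw.
  have /nonempty_compl[l] : #|[set i; j]| < #|path_graph (#|G| - 2)|.
    by rewrite card_ord cards2; case: (i != j) => //; apply: leq_trans deg0.
  rewrite !inE negb_or => /andP[li lj].
  have := adj_dom i l du li; have := adj_dom j l dw lj.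
  have := adj_dom i j du; rewrite eq_sym -(inj_eq eg.1) => /(_ uw); rewrite /path_adj.
  by clear; lia.
- have [u [w [g [p nauw _ _]]]] := edgeless2_join (path_graph_connected _) iso.
  exact: poles_mc p n4.
Qed.

Lemma mc_4connected_le : kconnected 4 G -> mc G + #|G| <= #|edges G| + 3.
Proof.
move=> k4; have [n5 _] := andP k4.
rewrite leqNgt -addnS; apply/negP => /(mc_hub c1 K5)[n4 [u [w [p auw]]]].
have [x dx] := hub_low_vertex p auw (ltnW n4).
by have := leq_trans (kconnected_degree x k4) dx.
Qed.

(** Apex graphs and poles over a path both have a vertex of degree at most 3, which leaves poles
    over a cycle. *)
Lemma mc_4connected : kconnected 4 G ->
  (mc G + #|G| = #|edges G| + 3 <-> G ≅ edgeless 2 ∨ cycle_graph (#|G| - 2)).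
Proof.
move=> k4; have [n5 _] := andP k4; have n4 := ltnW n5.
split=> [mE|iso]; last first.
  have k2 : 2 < #|G| - 2 by move: n5; clear; lia.
  have [u [w [g [p nauw _ _]]]] := edgeless2_join (cycle_graph_connected k2) iso.
  by apply/eqP; rewrite eqn_leq mc_4connected_le // (poles_mc p n4).
have [_ [ap|[u [w [p nauw]]]]] := mc_apex c1 K5 K33 (eq_leq (esym mE)).
  by case: (apex_not_4connected K5 ap k4).
have := rest_path_or_cycle p (embedding_val _) (valT _) K33 (ltnW n4).
case=> [[_ [x dx]]|[iso _ _]].
  by have := leq_trans (kconnected_degree x k4) dx.
apply: iso_trans (poles_join p) (iso_join _ iso); exact: induced_poles_edgeless.
Qed.

(** Apex graphs are not even 4-connected, and with two poles every other vertex has degree at most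
    4. *)
Lemma mc_5connected : kconnected 5 G -> mc G + #|G| = #|edges G| + 2.
Proof.
move=> k5; have [n6 _] := andP k5; have k4 := kconnectedW (leqnSn 4) k5.
apply/eqP; rewrite eqn_leq mc_ge_connected // andbT leqNgt -addnS; apply/negP => h.
have [_ [ap|[u [w [p nauw]]]]] := mc_apex c1 K5 K33 h.
  by case: (apex_not_4connected K5 ap k4).
have [uw _ _] := p.
have /nonempty_compl[x] : #|[set u; w]| < #|G|.
  by rewrite cards2 uw; apply: leq_trans n6.
rewrite -in_setC => xR; pose y : induced_graph (~: [set u; w]) := exist _ x xR.
have := rest_degree p (embedding_val _) (valT _) K33 y.
have := card_nbr_rest p (embedding_val _) (valT _) y.
by have := kconnected_degree x k5; rewrite /=; clear; lia.
Qed.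

End Cases.

(** * Parity of disjoint polygonal chains *)

From mathcomp Require Import all_classical all_analysis ring lra.
From Stdlib Require Btauto.

Section Segments.
Import Order.TTheory GRing.Theory Num.Theory.
Local Open Scope ring_scope.
Variable R : realFieldType.
Implicit Types (a p q r s : R * R) (x t : R).

Definition left_of p q : bool := p.1 < q.1.

Definition seg_param p q x := (x - p.1) / (q.1 - p.1).
Definition seg_height p q x := p.2 + seg_param p q x * (q.2 - p.2).

(** The upward vertical ray from [a] meets the segment. The exclusive or makes the abscissa range
    half-open, so a ray through the common end of two consecutive segments of a monotone stretch
    counts once. *)
Definition under a r s : bool :=
  (left_of r a (+) left_of s a) && (a.2 < seg_height r s a.1).

Definition seg_point p q t : R * R := (p.1 + t * (q.1 - p.1), p.2 + t * (q.2 - p.2)).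

Definition seg_disjoint p q r s := forall t t',
  0 <= t <= 1 -> 0 <= t' <= 1 -> seg_point p q t <> seg_point r s t'.

Lemma seg_disjoint_sym p q r s : seg_disjoint p q r s -> seg_disjoint r s p q.
Proof. by move=> d t t' ht ht' /esym; apply: d. Qed.

Lemma seg_disjoint_swap p q r s : seg_disjoint p q r s -> seg_disjoint q p r s.
Proof.
move=> d t t' ht ht' h; apply: (d (1 - t) t') => //; first by lra.
by rewrite -h /seg_point; congr (_, _); ring.
Qed.

Lemma seg_height_swap p q x : p.1 != q.1 -> seg_height p q x = seg_height q p x.
Proof.
move=> pq; have d1 : q.1 - p.1 != 0 by rewrite subr_eq0 eq_sym.
have d2 : p.1 - q.1 != 0 by rewrite subr_eq0.
by rewrite /seg_height /seg_param; field; rewrite d1 d2.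
Qed.

Lemma under_swap a r s : under a r s = under a s r.
Proof.
rewrite /under addbC; have [E|ne] := eqVneq r.1 s.1; last by rewrite seg_height_swap.
by rewrite /left_of E addbb.
Qed.

Lemma seg_point_param p q x : p.1 != q.1 ->
  seg_point p q (seg_param p q x) = (x, seg_height p q x).
Proof.
move=> pq; have d1 : q.1 - p.1 != 0 by rewrite subr_eq0 eq_sym.
by rewrite /seg_point /seg_height; congr (_, _); rewrite /seg_param; field.
Qed.

Lemma seg_height_l p q : seg_height p q p.1 = p.2.
Proof. by rewrite /seg_height /seg_param subrr mul0r mul0r addr0. Qed.

Lemma seg_height_r p q : p.1 != q.1 -> seg_height p q q.1 = q.2.
Proof.
move=> pq; rewrite /seg_height /seg_param divff ?mul1r ?subrKC //.
by rewrite subr_eq0 eq_sym.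
Qed.

Lemma seg_param_range p q x : p.1 < q.1 -> p.1 <= x <= q.1 -> 0 <= seg_param p q x <= 1.
Proof.
move=> pq /andP[px xq]; have d0 : 0 < q.1 - p.1 by rewrite subr_gt0.
by rewrite /seg_param divr_ge0 ?subr_ge0 ?(ltW pq) //= ler_pdivrMr // mul1r lerD2r.
Qed.

Section Disjoint.
Variables p q r s : R * R.
Hypothesis d : seg_disjoint p q r s.

Lemma seg_heights_neq x : p.1 < q.1 -> r.1 < s.1 ->
  p.1 <= x <= q.1 -> r.1 <= x <= s.1 -> seg_height p q x <> seg_height r s x.
Proof.
move=> pq rs hx hx' E; apply: (d (seg_param_range pq hx) (seg_param_range rs hx')).
by rewrite !seg_point_param ?lt_eqF // E.
Qed.

(* The difference of the heights is affine, so a change of sign is a crossing. *)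
Lemma seg_heights_lt x x' : p.1 < q.1 -> r.1 < s.1 ->
  p.1 <= x <= q.1 -> r.1 <= x <= s.1 -> p.1 <= x' <= q.1 -> r.1 <= x' <= s.1 ->
  seg_height p q x < seg_height r s x -> seg_height p q x' < seg_height r s x'.
Proof.
move=> pq rs hx1 hx2 hx1' hx2' lt; rewrite ltNge; apply/negP => ge.
set h := seg_height p q x - seg_height r s x.
set h' := seg_height p q x' - seg_height r s x'.
have h0 : h < 0 by rewrite subr_lt0.
have h0' : 0 <= h' by rewrite subr_ge0.
have hh : 0 < h' - h by lra.
pose l := (- h) / (h' - h).
have l01 : 0 <= l <= 1.
  rewrite /l divr_ge0 ?(ltW hh) ?oppr_ge0 ?(ltW h0) //= ler_pdivrMr // mul1r; lra.
pose z := x + l * (x' - x).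
have zb b c : b <= x <= c -> b <= x' <= c -> b <= z <= c.
  rewrite /z => *; apply/andP; split; nra.
apply: (@seg_heights_neq z) => //; first exact: zb; first exact: zb.
apply/eqP; rewrite -subr_eq0; apply/eqP.
have -> : seg_height p q z - seg_height r s z = h + l * (h' - h).
  rewrite /h /h' /z /seg_height /seg_param; field.
  by rewrite !subr_eq0 !gt_eqF.
rewrite /l divfK ?gt_eqF //; lra.
Qed.

End Disjoint.

(** Here [p] is leftmost. If the ranges interleave, one segment lies above the other over the common
    range, so exactly one inner end is under the other segment. If the range of [r], [s] is nested,
    both ends lie on the same side and cancel. *)
Let seg_parity_overlap p q r s : p.1 < q.1 -> r.1 < s.1 -> p.1 < r.1 ->
  q.1 != r.1 -> q.1 != s.1 -> seg_disjoint p q r s ->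
  under p r s (+) under q r s (+) under r p q (+) under s p q =
  left_of p r (+) left_of q r (+) left_of p s (+) left_of q s.
Proof.
move=> pq rs pr qr qs d; have ps := lt_trans pr rs.
rewrite /under /left_of pr ps !(lt_gtF pr) !(lt_gtF ps) /=.
case: (ltgtP q.1 r.1) qr => // qr _.
  by rewrite (lt_trans qr rs) (lt_gtF (lt_trans qr rs)).
rewrite /=; have dr := seg_disjoint_sym d.
have rI : p.1 <= r.1 <= q.1 by rewrite !ltW.
have rI' : r.1 <= r.1 <= s.1 by rewrite lexx ltW.
have neq : r.2 != seg_height p q r.1.
  by apply/eqP => h; case: (seg_heights_neq d pq rs rI rI'); rewrite seg_height_l.
case: (ltgtP q.1 s.1) qs => // qs _ /=.
  have qI : p.1 <= q.1 <= q.1 by rewrite lexx ltW.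
  have qI' : r.1 <= q.1 <= s.1 by rewrite !ltW.
  have A := seg_heights_lt d pq rs rI rI' qI qI'.
  have B := seg_heights_lt dr rs pq rI' rI qI' qI.
  rewrite seg_height_l seg_height_r ?lt_eqF // in A.
  rewrite seg_height_l seg_height_r ?lt_eqF // in B.
  case: (ltgtP r.2 (seg_height p q r.1)) neq A B => // h _ A B.
    by rewrite (lt_gtF (B isT)).
  by rewrite (A isT).
have sI : p.1 <= s.1 <= q.1 by rewrite !ltW.
have sI' : r.1 <= s.1 <= s.1 by rewrite lexx ltW.
have A := seg_heights_lt d pq rs rI rI' sI sI'.
have B := seg_heights_lt dr rs pq rI' rI sI' sI.
rewrite seg_height_l seg_height_r ?lt_eqF // in A.
rewrite seg_height_l seg_height_r ?lt_eqF // in B.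
case: (ltgtP r.2 (seg_height p q r.1)) neq A B => // h _ A B.
  by rewrite (B isT).
by rewrite (lt_gtF (A isT)).
Qed.

Lemma left_of_total p q : p.1 != q.1 -> left_of q p = ~~ left_of p q.
Proof. by rewrite /left_of; case: ltgtP. Qed.

Let seg_parity_sym p q r s : p.1 != r.1 -> p.1 != s.1 -> q.1 != r.1 -> q.1 != s.1 ->
  under r p q (+) under s p q (+) under p r s (+) under q r s =
    left_of r p (+) left_of s p (+) left_of r q (+) left_of s q ->
  under p r s (+) under q r s (+) under r p q (+) under s p q =
    left_of p r (+) left_of q r (+) left_of p s (+) left_of q s.
Proof.
move=> pr ps qr qs; rewrite !(left_of_total pr, left_of_total ps, left_of_total qr, left_of_total qs).
case: (under p r s); case: (under q r s); case: (under r p q); case: (under s p q);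
case: (left_of p r); case: (left_of q r); case: (left_of p s); by case: (left_of q s).
Qed.

(** The terms of the two ends of the vertical segment cancel unless the other segment passes between
    them, which would be a crossing. *)
Let seg_parity_vertical p q r s : p.1 = q.1 -> p.1 != r.1 -> p.1 != s.1 ->
  seg_disjoint p q r s ->
  under p r s (+) under q r s (+) under r p q (+) under s p q =
  left_of p r (+) left_of q r (+) left_of p s (+) left_of q s.
Proof.
move=> pq pr ps d; rewrite /under /left_of -pq !addbb /= !addbF.
wlog rs : r s pr ps d / r.1 < s.1 => [hw|].
  case: (ltgtP r.1 s.1) => rs; [exact: hw| |].
    rewrite [_ (+) (s.1 < _)]addbC !(@seg_height_swap r s) ?gt_eqF //; apply: hw => //.
    exact/seg_disjoint_sym/seg_disjoint_swap/seg_disjoint_sym.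
  by rewrite rs addbb.
case: (ltgtP r.1 p.1) pr => // rp _; case: (ltgtP s.1 p.1) ps => // sp _ //=;
  last by have := lt_trans rs (lt_trans sp rp); rewrite ltxx.
set Y := seg_height r s p.1.
have Yr : forall t, 0 <= t <= 1 -> seg_point p q t <> (p.1, Y).
  move=> t ht; rewrite -(@seg_point_param r s) ?lt_eqF //; apply: d => //.
  by apply: seg_param_range; rewrite // !ltW.
have onseg : forall t, 0 <= t <= 1 -> p.2 + t * (q.2 - p.2) <> Y.
  by move=> t ht E; apply: (Yr t ht); rewrite /seg_point -pq subrr mulr0 addr0 E.
have conv u v : u < Y -> Y <= v -> exists2 t, 0 <= t <= 1 & u + t * (v - u) = Y.
  move=> uY Yv; have vu : 0 < v - u by lra.
  exists ((Y - u) / (v - u)); last by rewrite divfK ?gt_eqF //; lra.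
  by rewrite divr_ge0 ?ler_pdivrMr // ?mul1r; lra.
case: (ltP p.2 Y) => pY; case: (ltP q.2 Y) => qY //.
  by have [t ht E] := conv _ _ pY qY; case: (onseg t ht).
have [t ht E] := conv _ _ qY pY; case: (onseg (1 - t)); first by lra.
by rewrite -E; ring.
Qed.

(** The right side is odd exactly when the abscissae of the ends of one segment separate those of
    the other. *)
Lemma seg_parity p q r s : p.1 != r.1 -> p.1 != s.1 -> q.1 != r.1 -> q.1 != s.1 ->
  seg_disjoint p q r s ->
  under p r s (+) under q r s (+) under r p q (+) under s p q =
  left_of p r (+) left_of q r (+) left_of p s (+) left_of q s.
Proof.
move=> pr ps qr qs d.
have [E|pq] := eqVneq p.1 q.1; first exact: seg_parity_vertical.
have [E|rs] := eqVneq r.1 s.1.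
  apply: seg_parity_sym => //; apply: seg_parity_vertical; rewrite // 1?eq_sym //.
  exact: seg_disjoint_sym.
wlog lt_pq : p q pr ps qr qs d pq / p.1 < q.1 => [hw|].
  case: (ltgtP p.1 q.1) pq => // h _; [by apply: hw => //; rewrite lt_eqF|].
  rewrite (under_swap r) (under_swap s) (addbC (under p _ _)) (addbC (left_of p r)).
  rewrite -!addbA [_ (+) left_of q s]addbC !addbA.
  by apply: hw => //; [apply: seg_disjoint_swap|rewrite lt_eqF].
wlog lt_rs : r s pr ps qr qs d rs / r.1 < s.1 => [hw|].
  case: (ltgtP r.1 s.1) rs => // h _; [by apply: hw => //; rewrite lt_eqF|].
  rewrite (under_swap p) (under_swap q) -addbA (addbC (under r _ _)) addbA.
  rewrite -[RHS]addbA [RHS]addbC !addbA.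
  apply: hw => //; last by rewrite lt_eqF.
  exact/seg_disjoint_sym/seg_disjoint_swap/seg_disjoint_sym.
case: (ltgtP p.1 r.1) (pr) => // h _; first exact: seg_parity_overlap.
apply: seg_parity_sym => //; apply: seg_parity_overlap; rewrite // 1?eq_sym //.
exact: seg_disjoint_sym.
Qed.

End Segments.

Lemma addb_xorb (b c : bool) : b (+) c = xorb b c. Proof. by case: b c => -[]. Qed.

Ltac xor_taut := rewrite ?addb_xorb; Btauto.btauto.

Lemma addb_isolate (a b c d e : bool) : a (+) b (+) c (+) d = e -> a = e (+) b (+) c (+) d.
Proof. by move=> <-; xor_taut. Qed.

(** * The parity identity for chains, K_5 and K_{3,3} *)

Section Chains.
Import Order.TTheory GRing.Theory Num.Theory.
Local Open Scope ring_scope.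
Variable R : realFieldType.
Implicit Types (a b c p q r s : R * R) (l : seq (R * R)).

Definition chain_segments p l := zip (p :: l) l.

Lemma chain_segments_cons p q l e :
  e \in chain_segments q l -> e \in chain_segments p (q :: l).
Proof. by move=> h; rewrite /chain_segments inE h orbT. Qed.

Definition seg_apart p q r s :=
  [/\ p.1 != r.1, p.1 != s.1, q.1 != r.1, q.1 != s.1 & seg_disjoint p q r s].

Definition chains_apart a l b l' := forall p q r s,
  (p, q) \in chain_segments a l -> (r, s) \in chain_segments b l' -> seg_apart p q r s.

(** The parity of the number of segments of the chain above [a]. *)
Fixpoint under_chain a r l : bool :=
  if l is s :: l' then under a r s (+) under_chain a s l' else false.

Lemma seg_chain_parity p q c l :
  (forall r s, (r, s) \in chain_segments c l -> seg_apart p q r s) ->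
  under_chain p c l (+) under_chain q c l (+) under c p q (+) under (last c l) p q =
  left_of p c (+) left_of q c (+) left_of p (last c l) (+) left_of q (last c l).
Proof.
elim: l c => [|s l IH] c /= h; first by xor_taut.
have [pc ps qc qs d] := h c s (mem_head _ _).
have /addb_isolate E := seg_parity pc ps qc qs d.
have /addb_isolate E' := IH s (fun r t hrt => h r t (chain_segments_cons _ hrt)).
by rewrite E E'; xor_taut.
Qed.

(** Summing [seg_parity] over all pairs of segments, the inner vertices of either chain occur twice
    and cancel, so only the four ends remain. *)
Theorem chain_parity a l c l' : chains_apart a l c l' ->
  under_chain a c l' (+) under_chain (last a l) c l' (+)
    under_chain c a l (+) under_chain (last c l') a l =
  left_of a c (+) left_of (last a l) c (+)
    left_of a (last c l') (+) left_of (last a l) (last c l').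
Proof.
elim: l a => [|b l IH] a /= h; first by xor_taut.
have /addb_isolate E := seg_chain_parity (fun r s => h a b r s (mem_head _ _)).
have /addb_isolate E' := IH b (fun p q r s hpq => h p q r s (chain_segments_cons _ hpq)).
by rewrite E E'; xor_taut.
Qed.

Lemma chains_apart_ends a l c l' : l != [::] -> l' != [::] -> chains_apart a l c l' ->
  [/\ a.1 != c.1, a.1 != (last c l').1, (last a l).1 != c.1 &
      (last a l).1 != (last c l').1].
Proof.
have lastP p m : m != [::] -> exists r, (r, last p m) \in chain_segments p m.
  elim: m p => // s [|t m] IH p _; first by exists p; rewrite mem_head.
  by have [r hr] := IH s isT; exists r; rewrite inE hr orbT.
case: l => // b l _; case: l' => // d l' _ h.
have [r hr] := lastP a (b :: l) isT; have [s hs] := lastP c (d :: l') isT.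
have ha : (a, b) \in chain_segments a (b :: l) by rewrite mem_head.
have hc : (c, d) \in chain_segments c (d :: l') by rewrite mem_head.
have [h1 _ _ _ _] := h _ _ _ _ ha hc; have [_ h2 _ _ _] := h _ _ _ _ ha hs.
have [_ _ h3 _ _] := h _ _ _ _ hr hc; have [_ _ _ h4 _] := h _ _ _ _ hr hs.
by split.
Qed.

Ltac parity_contradiction T :=
  match type of T with ?L = ?M =>
    let H := fresh in
    have H : L = ~~ M; [xor_taut | by move: H; rewrite T; case: M] end.

(* Summing the parity identity over the 15 pairs of independent edges, every
   [under_chain] term occurs twice while the right-hand sides add up to 1. *)
Theorem K5_chains_absurd (v : nat -> R * R) (P : nat -> nat -> seq (R * R)) :
  (forall i j, i < j < 5 -> P i j != [::] /\ last (v i) (P i j) = v j)%N ->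
  (forall i j k t, i < j < 5 -> k < t < 5 -> i != k -> i != t -> j != k -> j != t ->
    chains_apart (v i) (P i j) (v k) (P k t))%N -> False.
Proof.
move=> hP hd.
have E i j k t (h1 : (i < j < 5)%N) (h2 : (k < t < 5)%N) (h3 : i != k) (h4 : i != t)
    (h5 : j != k) (h6 : j != t) :
    under_chain (v i) (v k) (P k t) (+) under_chain (v j) (v k) (P k t) (+)
      under_chain (v k) (v i) (P i j) (+) under_chain (v t) (v i) (P i j) =
    left_of (v i) (v k) (+) left_of (v j) (v k) (+)
      left_of (v i) (v t) (+) left_of (v j) (v t).
  have := chain_parity (hd i j k t h1 h2 h3 h4 h5 h6).
  by rewrite (hP i j h1).2 (hP k t h2).2.
have ne i j k t (h1 : (i < j < 5)%N) (h2 : (k < t < 5)%N) (h3 : i != k) (h4 : i != t)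
    (h5 : j != k) (h6 : j != t) : left_of (v k) (v j) = ~~ left_of (v j) (v k).
  have [P0 Pl] := hP i j h1; have [P0' Pl'] := hP k t h2.
  have [] := chains_apart_ends P0 P0' (hd i j k t h1 h2 h3 h4 h5 h6).
  by rewrite Pl => _ _ h _; apply: left_of_total.
have ne' i j k t (h1 : (i < j < 5)%N) (h2 : (k < t < 5)%N) (h3 : i != k) (h4 : i != t)
    (h5 : j != k) (h6 : j != t) : left_of (v t) (v j) = ~~ left_of (v j) (v t).
  have [P0 Pl] := hP i j h1; have [P0' Pl'] := hP k t h2.
  have [] := chains_apart_ends P0 P0' (hd i j k t h1 h2 h3 h4 h5 h6).
  by rewrite Pl Pl' => _ _ _; apply: left_of_total.
have T := congr2 addb (E 0 1 2 3 isT isT isT isT isT isT)%N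
  (congr2 addb (E 0 1 2 4 isT isT isT isT isT isT)%N
  (congr2 addb (E 0 1 3 4 isT isT isT isT isT isT)%N
  (congr2 addb (E 0 2 1 3 isT isT isT isT isT isT)%N
  (congr2 addb (E 0 2 1 4 isT isT isT isT isT isT)%N
  (congr2 addb (E 0 2 3 4 isT isT isT isT isT isT)%N
  (congr2 addb (E 0 3 1 2 isT isT isT isT isT isT)%N
  (congr2 addb (E 0 3 1 4 isT isT isT isT isT isT)%N
  (congr2 addb (E 0 3 2 4 isT isT isT isT isT isT)%N
  (congr2 addb (E 0 4 1 2 isT isT isT isT isT isT)%N
  (congr2 addb (E 0 4 1 3 isT isT isT isT isT isT)%N
  (congr2 addb (E 0 4 2 3 isT isT isT isT isT isT)%N
  (congr2 addb (E 1 2 3 4 isT isT isT isT isT isT)%N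
  (congr2 addb (E 1 3 2 4 isT isT isT isT isT isT)%N
  (E 1 4 2 3 isT isT isT isT isT isT)%N))))))))))))).
rewrite (ne 0 2 1 3 isT isT isT isT isT isT)%N in T.
rewrite (ne 0 3 1 2 isT isT isT isT isT isT)%N in T.
rewrite (ne 0 4 1 2 isT isT isT isT isT isT)%N in T.
rewrite (ne 0 3 2 4 isT isT isT isT isT isT)%N in T.
rewrite (ne 0 4 2 3 isT isT isT isT isT isT)%N in T.
rewrite (ne' 0 4 1 3 isT isT isT isT isT isT)%N in T.
parity_contradiction T.
Qed.

(* The 18 pairs of independent edges of the complete bipartite graph; only the
   terms comparing two vertices of the second side occur an odd number of times. *)
Theorem K33_chains_absurd (v w : nat -> R * R) (P : nat -> nat -> seq (R * R)) :
  (forall i j, i < 3 -> j < 3 -> P i j != [::] /\ last (v i) (P i j) = w j)%N ->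
  (forall i j k t, i < 3 -> j < 3 -> k < 3 -> t < 3 -> i != k -> j != t ->
    chains_apart (v i) (P i j) (v k) (P k t))%N -> False.
Proof.
move=> hP hd.
have E i j k t (h1 : (i < 3)%N) (h2 : (j < 3)%N) (h3 : (k < 3)%N) (h4 : (t < 3)%N)
    (h5 : i != k) (h6 : j != t) :
    under_chain (v i) (v k) (P k t) (+) under_chain (w j) (v k) (P k t) (+)
      under_chain (v k) (v i) (P i j) (+) under_chain (w t) (v i) (P i j) =
    left_of (v i) (v k) (+) left_of (w j) (v k) (+)
      left_of (v i) (w t) (+) left_of (w j) (w t).
  have := chain_parity (hd i j k t h1 h2 h3 h4 h5 h6).
  by rewrite (hP i j h1 h2).2 (hP k t h3 h4).2.
have ends i j k t (h1 : (i < 3)%N) (h2 : (j < 3)%N) (h3 : (k < 3)%N) (h4 : (t < 3)%N)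
    (h5 : i != k) (h6 : j != t) : [/\ left_of (w j) (v k) = ~~ left_of (v k) (w j),
      left_of (w t) (v i) = ~~ left_of (v i) (w t) &
      left_of (w t) (w j) = ~~ left_of (w j) (w t)].
  have [P0 Pl] := hP i j h1 h2; have [P0' Pl'] := hP k t h3 h4.
  have [] := chains_apart_ends P0 P0' (hd i j k t h1 h2 h3 h4 h5 h6).
  rewrite Pl Pl' => _ h h' h''; split; apply: left_of_total; rewrite // 1?eq_sym //.
have flip i j (hi : (i < 3)%N) (hj : (j < 3)%N) : left_of (w j) (v i) = ~~ left_of (v i) (w j).
  have [k hk ik] : exists2 k, (k < 3)%N & k != i.
    by exists (if i == 0 then 1 else 0)%N; case: (i) => [|[|]].
  have [t ht jt] : exists2 t, (t < 3)%N & j != t.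
    by exists (if j == 0 then 1 else 0)%N; case: (j) => [|[|]].
  by have [-> _ _] := ends k j i t hk hj hi ht ik jt.
have [_ _ e01] := ends 0 0 1 1 isT isT isT isT isT isT.
have [_ _ e02] := ends 0 0 1 2 isT isT isT isT isT isT.
have [_ _ e12] := ends 0 1 1 2 isT isT isT isT isT isT.
(* For fixed i and k, the six identities with j and t distinct leave only [S i], [S k] and three
   comparisons on the second side, each contributing 1. So [S i] and [S k] differ, and three
   booleans cannot be pairwise different. *)
pose S k := under_chain (w 0) (v k) (P k 1) (+) under_chain (w 1) (v k) (P k 0) (+)
  under_chain (w 0) (v k) (P k 2) (+) under_chain (w 2) (v k) (P k 0) (+)
  under_chain (w 1) (v k) (P k 2) (+) under_chain (w 2) (v k) (P k 1).
have T i k (h1 : (i < 3)%N) (h3 : (k < 3)%N) (h5 : i != k) : S k (+) S i.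
  have := congr2 addb (E i 0 k 1 h1 isT h3 isT h5 isT)%N
    (congr2 addb (E i 0 k 2 h1 isT h3 isT h5 isT)%N
    (congr2 addb (E i 1 k 0 h1 isT h3 isT h5 isT)%N
    (congr2 addb (E i 1 k 2 h1 isT h3 isT h5 isT)%N
    (congr2 addb (E i 2 k 0 h1 isT h3 isT h5 isT)%N
    (E i 2 k 1 h1 isT h3 isT h5 isT)%N)))).
  rewrite e01 e02 e12 /S.
  do 9 move: (under_chain _ (v i) _); do 9 move: (under_chain _ (v k) _).
  do 3 move: (left_of (w _) (v k)); do 3 move: (left_of (v i) (w _)).
  move: (left_of _ _) (left_of _ _) (left_of _ _) (left_of _ _) => *.
  match goal with H : ?L = ?M |- is_true ?S => have -> : S = ~~ (L (+) M) (+) false end.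
    xor_taut.
  by match goal with H : ?L = ?M |- _ => rewrite H addbb end.
have := T 0 1 isT isT isT; have := T 0 2 isT isT isT; have := T 1 2 isT isT isT.
by case: (S 0); case: (S 1); case: (S 2).
Qed.

End Chains.

(** * Planar graphs have no K_5 minor and no K_{3,3} *)

Section Plane.
Import Order.TTheory GRing.Theory Num.Theory numFieldNormedType.Exports.
Local Open Scope classical_set_scope.
Local Open Scope ring_scope.
Variable R : realType.
Implicit Types (p q r s : plane R) (S T : set (plane R)).

Lemma compact_separated S T : compact S -> compact T -> S `&` T = set0 ->
  exists2 e : R, 0 < e & forall s t, S s -> T t -> e <= `|s - t|.
Proof.
move=> cS cT dST.
have [ST0|/set0P ST0] := eqVneq (S `*` T) set0.
  by exists 1 => // s t Ss Tt; have : (S `*` T) (s, t) by []; rewrite ST0.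
have nc : {within S `*` T, continuous (fun z : plane R * plane R => `|z.1 - z.2|)}.
  apply: continuous_subspaceT => z; apply: cvg_norm; apply: cvgB.
    exact: cvg_fst.
  exact: cvg_snd.
have [[s t] /set_mem[/= Ss Tt] smin] := compact_EVT_min ST0 (compact_setX cS cT) nc.
exists `|s - t|.
  rewrite normr_gt0 subr_eq0; apply/eqP => st.
  have : (S `&` T) s by split; rewrite // st.
  by rewrite dST.
by move=> s' t' Ss' Tt'; apply: (smin (s', t')); apply: mem_set.
Qed.

Definition near_rel (e : R) : rel (plane R) := fun p q => `|p - q| < e.

(** The points reachable from [a] by such chains form a subset that is both open and closed in
    [S]. *)
Lemma connected_chain S a b (e : R) : connected S -> S a -> S b -> 0 < e ->
  exists l, [/\ path (near_rel e) a l, last a l = b & forall p, p \in l -> S p].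
Proof.
move=> cS Sa Sb e0.
pose A := [set x | S x /\ exists l, [/\ path (near_rel e) a l, last a l = x &
  forall p, p \in l -> S p]].
suff AS : A = S by have : A b by [rewrite AS]; case.
have step x y : A x -> S y -> `|x - y| < e -> A y.
  move=> [Sx [l [pl lx lS]]] Sy xy; split=> //; exists (rcons l y); split.
  - by rewrite rcons_path pl lx.
  - by rewrite last_rcons.
  - by move=> p; rewrite mem_rcons inE => /orP[/eqP->|/lS].
have ball_e x y : ball x e y = (`|x - y| < e) :> Prop by rewrite -ball_normE.
apply: cS.
- by exists a; split=> //; exists [::].
- exists (\bigcup_(x in A) ball x e); first by apply: bigcup_open => x _; apply: ball_open.
  apply/seteqP; split=> [x Ax|y [Sy [x Ax]]].
    by split; [case: Ax|exists x => //; apply: ballxx].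
  by rewrite ball_e; apply: step.
exists (~` \bigcup_(x in S `\` A) ball x e).
  by apply: open_closedC; apply: bigcup_open => x _; apply: ball_open.
apply/seteqP; split=> [x Ax|y [Sy yC]].
  split; first by case: Ax.
  by move=> [y [Sy nAy]]; rewrite ball_e distrC => yx; apply: nAy; apply: step Ax Sy yx.
apply: contrapT => nAy; apply: yC; exists y; last exact: ballxx.
by split.
Qed.

Lemma seg_point_near p q (t : R) : 0 <= t <= 1 -> `|p - seg_point p q t| <= `|p - q|.
Proof.
move=> /andP[t0 t1]; rewrite !prod_normE /seg_point /=.
have half (x y : R) : `|x - (x + t * (y - x))| <= `|x - y|.
  rewrite opprD addNKr -mulrN opprB normrM (ger0_norm t0) ler_piMl //.
by rewrite ge_max !le_max !half orbT.
Qed.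

(** A pair of points at different heights excludes the single value listed in [bad]; a number
    exceeding the sum of all absolute values avoids them. Points at equal height stay apart for
    every t. *)
Lemma fresh_shear (L : seq (plane R)) : exists t : R, forall p q, p \in L -> q \in L ->
  p != q -> p.1 + t * p.2 != q.1 + t * q.2.
Proof.
pose bad := [seq (p.1 - q.1) / (q.2 - p.2) | p <- L, q <- L].
exists (1 + \sum_(x <- bad) `|x|) => p q pL qL; set t := 1 + _; apply: contra => /eqP E.
have tbad : t \notin bad.
  apply/negP => tb; have : `|t| <= \sum_(x <- bad) `|x|.
    by rewrite (big_rem t tb) /= lerDl sumr_ge0.
  apply/negP; rewrite -ltNge; apply: lt_le_trans (ler_norm _).
  by rewrite /t ltrDr.
have [E2|ne] := eqVneq p.2 q.2.
  by rewrite [p]surjective_pairing [q]surjective_pairing E2; move: E; rewrite E2 => /addIr->.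
case/negP: tbad; have -> : t = (p.1 - q.1) / (q.2 - p.2).
  have d0 : q.2 - p.2 != 0 by rewrite subr_eq0 eq_sym.
  by apply: (mulIf d0); rewrite divfK //; lra.
exact: (allpairs_f (fun p q : plane R => (p.1 - q.1) / (q.2 - p.2)) pL qL).
Qed.

Definition shear (t : R) p : plane R := (p.1 + t * p.2, p.2).

Lemma shear_inj t : injective (shear t).
Proof. by move=> [x y] [x' y'] [] /= + E; rewrite E => /addIr->. Qed.

Lemma shear_seg_disjoint t p q r s :
  seg_disjoint p q r s -> seg_disjoint (shear t p) (shear t q) (shear t r) (shear t s).
Proof.
have sE u v x : seg_point (shear t u) (shear t v) x = shear t (seg_point u v x).
  by rewrite /seg_point /shear /=; congr (_, _); ring.
by move=> d x y hx hy; rewrite !sE => /shear_inj; apply: d.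
Qed.

Lemma chain_segment_near (e : R) a l p q : path (near_rel e) a l ->
  (p, q) \in chain_segments a l -> [/\ p \in a :: l, q \in a :: l & near_rel e p q].
Proof.
elim: l a => // b l IH a /= /andP[ab pl]; rewrite inE => /orP[/eqP[-> ->]|].
  by rewrite !inE !eqxx orbT.
move=> /(IH b pl)[ph qh pq]; split=> //; by rewrite inE (ph, qh) orbT.
Qed.

(* Disjoint compact connected sets carry polygonal chains whose segments stay
   apart; a shear makes the abscissas of distinct chain points distinct. *)
Theorem chains_of_continua (I : finType) (a b : I -> plane R) (S : I -> set (plane R))
    (ind : rel I) :
  (forall i, [/\ compact (S i), connected (S i), S i (a i) & S i (b i)]) ->
  (forall i j, ind i j -> S i `&` S j = set0) ->
  exists (t : R) (P : I -> seq (R * R)),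
    (forall i, P i != [::] /\ last (shear t (a i)) (P i) = shear t (b i)) /\
    (forall i j, ind i j -> chains_apart (shear t (a i)) (P i) (shear t (a j)) (P j)).
Proof.
move=> hS hind.
have [e e0 he] : exists2 e : R, 0 < e & forall i j, ind i j ->
    forall s r, S i s -> S j r -> e <= `|s - r|.
  have h (k : I * I) : exists e : R, 0 < e /\ (ind k.1 k.2 ->
      forall s r, S k.1 s -> S k.2 r -> e <= `|s - r|).
    have [hk|hk] := boolP (ind k.1 k.2); last by exists 1.
    have [c1 _ _ _] := hS k.1; have [c2 _ _ _] := hS k.2.
    by have [e e0 he] := compact_separated c1 c2 (hind _ _ hk); exists e.
  have [f hf] := choice h.
  exists (\big[Num.min/1]_k f k).
    by elim/big_ind: _ => // [x y x0 y0|k _]; [rewrite lt_min x0|case: (hf k)].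
  move=> i j ij s r Ss Sr; have [_ /(_ ij s r Ss Sr)] := hf (i, j); apply: le_trans.
  exact: bigmin_le_cond.
have e20 : 0 < e / 2 by rewrite divr_gt0.
have h i : exists l, [/\ path (near_rel (e / 2)) (a i) l, last (a i) l = b i &
    forall p, p \in l -> S i p].
  by have [_ cS Sa Sb] := hS i; apply: connected_chain.
(* Repeating the start makes the chain nonempty even if [l i] is empty; the extra segment
   degenerates to a point. *)
have [l hl] := choice h; pose P i := a i :: l i.
have PS i p : p \in a i :: P i -> S i p.
  have [_ _ Sa _] := hS i; have [_ _ lS] := hl i.
  by rewrite !inE orbA orbb => /orP[/eqP->|/lS].
have Ppath i : path (near_rel (e / 2)) (a i) (P i).
  by have [pl _ _] := hl i; rewrite /= /near_rel subrr normr0 e20.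
have PE i : P i != [::] /\ last (a i) (P i) = b i by have [_ <- _] := hl i.
clearbody P; pose L := flatten [seq a i :: P i | i <- enum I].
have [t ht] := fresh_shear L; have PL i p : p \in a i :: P i -> p \in L.
  by move=> pP; apply/flattenP; exists (a i :: P i) => //; apply/mapP; exists i; rewrite ?mem_enum.
exists t, (fun i => map (shear t) (P i)); split=> [i|i j ij].
  have [P0 lP] := PE i; rewrite last_map lP; split=> //.
  by case: (P i) P0.
move=> p q r s; rewrite /chain_segments.
have zipE x m : zip (map (shear t) (x :: m)) (map (shear t) m) =
    [seq (shear t z.1, shear t z.2) | z <- zip (x :: m) m].
  by elim: m x => //= y m IH x; rewrite -IH.
rewrite -(map_cons (shear t) (a i)) -(map_cons (shear t) (a j)) !zipE.
case/mapP => [[p' q'] hpq /= [-> ->]].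
case/mapP => [[r' s'] hrs /= [-> ->]].
have [pP qP pq] := chain_segment_near (Ppath i) hpq.
have [rP sP rs] := chain_segment_near (Ppath j) hrs.
have sep u v : u \in a i :: P i -> v \in a j :: P j -> u != v.
  move=> /PS uS /PS vS; apply/eqP => uv; have := he i j ij u v uS vS.
  by rewrite uv subrr normr0 leNgt e0.
have neq u v (uP : u \in a i :: P i) (vP : v \in a j :: P j) :
    (shear t u).1 != (shear t v).1.
  exact: ht (PL i u uP) (PL j v vP) (sep u v uP vP).
split; [exact: neq|exact: neq|exact: neq|exact: neq|].
apply: shear_seg_disjoint => x y hx hy E.
have := he i j ij p' r' (PS _ _ pP) (PS _ _ rP); apply/negP; rewrite -ltNge.
(* A common point would be closer than e / 2 to the first vertex of each segment, bringing two
   points of separated sets closer than e. *)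
have -> : p' - r' = (p' - seg_point p' q' x) + (seg_point r' s' y - r').
  by rewrite E addrA subrK.
apply: le_lt_trans (ler_normD _ _) _; rewrite [`|seg_point _ _ _ - _|]distrC.
have := seg_point_near p' q' hx; have := seg_point_near r' s' hy.
by move: pq rs; rewrite /near_rel; lra.
Qed.

End Plane.

(** * Drawings of vertex sets as continua *)

Section DrawnSets.
Import Order.TTheory GRing.Theory Num.Theory numFieldNormedType.Exports.
Local Open Scope classical_set_scope.
Local Open Scope ring_scope.
Variables (R : realType) (G : sgraph) (d : drawing R G).
Implicit Types (A B : {set G}).

Lemma simple_arc_continuum (a b : plane R) S : simple_arc a b S ->
  [/\ compact S, connected S, S a & S b].
Proof.
case=> g [gc gi <- <- <-]; split.
- exact: continuous_compact gc (@segment_compact R 0 1).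
- exact: connected_continuous_connected (@segment_connected R 0 1) gc.
- by exists 0 => //=; rewrite in_itv /= lexx ler01.
- by exists 1 => //=; rewrite in_itv /= lexx ler01.
Qed.

Definition drawn A : set (plane R) :=
  (\bigcup_(z in [set` A]) [set Defs.point d z]) `|`
  (\bigcup_(e in [set` [set e in edges G | e \subset A]%SET]) curve d e).

Lemma drawn_point A z : z \in A -> drawn A (Defs.point d z).
Proof. by move=> zA; left; exists z. Qed.

Lemma drawn_edge A x y : x \in A -> y \in A -> adj x y ->
  curve d [set x; y]%SET `<=` drawn A.
Proof.
move=> xA yA xy p pe; right; exists [set x; y]%SET => //=.
by rewrite inE edge_mem xy finset.subUset !finset.sub1set xA yA.
Qed.

Lemma drawn_compact A : compact (drawn A).
Proof.
apply: compactU.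
  rewrite (_ : [set` A] = [set` enum A]); last by apply/seteqP; split=> x /=; rewrite mem_enum.
  by rewrite bigcup_seq; apply: bigsetU_compact => z _; apply: compact_set1.
set E := [set e in _ | _]%SET.
rewrite (_ : [set` E] = [set` enum E]); last by apply/seteqP; split=> x /=; rewrite mem_enum.
rewrite bigcup_seq big_seq; apply: bigsetU_compact => e; rewrite mem_enum inE => /andP[eE _].
have /edgesP[x [y [xy ->]]] := eE.
by have [] := simple_arc_continuum (curve_arc d xy).
Qed.

Lemma drawn_connected A : induced_connected A -> connected (drawn A).
Proof.
move=> cA; have [A0|[x0 x0A]] := set_0Vmem A.
  rewrite (_ : drawn A = set0); first exact: connected0.
  apply/seteqP; split=> // p [[z /=]|[e /=]]; first by rewrite A0 inE.
  rewrite A0 inE => /andP[/edgesP[x [y [_ ->]]]].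
  by rewrite finset.subUset !finset.sub1set inE.
pose C := connected_component (drawn A) (Defs.point d x0).
have ptC z : z \in A -> C (Defs.point d z).
  have : A \subset [set z | `[< C (Defs.point d z) >]]%SET.
    apply: (connected_closed cA x0A).
      rewrite inE; apply/asboolP; apply: connected_component_refl; exact: drawn_point.
    move=> u v uA vA uv; rewrite !finset.inE => /asboolW Cu; apply/asboolP.
    have [_ cc cu cv] := simple_arc_continuum (curve_arc d uv).
    have h := connected_component_max cu (drawn_edge uA vA uv) cc cv.
    exact: connected_component_trans Cu h.
  by move=> /fintype.subsetP /(_ z) h /h; rewrite inE => /asboolP.
rewrite (_ : drawn A = C); first exact: component_connected.
apply/seteqP; split; last exact: connected_component_sub.
move=> p [[z /= zA ->]|[e /= + pe]]; first exact: ptC.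
rewrite inE => /andP[/edgesP[x [y [xy eE]]]]; rewrite eE in pe *.
rewrite finset.subUset !finset.sub1set => /andP[xA yA].
have [_ cc cx _] := simple_arc_continuum (curve_arc d xy).
have h := connected_component_max cx (drawn_edge xA yA xy) cc pe.
exact: (connected_component_trans (ptC x xA) h).
Qed.

(** Curves of distinct edges meet only in points of vertices, and such a vertex is an end of both
    edges. *)
Lemma drawn_disjoint A B : fintype.disjoint (mem A) (mem B) -> drawn A `&` drawn B = set0.
Proof.
move=> /pred0P dAB; have nAB z : z \in A -> z \in B -> False.
  by move=> zA zB; have := dAB z; rewrite /= zA zB.
have edge_point (D e : {set G}) (z : G) : e \in edges G -> e \subset D -> curve d e (Defs.point d z) -> z \in D.
  by move=> eE eD /(curve_point eE) ze; apply: (fintype.subsetP eD).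
apply/seteqP; split=> // p [[[z /= zA ->]|[e /= eA pe]] [[z' /= zB]|[e' /= eB pe']]].
- by move=> /point_inj zz; apply: (nAB z) => //; rewrite zz.
- by move: eB; rewrite inE => /andP[eE eB]; apply: (nAB z) => //; apply: edge_point pe'.
- by move=> pE; move: eA; rewrite inE => /andP[eE eA]; apply: (nAB z') => //;
    apply: edge_point eA _; rewrite // -pE.
move: eA eB; rewrite !inE => /andP[eE eA] /andP[e'E e'B].
have ne : e != e'.
  apply/eqP => ee; have /edgesP[x [y [_ xyE]]] := eE.
  have xe : x \in e by rewrite xyE !inE eqxx.
  by apply: (nAB x); [apply: (fintype.subsetP eA)|apply: (fintype.subsetP e'B); rewrite -ee].
have [z _ zp] := curve_disjoint eE e'E ne (conj pe pe').
rewrite -zp in pe pe'.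
by apply: (nAB z); [apply: edge_point eA pe|apply: edge_point e'B pe'].
Qed.

End DrawnSets.

Section Kuratowski.
Local Open Scope nat_scope.
Variables (R : realType) (G : sgraph).
Hypothesis planarG : planar R G.

(** The drawing of the union of two branch sets is a continuum joining their representatives. Unions
    for pairs without a common branch set are disjoint, and these are the only pairs that the parity
    argument compares. *)
Theorem planar_no_K5 : ~ complete_minor 5 G.
Proof.
case=> s [s5 hs]; have [d] := planarG.
pose V i : {set G} := nth finset.set0 s i.
have sV i : i < 5 -> V i \in s by move=> i5; apply: mem_nth; rewrite s5.
have [/allP h1 /(pairwiseP finset.set0) h2] := andP hs.
have V0 i : i < 5 -> exists x, x \in V i.
  by move=> /sV/h1/andP[/set0Pn].
have cV i : i < 5 -> induced_connected (V i) by move=> /sV/h1/andP[].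
have hij i j : i < 5 -> j < 5 -> i != j -> [disjoint V i & V j] && touching (V i) (V j).
  move=> i5 j5; case: (ltngtP i j) => // h _; first by apply: h2; rewrite ?inE ?s5.
  rewrite disjoint_sym touching_sym; by apply: h2; rewrite ?inE ?s5.
have [r rP] := choice (fun i : 'I_5 => V0 i (ltn_ord i)).
pose I := ('I_5 * 'I_5)%type.
pose S (k : I) := drawn d (V k.1 :|: V k.2).
pose ind (k l : I) := [&& k.1 != l.1, k.1 != l.2, k.2 != l.1 & k.2 != l.2].
have [|k l kl|t [P [hP hd]]] := @chains_of_continua R I
    (fun k => Defs.point d (r k.1)) (fun k => Defs.point d (r k.2)) S ind.
- move=> k; split; [exact: drawn_compact| | |]; last 2 first.
  + by apply: drawn_point; rewrite inE rP.
  + by apply: drawn_point; rewrite inE rP orbT.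
  apply: drawn_connected; have [->|ne] := eqVneq k.1 k.2.
    by rewrite finset.setUid; apply: cV.
  apply: connected_setU; [exact: cV|exact: cV|].
  by have /andP[] := hij k.1 k.2 (ltn_ord _) (ltn_ord _) ne.
- apply: drawn_disjoint; move: kl; rewrite /ind => /and4P[h11 h12 h21 h22].
  have dj (i j : 'I_5) z : i != j -> z \in V i -> z \in V j -> False.
    move=> ij zi zj; have /andP[/pred0P/(_ z)] := hij i j (ltn_ord _) (ltn_ord _) ij.
    by rewrite /= zi zj.
  apply/pred0P => z /=; rewrite !finset.inE; apply/negP.
  case/andP=> /orP[] h /orP[] h'; [apply: (dj k.1 l.1 z)|apply: (dj k.1 l.2 z)|
    apply: (dj k.2 l.1 z)|apply: (dj k.2 l.2 z)] => //.
apply: (@K5_chains_absurd R (fun i => shear t (Defs.point d (r (inord i))))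
  (fun i j => P (inord i, inord j))) => [i j _|i j k l /andP[ij j5] /andP[kl l5] ik il jk jl].
  exact: (hP (inord i, inord j)).
have i5 := ltn_trans ij j5; have k5 := ltn_trans kl l5.
apply: (hd (inord i, inord j) (inord k, inord l)).
have ne a b : a < 5 -> b < 5 -> a != b -> (inord a : 'I_5) != inord b.
  by move=> a5 b5; apply: contra => /eqP/(congr1 val); rewrite /= !inordK // => ->.
by rewrite /ind /= !ne.
Qed.

Theorem planar_K33_free : K33_free G.
Proof.
move=> A B A3 B3 hAB; have [d] := planarG.
have [a [ai aA]] : exists a : 'I_3 -> G, injective a /\ forall i, a i \in A.
  exists (fun i => enum_val (widen_ord A3 i)); split=> [i j /enum_val_inj|i]; last exact: enum_valP.
  by move=> /(congr1 val) /= /val_inj.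
have [b [bi bB]] : exists b : 'I_3 -> G, injective b /\ forall i, b i \in B.
  exists (fun i => enum_val (widen_ord B3 i)); split=> [i j /enum_val_inj|i]; last exact: enum_valP.
  by move=> /(congr1 val) /= /val_inj.
have ab i j : adj (a i) (b j) by apply: hAB.
have ab_ne i j : a i != b j by apply: adj_neq.
pose I := ('I_3 * 'I_3)%type.
pose S (k : I) := drawn d [set a k.1; b k.2].
pose ind (k l : I) := (k.1 != l.1) && (k.2 != l.2).
have [|k l kl|t [P [hP hd]]] := @chains_of_continua R I
    (fun k => Defs.point d (a k.1)) (fun k => Defs.point d (b k.2)) S ind.
- move=> k; split; [exact: drawn_compact| | |]; last 2 first.
  + by apply: drawn_point; rewrite !inE eqxx.
  + by apply: drawn_point; rewrite !inE eqxx orbT.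
  by apply: drawn_connected; apply: connected_edge.
- apply: drawn_disjoint; move: kl; rewrite /ind => /andP[h1 h2].
  apply/pred0P => z /=; rewrite !inE; apply/negP => /andP[/orP[] /eqP-> /orP[] /eqP h].
  + by rewrite (ai _ _ h) eqxx in h1.
  + by have := ab_ne k.1 l.2; rewrite h eqxx.
  + by have := ab_ne l.1 k.2; rewrite h eqxx.
  + by rewrite (bi _ _ h) eqxx in h2.
apply: (@K33_chains_absurd R (fun i => shear t (Defs.point d (a (inord i))))
  (fun i => shear t (Defs.point d (b (inord i))))
  (fun i j => P (inord i, inord j))) => [i j _ _|i j k l i3 j3 k3 l3 ik jl].
  exact: (hP (inord i, inord j)).
apply: (hd (inord i, inord j) (inord k, inord l)).
have ne x y : x < 3 -> y < 3 -> x != y -> (inord x : 'I_3) != inord y.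
  by move=> x3 y3; apply: contra => /eqP/(congr1 val); rewrite /= !inordK // => ->.
by rewrite /ind /= !ne.
Qed.

End Kuratowski.

(** * Inversion about a dominating vertex *)

Section Inversion.
Import Order.TTheory GRing.Theory Num.Theory numFieldNormedType.Exports.
Local Open Scope classical_set_scope.
Local Open Scope ring_scope.
Variable R : realType.
Implicit Types (p q c : plane R) (A : set (plane R)).

Lemma convex_connected A :
  (forall p q (t : R), A p -> A q -> 0 <= t <= 1 -> A (seg_point p q t)) -> connected A.
Proof.
move=> cA; have [->|/set0P[a Aa]] := eqVneq A set0; first exact: connected0.
have -> : A = \bigcup_(p in A) (seg_point a p @` `[0, 1]).
  apply/seteqP; split=> [p Ap|_ [p Ap [t /= t01 <-]]]; last first.
    by apply: cA => //; move: t01; rewrite in_itv.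
  exists p => //; exists 1; first by rewrite /= in_itv /= lexx ler01.
  by rewrite /seg_point !mul1r !subrKC -surjective_pairing.
apply: bigcup_connected.
  exists a => p Ap; exists 0; first by rewrite /= in_itv /= lexx ler01.
  by rewrite /seg_point !mul0r !addr0 -surjective_pairing.
move=> p Ap; have cc : {within `[0, 1], continuous (seg_point a p)}.
  apply: continuous_subspaceT => t.
  have h (x y : R) : (x + s * (y - x)) @[s --> t] --> x + t * (y - x).
    by apply: cvgD; [exact: cvg_cst|exact: mulrr_continuous].
  exact: cvg_pair (h a.1 p.1) (h a.2 p.2).
exact: connected_continuous_connected (@segment_connected R 0 1) cc.
Qed.

(** In the maximum norm this is a union of four half-planes, of which neighbouring ones
    intersect. *)
Lemma exterior_connected (M : R) : connected [set p : plane R | M < `|p|].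
Proof.
have half (f : plane R -> R) : (forall p q t, f (seg_point p q t) = f p + t * (f q - f p)) ->
    connected [set p | M < f p].
  move=> fl; apply: convex_connected => p q t /= hp hq /andP[t0 t1]; rewrite fl.
  by case: (ltP (f q) (f p)) => h; nra.
have c1 := half (fun p => p.1) (fun _ _ _ => erefl).
have c2 := half (fun p => p.2) (fun _ _ _ => erefl).
have c3 : connected [set p : plane R | M < - p.1].
  by apply: (half (fun p => - p.1)) => p q t; rewrite /seg_point /=; ring.
have c4 : connected [set p : plane R | M < - p.2].
  by apply: (half (fun p => - p.2)) => p q t; rewrite /seg_point /=; ring.
have M1 : M < M + 1 by rewrite ltrDl.
rewrite (_ : [set p | _] = [set p : plane R | M < p.1] `|` [set p : plane R | M < p.2] `|`
    [set p : plane R | M < - p.1] `|` [set p : plane R | M < - p.2]).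
  apply: connectedU => //; first by exists (M + 1, - (M + 1)); split; [left; left|rewrite /= opprK].
  apply: connectedU => //; first by exists (- (M + 1), M + 1); split; [right|rewrite /= opprK].
  by apply: connectedU => //; exists (M + 1, M + 1).
apply/seteqP; split=> p /=; rewrite prod_normE lt_max !ltr_normr.
  by case/orP => /orP[] h; [left; left; left|left; right|left; left; right|right].
by move=> [[[|]|]|] h; rewrite h ?orbT.
Qed.

(** The Euclidean square, whereas the norm of the product type is the maximum norm. *)
Definition sqnorm p : R := p.1 * p.1 + p.2 * p.2.

(** Inversion in the unit circle around [c], with [c] moved to the origin; it carries points near
    [c] far away. *)
Definition inversion c p : plane R := (sqnorm (p - c))^-1 *: (p - c).

Lemma sqnorm_gt0 p : p != 0 -> 0 < sqnorm p.
Proof.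
move=> p0; rewrite /sqnorm lt_def addr_ge0 ?andbT; try by rewrite -expr2 sqr_ge0.
rewrite paddr_eq0 -?expr2 ?sqr_ge0 // !sqrf_eq0.
by apply: contra p0 => /andP[/eqP h /eqP h']; rewrite [p]surjective_pairing h h'.
Qed.

Lemma inversion_inj c p q : p != c -> q != c -> inversion c p = inversion c q -> p = q.
Proof.
rewrite -subr_eq0 -(subr_eq0 q) /inversion => /sqnorm_gt0 p0 /sqnorm_gt0 q0 E.
apply: (addIr (- c)); move: p0 q0 E; move: (p - c) (q - c) => u v u0 v0 E.
(* Inversion inverts the squared length, so points with equal images have equal scaling factors. *)
have inv x : 0 < sqnorm x -> sqnorm ((sqnorm x)^-1 *: x) = (sqnorm x)^-1.
  move=> x0; rewrite {1}/sqnorm /= /GRing.scale /=.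
  rewrite (_ : _ + _ = (sqnorm x)^-1 * (sqnorm x)^-1 * sqnorm x); last by rewrite /sqnorm; ring.
  by rewrite mulfVK ?gt_eqF.
have : (sqnorm u)^-1 = (sqnorm v)^-1 by rewrite -(inv u u0) E inv.
by move=> h; move: E; rewrite h => /(scalerI _); apply; rewrite invr_eq0 gt_eqF.
Qed.

Lemma inversion_continuous c p : p != c -> {for p, continuous (inversion c)}.
Proof.
move=> pc; have subc : (fun q : plane R => q - c) x @[x --> p] --> p - c.
  by apply: cvgB; [exact: cvg_id|exact: cvg_cst].
have c1 : (x - c).1 @[x --> p] --> (p - c).1 by apply: cvg_comp subc _; exact: cvg_fst.
have c2 : (x - c).2 @[x --> p] --> (p - c).2 by apply: cvg_comp subc _; exact: cvg_snd.
apply: cvgZ => //; apply: cvgV.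
  by rewrite gt_eqF // sqnorm_gt0 // subr_eq0.
by apply: cvgD; apply: cvgM.
Qed.

(** The factor 2 compares the two norms: [sqnorm] is at most twice the square of the maximum
    norm. *)
Lemma norm_inversion_ge c p : p != c -> (2 * `|p - c|)^-1 <= `|inversion c p|.
Proof.
rewrite -subr_eq0 /inversion; move: (p - c) => u u0; have s0 := sqnorm_gt0 u0.
have n0 : 0 < `|u| by rewrite normr_gt0.
have i0 : 0 < (sqnorm u)^-1 by rewrite invr_gt0.
rewrite normrZ (gtr0_norm i0) ler_pdivlMl // ler_pdivrMr ?mulr_gt0 //.
have h (x : R) : `|x| <= `|u| -> x * x <= `|u| * `|u|.
  by move=> hx; rewrite -expr2 -real_normK ?num_real // expr2 ler_pM.
have h1 : `|u.1| <= `|u| by rewrite prod_normE le_max lexx.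
have h2 : `|u.2| <= `|u| by rewrite prod_normE le_max lexx orbT.
by have := h _ h1; have := h _ h2; rewrite /sqnorm; lra.
Qed.

End Inversion.

(** * Deleting a dominating vertex from a drawing *)

Section DominatingVertex.
Import Order.TTheory GRing.Theory Num.Theory numFieldNormedType.Exports.
Local Open Scope classical_set_scope.
Local Open Scope ring_scope.
Variables (R : realType) (G : sgraph) (d : drawing R G) (v : G).
Hypothesis dom : dominating v.

Let H := induced_graph (~: [set v])%SET.
Let c := Defs.point d v.
Let I := inversion c.

Let H_neq (z : H) : val z != v. Proof. by have := valP z; rewrite !finset.inE. Qed.

Let lift_edge (e : {set H}) : e \in edges H -> lift_set e \in edges G /\ v \notin lift_set e.
Proof.
move=> /edgesP[x [y [xy ->]]]; rewrite /lift_set finset.imsetU1 finset.imset_set1 edge_mem.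
split; first exact: xy.
by rewrite !finset.inE negb_or !(eq_sym v) !H_neq.
Qed.

Let curve_neq (e : {set G}) p : e \in edges G -> v \notin e -> curve d e p -> p != c.
Proof. by move=> eE ve pe; apply: contra ve => /eqP pc; rewrite pc in pe; exact: curve_point eE pe. Qed.

Let point_neq (x : G) : x != v -> Defs.point d x != c.
Proof. by apply: contra => /eqP /point_inj ->. Qed.

Let within_inversion (g : R -> plane R) (A : set R) :
  {within A, continuous g} -> (forall t, A t -> g t != c) -> {within A, continuous (I \o g)}.
Proof.
move=> gc gn; apply/subspace_continuousP => t At.
move/subspace_continuousP: gc => /(_ t At) gt.
exact: cvg_comp gt (inversion_continuous (gn t At)).
Qed.

Let ipoint (z : H) : plane R := I (Defs.point d (val z)).
Let icurve (e : {set H}) : set (plane R) := I @` curve d (lift_set e).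

Let ipoint_inj : injective ipoint.
Proof.
move=> x y /inversion_inj h; apply: val_inj; apply: (@point_inj _ _ d).
by apply: h; apply: point_neq.
Qed.

Let icurve_arc x y : adj x y -> simple_arc (ipoint x) (ipoint y) (icurve [set x; y]%SET).
Proof.
move=> xy; have [eE ve] := lift_edge (etrans (edge_mem x y) xy).
rewrite /icurve; move: eE ve; rewrite /lift_set finset.imsetU1 finset.imset_set1 => eE ve.
have [g [gc gi g0 g1 gS]] := @curve_arc _ _ d (val x) (val y) xy.
have gn t : `[0, 1]%classic t -> g t != c.
  by move=> t01; apply: (curve_neq eE ve); rewrite -gS; exists t.
exists (I \o g); split.
- exact: within_inversion.
- move=> s t s01 t01 /inversion_inj h; apply: gi => //; apply: h; apply: gn; exact: set_mem.
- by rewrite /= g0.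
- by rewrite /= g1.
- by rewrite -gS image_comp.
Qed.

Let icurve_point (e : {set H}) (z : H) : e \in edges H -> icurve e (ipoint z) -> z \in e.
Proof.
move=> eE [p pe /inversion_inj h]; have [lE vl] := lift_edge eE.
have pz : p = Defs.point d (val z) by apply: h; [apply: curve_neq pe|apply: point_neq].
rewrite pz in pe; have /imsetP[w we /val_inj ->] := curve_point lE pe.
exact: we.
Qed.

Let icurve_disjoint (e e' : {set H}) : e \in edges H -> e' \in edges H -> e != e' ->
  icurve e `&` icurve e' `<=` range ipoint.
Proof.
move=> eE e'E ee q [[p pe pq] [p' pe' p'q]].
have [lE vl] := lift_edge eE; have [lE' vl'] := lift_edge e'E.
have pp : p = p'.
  by apply: (@inversion_inj _ c); [apply: curve_neq pe|apply: curve_neq pe'|rewrite -/I pq].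
have ll : lift_set e != lift_set e' by rewrite (inj_eq (imset_inj val_inj)).
rewrite -pp in pe'; have [w _ wp] := curve_disjoint lE lE' ll (conj pe pe').
rewrite -wp in pe; have /imsetP[z ze wz] := curve_point lE pe.
by exists z => //; rewrite /ipoint -wz wp.
Qed.

Definition inverted_drawing : drawing R H :=
  Drawing ipoint_inj icurve_arc icurve_point icurve_disjoint.
Let d' := inverted_drawing.

(* Leaving [x] along its edge to [v], one goes to infinity in the inverted drawing. *)
Let spoke (x : H) : exists g : R -> plane R, [/\ {within `[0, 1], continuous g},
  g 0 = c, (forall t, 0 < t <= 1 -> g t != c), g 1 = Defs.point d (val x) &
  forall t, 0 < t < 1 -> ~ Defs.support d' (I (g t))].
Proof.
have vx : adj v (val x) by apply: dom; apply: H_neq.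
have [g [gc gi g0 g1 gS]] := curve_arc d vx.
have in01 (t : R) : 0 <= t <= 1 -> t \in `[0, 1]%classic.
  by move=> ht; apply/mem_set; rewrite /= in_itv.
have gn t : 0 < t <= 1 -> g t != c.
  move=> /andP[t0 t1]; apply/eqP => gt; have : t = 0; last by move=> h; rewrite h ltxx in t0.
  by apply: gi; rewrite ?in01 ?lexx ?ler01 ?(ltW t0) // g0.
have eE : [set v; val x]%SET \in edges G by rewrite edge_mem.
exists g; split=> // t /andP[t0 t1]; have gtc : g t != c by rewrite gn // t0 ltW.
have gt : curve d [set v; val x]%SET (g t).
  by rewrite -gS; exists t => //; rewrite /= in_itv /= !ltW.
have no_vertex (w : G) : g t <> Defs.point d w.
  move=> gw; rewrite gw in gt; have := curve_point eE gt; rewrite !finset.inE => /orP[] /eqP wE.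
    by rewrite gw wE eqxx in gtc.
  have : t = 1; last by move=> h; rewrite h ltxx in t1.
  by apply: gi; rewrite ?in01 ?lexx ?ler01 ?ltW // g1 gw wE.
move=> [[z _ /inversion_inj h]|[e /= eH [p pe /inversion_inj h]]].
  by apply: (no_vertex (val z)); apply/esym/h => //; apply: point_neq.
have [lE vl] := lift_edge eH; have pt : p = g t by apply: h => //; apply: curve_neq pe.
rewrite pt in pe; have ne : lift_set e != [set v; val x]%SET.
  by apply: contra vl => /eqP ->; rewrite !finset.inE eqxx.
by have [w _ /esym] := curve_disjoint lE eE ne (conj pe gt); apply: no_vertex.
Qed.

(** The new drawing is bounded, so the exterior of a large square lies in one face. The inverted
    edge from [v] to a vertex x, without its ends, is connected, avoids the drawing and reaches that
    exterior near [v]. So it lies in the same face, and its other end approaches x. *)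
Theorem outerplanar_del_dominating_drawing : outerplanar R H.
Proof.
have [M hM] : exists M : R, forall p, Defs.support d' p -> `|p| <= M.
  have := compact_bounded (@drawn_compact R H d' [set: H]%SET).
  move=> [M [_ /(_ (M + 1))]]; rewrite ltrDl => /(_ ltr01) h; exists (M + 1) => p sp.
  apply: h; case: sp => [[z _ <-]|[e /= eE pe]]; first by apply: drawn_point; rewrite finset.inE.
  by right; exists e => //=; rewrite finset.inE eE finset.subsetT.
pose E := [set p : plane R | M < `|p|].
have EM (r : R) : M < r -> 0 <= r -> E (r, 0).
  by move=> Mr r0; rewrite /E /= prod_normE /= lt_max ger0_norm // Mr.
pose r0 := `|M| + 1; have r00 : 0 <= r0 by rewrite addr_ge0.
have Mr0 : M < r0 by rewrite /r0 (le_lt_trans (ler_norm M)) // ltrDl.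
have Ep0 : E (r0, 0) by apply: EM.
have Esup : E `<=` ~` Defs.support d' by move=> p /= Mp /hM; rewrite leNgt Mp.
pose F := connected_component (~` Defs.support d') (r0, 0).
have EF : E `<=` F by apply: connected_component_max => //; exact: exterior_connected.
exists d', F; split.
- by exists (r0, 0) => //; apply: Esup.
- move=> [K [_ hK]]; have := hK (`|K| + 1); rewrite (le_lt_trans (ler_norm K)) ?ltrDl //.
  move=> /(_ isT) h; pose r := r0 + `|K| + 1.
  have r_ge : r0 <= r by rewrite /r -addrA lerDl addr_ge0.
  have /h /= : F (r, 0) by apply/EF/EM; [apply: lt_le_trans Mr0 _|apply: le_trans r_ge].
  rewrite prod_normE /= normr0 ge_max ger0_norm; last exact: le_trans r_ge.
  apply/negP; rewrite negb_and -!ltNge /r -addrA ltrDr.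
  by rewrite (_ : 0 < r0) // /r0 ltr_wpDl.
move=> x; split; last first.
  move=> /interior_subset /connected_component_sub; apply; left; by exists x.
have [g [gc g0 gn g1 gs]] := spoke x.
pose W := (I \o g) @` `]0, 1[.
have Wsup : W `<=` ~` Defs.support d'.
  by move=> _ [t /= + <-]; rewrite in_itv; apply: gs.
have Wc : connected W.
  apply: connected_continuous_connected.
    by apply/connected_intervalP; exact: interval_is_interval.
  apply: within_inversion => [|t]; last first.
    by rewrite /= in_itv /= => /andP[t0 t1]; apply: gn; rewrite t0 ltW.
  apply: continuous_subspaceW gc => t /=; rewrite !in_itv /= => /andP[t0 t1].
  by rewrite !ltW.
move/subspace_continuousP: (gc) => gcP.
have near01 (f : R -> plane R) (a : R) (B : set (plane R)) : 0 <= a <= 1 ->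
    f y @[y --> within `[0, 1] (nbhs a)] --> f a -> nbhs (f a) B ->
    exists2 t, 0 < t < 1 & B (f t).
  move=> /andP[a0 a1] fa /fa [e /= e0 he].
  (* The time moves inwards from [a] by s, to the right if a <= 1/2 and to the left otherwise; s <=
     1/3 keeps it strictly between 0 and 1. *)
  pose s := Num.min (e / 2) (1 / 3).
  have s0 : 0 < s by rewrite lt_min !divr_gt0.
  have se : s < e by rewrite gt_min ltr_pdivrMr // ltr_pMr // ltr1n.
  have s13 : s <= 1 / 3 by rewrite ge_min lexx orbT.
  have [a12|a12] := leP a (1 / 2).
    exists (a + s); first by apply/andP; split; lra.
    apply: he; last by rewrite /= in_itv /=; apply/andP; split; lra.
    by rewrite /ball_ /= opprD addNKr normrN gtr0_norm.
  exists (a - s); first by apply/andP; split; lra.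
  apply: he; last by rewrite /= in_itv /=; apply/andP; split; lra.
  by rewrite /ball_ /= opprB addrC subrK gtr0_norm.
have WE : exists2 q, W q & E q.
  (* Closer than e to the centre, inversion gives a norm of more than 1 / (2e) = r0 + 1, which
     exceeds M. *)
  pose e := (2 * (r0 + 1))^-1.
  have e0 : 0 < e by rewrite invr_gt0 mulr_gt0 // ltr_wpDl.
  have gc0 : g y @[y --> within `[0, 1] (nbhs (0 : R))] --> g 0.
    by apply: gcP; rewrite /= in_itv /= lexx ler01.
  have [|t t01 gt] := near01 g 0 _ _ gc0 (nbhsx_ballx (g 0) e e0); first by rewrite lexx ler01.
  exists (I (g t)); first by exists t.
  have gtc : g t != c by case/andP: t01 => t0 t1; apply: gn; rewrite t0 ltW.
  rewrite /E /=; apply: lt_le_trans (norm_inversion_ge gtc).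
  apply: (lt_trans Mr0); apply: (@lt_trans _ _ (r0 + 1)); first by rewrite ltrDl.
  have n0 : 0 < `|g t - c| by rewrite normr_gt0 subr_eq0.
  move: gt; rewrite g0 -ball_normE /ball_ /= distrC => gt.
  have h : 0 < 2 * (r0 + 1) by rewrite mulr_gt0 // ltr_wpDl.
  rewrite -[ltLHS]invrK ltf_pV2 ?posrE ?invr_gt0 ?mulr_gt0 ?ltr_wpDl //.
  have : 2 * `|g t - c| < 2 * e by rewrite ltr_pM2l.
  by rewrite /e invfM mulrA mulfV ?mul1r.
have WF : W `<=` F.
  have [q Wq Eq] := WE; move=> p Wp.
  apply: (@connected_component_max _ _ (W `|` E) (r0, 0)); [by right| | |by left].
    by move=> y [/Wsup|/Esup].
  by apply: connectedU => //; [exists q|exact: exterior_connected].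
move=> B nB; have x0 : 0 < (1 : R) by [].
have c1 : (I \o g) y @[y --> within `[0, 1] (nbhs (1 : R))] --> (I \o g) 1.
  have g1c : g 1 != c by apply: gn; rewrite lexx ltr01.
  have one : `[0, 1]%classic (1 : R) by rewrite /= in_itv /= lexx ler01.
  exact: cvg_comp (gcP 1 one) (inversion_continuous g1c).
have nB' : nbhs ((I \o g) 1) B by rewrite /= g1; exact: nB.
have [|t t01 Bt] := near01 (I \o g) 1 B _ c1 nB'; first by rewrite lexx ler01.
by exists (I (g t)); split=> //; apply: WF; exists t.
Qed.

End DominatingVertex.

Theorem outerplanar_del_dominating (R : realType) (G : sgraph) (v : G) :
  planar R G -> dominating v -> outerplanar R (induced_graph (~: [set v])%SET).
Proof. by case=> d dv; apply: outerplanar_del_dominating_drawing. Qed.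

Local Open Scope ring_scope.

Theorem theorem3p11 (R : realType) (G : sgraph)
    (G_connected : kconnected 1 G) (G_planar : planar R G) :
  let n : nat := #|G| in
  let m : nat := #|edges G| in
  (mc G)%:Z <= m%:Z - n%:Z + 4 /\
  [/\ (* (1) *)
      ~~ kconnected 2 G -> (mc G)%:Z = m%:Z - n%:Z + 2,
      (* (2): the triangle is excluded from the equivalence, which fails for
         it: there mc = 3 = m - n + 3, but an edge has no cut-vertex *)
      kconnected 2 G -> ~~ kconnected 3 G ->
        m%:Z - n%:Z + 2 <= (mc G)%:Z <= m%:Z - n%:Z + 3 /\
        (~ G ≅ complete 3 ->
         ((mc G)%:Z = m%:Z - n%:Z + 3 <-> P1 R G)),
      (* (3) *)
      kconnected 3 G -> ~~ kconnected 4 G ->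
        [/\ m%:Z - n%:Z + 2 <= (mc G)%:Z <= m%:Z - n%:Z + 4,
            (mc G)%:Z = m%:Z - n%:Z + 4 <->
              G ≅ complete 2 ∨ path_graph (n - 2)
          & (mc G)%:Z = m%:Z - n%:Z + 3 <->
              P2 R G \/ G ≅ edgeless 2 ∨ path_graph (n - 2)],
      (* (4) *)
      kconnected 4 G -> ~~ kconnected 5 G ->
        m%:Z - n%:Z + 2 <= (mc G)%:Z <= m%:Z - n%:Z + 3 /\
        ((mc G)%:Z = m%:Z - n%:Z + 3 <->
           G ≅ edgeless 2 ∨ cycle_graph (n - 2))
    & (* (5) *)
      kconnected 5 G -> (mc G)%:Z = m%:Z - n%:Z + 2].
Proof.
move=> n m.
have K5 := planar_no_K5 G_planar; have K33 := planar_K33_free G_planar.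
have outer v (dv : dominating v) := outerplanar_del_dominating G_planar dv.
have lower : (m + 2 <= mc G + n)%N := mc_ge_connected G_connected.
have upper : (mc G + n <= m + 4)%N := mc_upper G_connected K5.
(* Clearing the subtraction lets every case be settled in natural numbers. *)
have int_eq k : ((mc G)%:Z = m%:Z - n%:Z + k%:Z) <-> (mc G + n = m + k)%N by split; lia.
split; first lia.
split.
- by move=> nk2; apply/int_eq; exact: not_2connected_mc.
- move=> k2 nk3; have le3 := mc_2connected_le G_connected K5 nk3.
  split; first lia.
  move=> nK3.
  exact: iff_trans (int_eq 3) (mc_2connected_P1 G_connected K5 K33 outer k2 nk3 nK3).
- move=> k3 nk4; have [n4 _] := andP k3; split; first lia.
    exact: iff_trans (int_eq 4) (mc_hub_iso G_connected K5 K33 (ltnW n4) k3).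
  exact: iff_trans (int_eq 3) (mc_3connected G_connected K5 K33 outer k3 nk4).
- move=> k4 _; have le3 := mc_4connected_le G_connected K5 K33 k4.
  split; first lia.
  exact: iff_trans (int_eq 3) (mc_4connected G_connected K5 K33 k4).
- by move=> k5; apply/int_eq; exact: (mc_5connected G_connected K5 K33 k5).
Qed.
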